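(* Let $\alpha\in(0,1)$ and, for $n\ge3$, let $v_n:\mathbb R^2\to\mathbb R^2$ be the iterated deformation defined in the context. Then there exists $v\in W^{1,\infty}_{loc}(\mathbb R^2;\mathbb R^2)$ such that $v_n\to v$ in $W^{1,p}_{loc}(\mathbb R^2;\mathbb R^2)$ for each $p\ge1$ (with $p<\infty$), and $\nabla v=Q(\beta_0)$ on $\mathbb R^2\setminus B_1$, $\nabla v=Q(\beta_0)Q(\rho_0\log\frac12)$ on $B_{1/2}$, and $$\nabla v=Q(\rho_0\log r)\,Q(\omega)\bigl(a\,\bar e_{11}\otimes\bar e_{11}+a^{-1}\bar e_{11}^\perp\otimes\bar e_{11}^\perp\bigr)Q^T(\omega)\qquad\text{in }B_1\setminus B_{1/2},$$ where $\rho_0=\frac{2\alpha-1}{\sqrt{\alpha(1-\alpha)}}$, $\beta_0=\sin^{-1}(1-2\alpha)$, $r=|x|$, $\omega=\arctan\bigl(\frac{x\cdot e_2}{x\cdot e_1}\bigr)$, $a=\sqrt{\frac{1-\alpha}{\alpha}}$ and $\bar e_{11}=(\sqrt{1-\alpha},-\sqrt\alpha)$.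
   Context: $\{e_1,e_2\}$ is the standard orthonormal basis of $\mathbb R^2$, $B_r$ is the open ball of radius $r$ centred at $0$, $Q(s)\in SO(2)$ is the counterclockwise rotation by angle $s$, and for a unit vector $e$, $e^\perp=Q(\pi/2)e$. Gradient identities are understood a.e. Definition of $v_n$ (for fixed $\alpha\in(0,1)$). For $n\ge3$ write $Q_s:=Q(\frac{2\pi}{n}s)$. Set $r_E=1$, $r_I=\frac{1}{\cos(\pi/n)}\bigl(\cos(\frac{\pi}{n}(1-2\alpha))-\sqrt{\sin(\frac{2\pi}{n}\alpha)\sin(\frac{2\pi}{n}(1-\alpha))}\bigr)$, $a_n=\sqrt{\sin(\frac{2\pi}{n}(1-\alpha))/\sin(\frac{2\pi}{n}\alpha)}$, and $R_*=Q(\frac{2\pi}{n}(1-2\alpha))$. Let $E_i=Q_{i-1}e_1$, $I_i=r_IQ_{i-1+\alpha}e_1$ ($i=1,\dots,n$), $E_{n+1}=E_1$, $I_0=I_n$; let $\Omega_n^E,\Omega_n^I$ be the convex hulls of the $E_i$ and of the $I_i$, and $\Omega_n$ the interior of $\Omega_n^E\setminus\Omega_n^I$. $T_j$ ($1\le j\le2n$) is the open triangle with vertices $E_{(j+1)/2},I_{(j-1)/2},I_{(j+1)/2}$ ($j$ odd) or $E_{j/2},I_{j/2},E_{1+j/2}$ ($j$ even). Let $e_{11}=\frac{I_1-E_1}{|I_1-E_1|}$, $P_0=e_{11}\otimes e_{11}-e_{11}^\perp\otimes e_{11}^\perp$, $\phi=\frac{(n-2)\pi}{2n}$ and $U=a_n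 e_{11}\otimes e_{11}+a_n^{-1}e_{11}^\perp\otimes e_{11}^\perp+\frac{a_n^{-1}-a_n}{\tan\phi}e_{11}\otimes e_{11}^\perp$. Let $u=u_n\in W^{1,\infty}_{loc}(\mathbb R^2;\mathbb R^2)$ and $R_E\in SO(2)$ be such that $u(x)=x$ outside $\Omega_n^E$, $u(x)=R_*x$ in $\Omega_n^I$, and $R_E\nabla u=Q_{\frac{j-1}{2}}UQ_{\frac{j-1}{2}}^T$ on $T_j$ for $j$ odd, $R_E\nabla u=Q_{\frac{j-2}{2}}P_0UP_0Q_{\frac{j-2}{2}}^T$ on $T_j$ for $j$ even (such $u$, $R_E$ exist and are unique). Let $N_n=\inf\{N\in\mathbb N: r_I^N\le\frac12\}$ and $\Sigma_k=r_I^kQ_\alpha^k\Omega_n$. Then $$v_n(x)=\sum_{k=0}^{N_n}r_I^kR_ER_*^kQ_\alpha^k\,u(r_I^{-k}Q_{-\alpha}^kx)\chi_{\Sigma_k}(x)+R_Ex\,\chi_{\mathbb R^2\setminus\Sigma_0^{co}}(x)+R_ER_*^{N_n+1}x\,\chi_{\overline{\Sigma}^{co}_{N_n+1}}(x),$$ extended continuously to the (null) boundaries between rings; $\chi_B$ is the indicator function of $B$ and $A^{co}$ the convex hull of $A$. *)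

(* Defs.v *)
From HB Require Import structures.
From mathcomp Require Import all_boot all_order all_algebra.
From mathcomp Require Import all_classical all_reals all_analysis.
Set Implicit Arguments.
Unset Strict Implicit.
Unset Printing Implicit Defensive.
Import Order.TTheory GRing.Theory Num.Theory.
Import numFieldNormedType.Exports.
Local Open Scope classical_set_scope.
Local Open Scope ring_scope.

(* Points of the plane are pairs, because the product type carries both the
   topology and the (product Lebesgue) measure.  The library norm on [R * R]
   is the max norm, so the Euclidean length [enorm] is defined separately. *)
Notation plane R := (R * R)%type (only parsing).

Section Plane.
Context {R : realType}.
Implicit Types (x y e : plane R) (A : 'M[R]_2) (s : R).

Definition coord (i : 'I_2) x : R := if i == ord0 then x.1 else x.2.

Definition basis (j : 'I_2) : plane R := if j == ord0 then (1, 0) else (0, 1).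
Definition e1 : plane R := basis ord0.

Definition mxact A x : plane R :=
  (A ord0 ord0 * x.1 + A ord0 ord_max * x.2,
   A ord_max ord0 * x.1 + A ord_max ord_max * x.2).

Definition tensor x y : 'M[R]_2 := \matrix_(i, j) (coord i x * coord j y).

Definition enorm x : R := Num.sqrt (x.1 ^+ 2 + x.2 ^+ 2).

Definition rotation s : 'M[R]_2 :=
  \matrix_(i, j) (if i == j then cos s
                  else if i == ord0 then - sin s else sin s).

Definition perp e : plane R := mxact (rotation (pi / 2)) e.

Definition SO2 A : Prop := A *m A^T = 1%:M /\ \det A = 1.

Definition convex_hull (S : set (plane R)) : set (plane R) :=
  smallest (@convex_set R (plane R)) S.

Definition eball (r : R) : set (plane R) := [set x | enorm x < r].

End Plane.

Section Sobolev.
Context {R : realType}.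

Definition lebesgue2 :
    {measure set (measurableTypeR R * measurableTypeR R)%type -> \bar R} :=
  (@lebesgue_measure R \x @lebesgue_measure R)%E.

Definition iter_deriv (s : seq (plane R)) (f : plane R -> R) : plane R -> R :=
  foldr (fun e g => 'D_e g) f s.

Definition smooth (f : plane R -> R) : Prop :=
  forall s : seq (plane R), continuous (iter_deriv s f) /\
    forall x e, derivable (iter_deriv s f) x e.

Definition test_function (f : plane R -> R) : Prop :=
  smooth f /\
  exists K : set (plane R), compact K /\ forall x, ~ K x -> f x = 0.

Definition weak_partial (j : 'I_2) (f g : plane R -> R) : Prop :=
  forall psi : plane R -> R, test_function psi ->
    (\int[lebesgue2]_x (f x * 'D_(basis j) psi x)%:E =
     - \int[lebesgue2]_x (g x * psi x)%:E)%E.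

Definition Lloc (p : \bar R) (f : plane R -> R) : Prop :=
  measurable_fun setT f /\
  forall K : set (plane R), compact K -> finite_norm lebesgue2 p (f \_ K).

(* [v] belongs to $W^{1,p}_{loc}(\mathbb R^2; \mathbb R^2)$ and [G] is (a
   representative of) its weak gradient, with the convention
   [G x i j] $= \partial_j v_i (x)$. *)
Definition W1loc (p : \bar R) (v : plane R -> plane R)
    (G : plane R -> 'M[R]_2) : Prop :=
  [/\ forall i, Lloc p (coord i \o v),
      forall i j, Lloc p (fun x => G x i j) &
      forall i j, weak_partial j (coord i \o v) (fun x => G x i j)].

Definition Lloc_cvg (p : \bar R) (f_ : nat -> plane R -> R)
    (f : plane R -> R) : Prop :=
  forall K : set (plane R), compact K ->
    (fun m => Lnorm lebesgue2 p (EFin \o ((f_ m \- f) \_ K))) @ \oo --> 0%E.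

Definition W1loc_cvg (p : \bar R) (v_ : nat -> plane R -> plane R)
    (v : plane R -> plane R) : Prop :=
  exists (G_ : nat -> plane R -> 'M[R]_2) (G : plane R -> 'M[R]_2),
    [/\ forall m, W1loc p (v_ m) (G_ m),
        W1loc p v G,
        forall i, Lloc_cvg p (fun m => coord i \o v_ m) (coord i \o v) &
        forall i j, Lloc_cvg p (fun m x => G_ m x i j) (fun x => G x i j)].

End Sobolev.

Section Rings.
Context {R : realType}.
Variables (alpha : R) (n : nat).

Definition theta : R := 2 * pi / n%:R.

Definition Qn (s : R) : 'M[R]_2 := rotation (theta * s).

Definition r_I : R :=
  (cos (pi / n%:R * (1 - 2 * alpha))
   - Num.sqrt (sin (theta * alpha) * sin (theta * (1 - alpha))))
  / cos (pi / n%:R).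

Definition a_n : R :=
  Num.sqrt (sin (theta * (1 - alpha)) / sin (theta * alpha)).

Definition R_star : 'M[R]_2 := rotation (theta * (1 - 2 * alpha)).

(* Since [Qn] is $n$-periodic, the conventions $E_{n+1} = E_1$ and $I_0 = I_n$
   hold automatically. *)
Definition E_pt (i : nat) : plane R := mxact (Qn (i%:R - 1)) e1.
Definition I_pt (i : nat) : plane R := r_I *: mxact (Qn (i%:R - 1 + alpha)) e1.

Definition OmegaE : set (plane R) :=
  convex_hull [set E_pt i | i in [set i | (1 <= i <= n)%N]].
Definition OmegaI : set (plane R) :=
  convex_hull [set I_pt i | i in [set i | (1 <= i <= n)%N]].
Definition Omega : set (plane R) := interior (OmegaE `\` OmegaI).

Definition open_triangle (a b c : plane R) : set (plane R) :=
  interior (convex_hull [set x | [\/ x = a, x = b | x = c]]).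

Definition T_ (j : nat) : set (plane R) :=
  if odd j then open_triangle (E_pt j.+1./2) (I_pt j.-1./2) (I_pt j.+1./2)
  else open_triangle (E_pt j./2) (I_pt j./2) (E_pt (1 + j./2)).

Definition e11 : plane R :=
  (enorm (I_pt 1 - E_pt 1))^-1 *: (I_pt 1 - E_pt 1).

Definition P0 : 'M[R]_2 := tensor e11 e11 - tensor (perp e11) (perp e11).

Definition phi : R := (n%:R - 2) * pi / (2 * n%:R).

Definition U : 'M[R]_2 :=
  a_n *: tensor e11 e11 + a_n^-1 *: tensor (perp e11) (perp e11)
  + ((a_n^-1 - a_n) / tan phi) *: tensor e11 (perp e11).

Definition ring_gradient (j : nat) : 'M[R]_2 :=
  if odd j then Qn ((j%:R - 1) / 2) *m U *m (Qn ((j%:R - 1) / 2))^T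
  else Qn ((j%:R - 2) / 2) *m (P0 *m U *m P0) *m (Qn ((j%:R - 2) / 2))^T.

(* [u] is the continuous representative of its $W^{1,\infty}_{loc}$ class. *)
Definition ring_deformation (u : plane R -> plane R) (RE : 'M[R]_2) : Prop :=
  [/\ SO2 RE,
      continuous u,
      forall x, ~ OmegaE x -> u x = x,
      forall x, OmegaI x -> u x = mxact R_star x &
      exists2 G : plane R -> 'M[R]_2, W1loc +oo%E u G &
        forall j, (1 <= j <= 2 * n)%N ->
          {ae lebesgue2, forall x, T_ j x -> RE *m G x = ring_gradient j}].

Definition N_n : nat :=
  xget 0%N [set N | r_I ^+ N <= 1 / 2 /\
                    forall m, r_I ^+ m <= 1 / 2 -> (N <= m)%N].

Definition Sigma (k : nat) : set (plane R) :=
  [set r_I ^+ k *: mxact (Qn alpha ^+ k) x | x in Omega].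

Definition outer : set (plane R) := ~` convex_hull (Sigma 0).
Definition core : set (plane R) := convex_hull (closure (Sigma N_n.+1)).

Definition v_sum (u : plane R -> plane R) (RE : 'M[R]_2) (x : plane R) :
    plane R :=
  \sum_(0 <= k < N_n.+1)
     (\1_(Sigma k) x : R) *:
       (r_I ^+ k *: mxact (RE *m R_star ^+ k *m Qn alpha ^+ k)
          (u (r_I ^- k *: mxact (Qn (- alpha) ^+ k) x)))
  + (\1_outer x : R) *: mxact RE x
  + (\1_core x : R) *: mxact (RE *m R_star ^+ N_n.+1) x.

Definition v_domain : set (plane R) :=
  (\bigcup_(k in [set k | (k <= N_n)%N]) Sigma k) `|` outer `|` core.

(* Off [v_domain], that is on the boundaries between consecutive rings, all the
   indicators in [v_sum] vanish, and the value is the limit of [v_sum] along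
   [v_domain]. *)
Definition v_n (u : plane R -> plane R) (RE : 'M[R]_2) (x : plane R) :
    plane R :=
  if x \in v_domain then v_sum u RE x
  else xget 0 [set l : plane R | v_sum u RE @ within v_domain (nbhs x) --> l].

End Rings.

Section LimitGradient.
Context {R : realType}.
Variable alpha : R.

Definition rho0 : R := (2 * alpha - 1) / Num.sqrt (alpha * (1 - alpha)).
Definition beta0 : R := asin (1 - 2 * alpha).
Definition a_lim : R := Num.sqrt ((1 - alpha) / alpha).
Definition ebar11 : plane R := (Num.sqrt (1 - alpha), - Num.sqrt alpha).

(* The value of [omega] on the null line [x.1 = 0] is irrelevant. *)
Definition omega (x : plane R) : R := atan (x.2 / x.1).

Definition annulus_gradient (x : plane R) : 'M[R]_2 :=
  rotation (rho0 * ln (enorm x)) *m rotation (omega x) *m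
  (a_lim *: tensor ebar11 ebar11
   + a_lim^-1 *: tensor (perp ebar11) (perp ebar11)) *m
  (rotation (omega x))^T.

End LimitGradient.

(* Main.v *)
Require Import Defs.
From mathcomp Require Import all_boot all_order all_algebra.
From mathcomp Require Import all_classical all_reals all_analysis.
From mathcomp Require Import measurable_realfun ess_sup_inf.
From mathcomp Require Import ring lra.
Import Order.TTheory GRing.Theory Num.Theory.
Import numFieldNormedType.Exports.
Set Implicit Arguments.
Unset Strict Implicit.
Unset Printing Implicit Defensive.
Local Open Scope classical_set_scope.
Local Open Scope ring_scope.
Local Notation basis := Defs.basis.
Local Notation coord := Defs.coord.

(** The sum that defines the iterated deformation has, at every point, at most
    one nonzero term, and the deformation agrees with one continuous map
    ([v_n_iterated]): R_E outside the large polygon, a rotation inside the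
    smallest one, and, on the ring of index k, the rescaled copy of u turned by
    the accumulated rotation.  The triangles T_j cover a ring ([ring_cover]), and
    a continuous map whose weak gradient is constant on a convex open set is
    affine there ([affine_of_weak_gradient]), so u is affine on each of them.
    Hence the iterated map is affine near almost every point, with an explicit
    matrix ([ae_affine_near]): on a triangle of the ring of index k whose first
    outer vertex has polar angle psi it is Q(k gamma) Q(psi) V Q(psi)^T, where
    gamma = theta (1 - 2 alpha), theta = 2 pi / n and V is U or P_0 U P_0.

    As n grows the rings become thin.  With s = sqrt (alpha (1 - alpha)) one has
    (1 - r_I) / theta -> s ([cvg_1r]).  The ring through a fixed x of norm rho
    in (1/2, 1) has an index k with r_I^k -> rho, so k theta -> - ln rho / s and
    the accumulated angle k gamma tends to rho_0 ln rho ([cvg_angle]).  Since the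
    triangles shrink to points, psi tends to the polar angle of x; both choices of
    V have the limit a e (x) e + a^-1 e' (x) e', with e = ebar11 and e' = e^perp
    ([mxcvg_stretch]).  Finally u fixes the outer vertices, which determines the
    rotation R_E and gives R_E -> Q(beta_0) ([cvg_RE]).  So the maps and
    their gradients converge at almost every point ([limits_out], [limits_in],
    [limits_mid]).

    The maps are also Lipschitz with a common constant ([iterated_lip],
    [cvg_lip_bound]).  Dominated convergence then gives convergence in every
    W^{1,p} on compact sets and carries the weak formulation to the limit, whose
    weak gradient is the pointwise limit of the gradients ([W1loc_limit]). *)

(** * Translation invariance of planar Lebesgue measure *)

Section PlaneMeasure.
Context {R : realType}.
Notation mR := (measurableTypeR R).

(** An open set is the countable union of the rational boxes that it contains. *)
Lemma open_measurable2 (U : set (R * R)) : open U ->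
  measurable (U : set (mR * mR)).
Proof.
move=> oU.
pose B (p q : rat) (k : nat) : set (mR * mR) :=
  ball (ratr p : R) (k.+1%:R^-1) `*` ball (ratr q : R) (k.+1%:R^-1).
pose C p q k := if pselect (B p q k `<=` U) then B p q k else set0.
have -> : U = \bigcup_p \bigcup_q \bigcup_k C p q k.
  apply/seteqP; split => [[x y] Uxy|[x y] [p _ [q _ [k _]]]]; last first.
    by rewrite /C; case: pselect => // h /h.
  have /nbhs_ballP[/= e e0 eU] : nbhs ((x, y) : R * R) U.
    by apply: open_nbhs_nbhs; split.
  have [k] : exists k : nat, (k.+1%:R^-1 : R) < e / 2.
    by have [k _ /(_ k (leqnn k))] := near_infty_natSinv_lt (PosNum (divr_gt0 e0 (ltr0n _ 2))); exists k.
  move=> ke.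
  have hr (z : R) : exists p : rat, ball (ratr p : R) (k.+1%:R^-1) z.
    have : z - k.+1%:R^-1 < z + k.+1%:R^-1 by rewrite ltrD2l gtrN.
    move=> /rat_in_itvoo[p]; rewrite in_itv/= => /andP[p1 p2]; exists p.
    by rewrite /ball/= ltr_distl p1 p2.
  have [p hp] := hr x; have [q hq] := hr y.
  exists p => //; exists q => //; exists k => //.
  rewrite /C; case: pselect; first by move=> ?; split.
  case=> -[a b] [/= ha hb]; apply: eU; split => /=.
    rewrite /= (splitr e); apply: ball_triangle (le_ball (ltW ke) (ball_sym hp)) _.
    exact: (le_ball (ltW ke)).
  rewrite /= (splitr e); apply: ball_triangle (le_ball (ltW ke) (ball_sym hq)) _.
  exact: (le_ball (ltW ke)).
apply: bigcupT_measurable_rat => p.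
apply: bigcupT_measurable_rat => q.
apply: bigcupT_measurable => k.
rewrite /C; case: pselect => [h|h] /=; last exact: measurable0.
by apply: measurableX; apply: open_measurable; exact: ball_open.
Qed.

Lemma closed_measurable2 (A : set (R * R)) : closed A ->
  measurable (A : set (mR * mR)).
Proof. by move/closed_openC/open_measurable2/measurableC; rewrite setCK. Qed.

Lemma compact_measurable2 (A : set (R * R)) : compact A ->
  measurable (A : set (mR * mR)).
Proof.
move=> cA; have cl : closed (A : set (R * R)).
  exact: (compact_closed (@norm_hausdorff _ (R * R)%type) cA).
exact: (closed_measurable2 cl).
Qed.

Lemma continuous_measurable2 (f : R * R -> R) : continuous f ->
  measurable_fun setT (f : mR * mR -> mR).
Proof.
move=> /continuousP cf; apply: (measurability _ (RGenOpens.measurableE R)).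
move=> _ [_ [a [b ->] <-]]; rewrite setTI; apply: open_measurable2.
exact/cf/interval_open.
Qed.

Lemma measurable_shift (c : R) : measurable_fun [set: mR] (fun x : mR => (x + c)%R : mR).
Proof. by apply: measurable_funD. Qed.

(** Half-open intervals have the same length after a translation, and they
    determine the measure. *)
Lemma lebesgue_measure_shift (c : R) (A : set R) : measurable (A : set mR) ->
  pushforward (@lebesgue_measure R) (fun x : mR => (x + c)%R : mR) A = lebesgue_measure A.
Proof.
have mc := measurable_shift c.
pose m := pushforward (@lebesgue_measure R) (fun x : mR => (x + c)%R : mR).
move=> mA; apply/esym/lebesgue_measure_unique => //= _ [[a b]] _ <-.
rewrite /pushforward /=.
have -> : (fun x : mR => (x + c)%R) @^-1` `]a, b] = `](a - c)%R, (b - c)%R]%classic.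
  by apply/seteqP; split => x /=; rewrite !in_itv/= ltrBlDr lerBrDr.
by rewrite !lebesgue_measure_itv/= !lte_fin ltrD2r -!EFinB opprB addrA subrK.
Qed.

Definition shift2 (v : R * R) : mR * mR -> mR * mR := fun x => (x.1 + v.1, x.2 + v.2)%R.

Lemma measurable_shift2 v : measurable_fun [set: mR * mR] (shift2 v).
Proof.
apply: measurable_fun_pair => /=.
  exact: (measurableT_comp (measurable_shift v.1) measurable_fst).
exact: (measurableT_comp (measurable_shift v.2) measurable_snd).
Qed.

Lemma lebesgue2_shift v (A : set (mR * mR)) : measurable A ->
  pushforward (@lebesgue2 R) (shift2 v) A = lebesgue2 A.
Proof.
have mv := measurable_shift2 v.
move=> mA; apply/esym/product_measure_unique => //= B C mB mC.
rewrite -(lebesgue_measure_shift v.1)// -(lebesgue_measure_shift v.2)//.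
rewrite /pushforward /= -product_measure1E.
- by [].
- by rewrite -[X in measurable X]setTI; exact: measurable_shift.
- by rewrite -[X in measurable X]setTI; exact: measurable_shift.
Qed.

(** Change of variables for nonnegative functions, applied to the positive and
    the negative part. *)
Lemma integral_measure_preserving d (T : measurableType d) (mu : {measure set T -> \bar R})
    (phi : T -> T) (f : T -> \bar R) :
  measurable_fun setT phi ->
  (forall A, measurable A -> pushforward mu phi A = mu A) ->
  measurable_fun setT f ->
  (\int[mu]_x f (phi x) = \int[mu]_x f x)%E.
Proof.
move=> mphi mu_phi mf.
have pos (g : T -> \bar R) : (forall x, 0 <= g x)%E -> measurable_fun setT g ->
  (\int[mu]_x g (phi x) = \int[mu]_x g x)%E.
  move=> g0 mg.
  have := @ge0_integral_pushforward _ _ _ _ R _ mphi mu setT g.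
  rewrite preimage_setT => <- //.
  by apply: eq_measure_integral => //= A mA _; exact: mu_phi.
rewrite integralE [RHS]integralE.
rewrite -(pos (f^\+)%E)//; last exact: measurable_funepos.
rewrite -(pos (f^\-)%E)//; last exact: measurable_funeneg.
congr (_ - _)%E; apply: eq_integral => x _; rewrite -[fun y => f (phi y)]/(f \o phi).
  by rewrite funepos_comp.
by rewrite funeneg_comp.
Qed.

Lemma integral_shift2 v (f : mR * mR -> \bar R) : measurable_fun setT f ->
  (\int[lebesgue2]_x f (shift2 v x) = \int[lebesgue2]_x f x)%E.
Proof.
move=> mf; apply: integral_measure_preserving => //.
- exact: measurable_shift2.
- exact: lebesgue2_shift.
Qed.

End PlaneMeasure.

(** * Local integrability and dominated convergence *)

Section DominatedLp.
Context {R : realType} d (T : measurableType d) (mu : {measure set T -> \bar R}).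

Lemma finite_norm_bounded (p : \bar R) (f : T -> R) (K : set T) (M : R) : (0 < p)%E ->
  measurable K -> (mu K < +oo)%E -> measurable_fun setT f ->
  (forall x, K x -> `|f x| <= M) -> finite_norm mu p (f \_ K).
Proof.
move=> p0 mK Kfin mf hM; rewrite /finite_norm.
case: p p0 => [p|_|]; last by rewrite ltNge leNye.
- rewrite lte_fin => p0; rewrite unlock poweR_lty//.
  apply: (@le_lt_trans _ _ (\int[mu]_(x in K) (`|M| `^ p)%:E)%E).
    rewrite [leRHS]integral_mkcond; apply: ge0_le_integral => //.
    + by move=> x _; rewrite poweR_ge0.
    + apply: (@measurableT_comp _ _ _ _ _ _ (fun x => x `^ p)%E); first exact: measurable_poweR.
      apply: measurableT_comp => //; apply/measurable_EFinP.
      by apply/(measurable_restrictT _ _).1 => //; apply: measurable_funTS.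
    + exact/(measurable_restrictT _ _).1.
    + move=> x _; rewrite /= !patchE; case: ifPn => xK.
        rewrite lee_fin; apply: ge0_ler_powR; rewrite ?nnegrE ?(ltW p0)//.
        by apply: le_trans (ler_norm M); apply: hM; rewrite -inE.
      by rewrite /point /= normr0 powR0 ?gt_eqF.
  by rewrite integral_cst// lte_mul_pinfty ?lee_fin ?powR_ge0.
- rewrite unlock; case: ifP => // _.
  apply: (@le_lt_trans _ _ (`|M|)%:E); last exact: ltry.
  apply/ess_supP; apply: aeW => x /=; rewrite lee_fin patchE.
  by case: ifPn => [/[!inE] /hM h|_]; rewrite ?normr0//; apply: le_trans h (ler_norm M).
Qed.

Lemma cvg_poweR0 (p : R) (u : (\bar R)^nat) : 0 < p -> (forall n, 0 <= u n)%E ->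
  u @ \oo --> 0%E -> (fun n => u n `^ p)%E @ \oo --> 0%E.
Proof.
move=> p0 u0 /fine_cvgP [finu cu]; apply/fine_cvgP; split.
  by apply: filterS finu => n un; rewrite ge0_fin_numE ?poweR_ge0// poweR_lty// -ge0_fin_numE.
apply/cvgrPdist_lt => e e0.
have e'0 : 0 < e `^ p^-1 by apply: powR_gt0.
move/cvgrPdist_lt : cu => /(_ _ e'0) cu.
near=> n.
have : `|0 - (fine \o u) n| < e `^ p^-1 by near: n.
have : u n \is a fin_num by near: n.
rewrite /= !sub0r !normrN.
case: (u n) (u0 n) => // r; rewrite lee_fin => r0 _ /=.
rewrite !ger0_norm ?powR_ge0// => h.
have := @gt0_ltr_powR _ _ p0 r (e `^ p^-1).
rewrite !nnegrE r0 (ltW e'0) -powRrM mulVf ?gt_eqF// powRr1 ?ltW//; exact.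
Unshelve. all: by end_near. Qed.

(** Dominated convergence for the p-th power of the difference, which is at most
    [(2 * M) `^ p] on the set [K] of finite measure. *)
Lemma Lnorm_restrict_cvg0 (p : R) (f_ : nat -> T -> R) (f : T -> R) (K : set T) (M : R) :
  0 < p -> measurable K -> (mu K < +oo)%E ->
  (forall n, measurable_fun setT (f_ n)) -> measurable_fun setT f ->
  (forall x, K x -> `|f x| <= M) -> (forall n x, K x -> `|f_ n x| <= M) ->
  {ae mu, forall x, f_ ^~ x @ \oo --> f x} ->
  (fun m => Lnorm mu p%:E (EFin \o ((f_ m \- f) \_ K))) @ \oo --> 0%E.
Proof.
move=> p0 mK Kfin mf_ mf fM f_M cvf.
pose F m x := (`| ((f_ m \- f) \_ K) x|%:E `^ p)%E.
have mF m : measurable_fun setT (F m).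
  apply: (@measurableT_comp _ _ _ _ _ _ (fun x => x `^ p)%E); first exact: measurable_poweR.
  apply/measurable_EFinP; apply: measurableT_comp => //.
  apply/(measurable_restrictT _ _).1 => //; apply: measurable_funTS.
  exact: measurable_funB.
have I0 : (fun m => \int[mu]_x F m x)%E @ \oo --> 0%E.
  have := @dominated_convergence _ _ R mu setT measurableT F (cst 0%E)
    ((EFin \o (cst ((2 * M) `^ p))) \_ K) mF.
  case => //.
  - apply: filterS cvf => x cx _; rewrite /F /cst.
    apply: cvg_poweR0 => //.
    apply: cvg_EFin; first by near=> n.
    rewrite [X in X @ _ --> _](_ : _ =
        (fun n => if x \in K then `|f_ n x - f x| else 0)); last first.
      by apply/funext => n; rewrite /comp /= patchE; case: ifP; rewrite ?normr0.
    case: (x \in K); last exact: cvg_cst.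
    rewrite -(@normr0 _ R) -(subrr (f x)); apply: cvg_norm.
    by apply: cvgB => //; exact: cvg_cst.
  - apply/(integrable_mkcond _ mK)/measurable_bounded_integrable => //.
    exists ((2 * M) `^ p); split; first exact: num_real.
    move=> y Cy x _ /=; apply: le_trans (ltW Cy); by rewrite ger0_norm ?powR_ge0.
  - apply: aeW => x n _; rewrite /F /= patchE [leRHS]patchE.
    case: ifPn => [/[!inE] xK|_].
      rewrite lee_fin ger0_norm ?powR_ge0//; apply: ge0_ler_powR; rewrite ?nnegrE ?(ltW p0)//.
        by rewrite mulr_ge0// (le_trans _ (fM x xK)).
      rewrite (le_trans (ler_normB _ _))// mulr2n mulrDl mul1r lerD//; [exact: f_M|exact: fM].
    by rewrite normr0 powR0 ?gt_eqF ?normr0.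
  - by move=> _ _; rewrite integral0; exact.
have pV0 : 0 < p^-1 by rewrite invr_gt0.
have := cvg_poweR0 pV0 _ I0.
rewrite unlock; apply.
by move=> n; apply: integral_ge0 => x _; exact: poweR_ge0.
Unshelve. all: by end_near. Qed.

End DominatedLp.

Section LocalBounds.
Context {R : realType}.
Notation mR := (measurableTypeR R).

Lemma compact_finite_measure2 (K : set (R * R)) : compact K -> (@lebesgue2 R K < +oo)%E.
Proof.
move=> cK; have /compact_bounded [M [_ hM]] := cK.
have {}hM x : K x -> `|x| <= M + 1 by apply: hM; rewrite ltrDl.
pose I : set mR := `[- (M + 1), M + 1]%classic.
have mI : measurable I by exact: measurable_itv.
apply: (@le_lt_trans _ _ (@lebesgue2 R (I `*` I))).
  apply: le_measure; rewrite ?inE//.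
  - exact: compact_measurable2.
  - exact: measurableX.
  - move=> x /hM; rewrite prod_normE ge_max => /andP[h1 h2].
    by split; rewrite /I/= in_itv/= -ler_norml.
have -> : lebesgue2 (I `*` I) = (lebesgue_measure I * lebesgue_measure I)%E.
  exact: (product_measure1E (@lebesgue_measure R) (@lebesgue_measure R) mI mI).
 rewrite /I lebesgue_measure_itv/=.
by case: ifP => _; rewrite ?mule0 // -EFinB -EFinM ltry.
Qed.

Lemma continuous_bounded_on_compact (f : R * R -> R) (K : set (R * R)) :
  continuous f -> compact K -> exists M : R, forall x, K x -> `|f x| <= M.
Proof.
move=> cf cK.
have /compact_bounded [M [_ hM]] : compact (f @` K).
  by apply: continuous_compact => //; apply: continuous_subspaceT.
by exists (M + 1) => x Kx; apply: (hM (M + 1)); rewrite ?ltrDl//; exists x.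
Qed.

Lemma compact_box (M : R) : compact [set x : R * R | `|x| <= M].
Proof.
have -> : [set x : R * R | `|x| <= M] = `[- M, M]%classic `*` `[- M, M]%classic.
  apply/seteqP; split => x /=; rewrite prod_normE ge_max !in_itv/= -!ler_norml.
    by move=> /andP.
  by move=> [-> ->].
by apply: compact_setX; exact: segment_compact.
Qed.

Lemma Lloc_bounded (p : \bar R) (f : R * R -> R) : (0 < p)%E ->
  measurable_fun setT (f : mR * mR -> mR) ->
  (forall K : set (R * R), compact K -> exists M : R, forall x, K x -> `|f x| <= M) ->
  Lloc p f.
Proof.
move=> p0 mf hf; split => // K cK; have [M hM] := hf K cK.
apply: (@finite_norm_bounded _ _ _ _ _ _ _ M) => //.
- exact: compact_measurable2.
- exact: compact_finite_measure2.
Qed.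

Lemma integrable_bounded_support (f : R * R -> R) (C M : R) :
  measurable_fun setT (f : mR * mR -> mR) ->
  (forall x, `|f x| <= C) -> (forall x : R * R, M < `|x| -> f x = 0) ->
  (@lebesgue2 R).-integrable setT (EFin \o f).
Proof.
move=> mf fC f0; pose B := [set x : R * R | `|x| <= M].
have cB : compact B by exact: compact_box.
have mB := compact_measurable2 cB.
have -> : EFin \o f = (EFin \o f) \_ B.
  apply/funext => x; rewrite patchE; case: ifPn => //.
  by rewrite notin_setE /B /= => /negP; rewrite -ltNge /= => /f0 ->.
have := @measurable_bounded_integrable _ _ _ (@lebesgue2 R) f B mB (compact_finite_measure2 cB).
move=> h; apply/(integrable_mkcond _ mB)/h.
- exact: measurable_funTS.
- exists C; split; first exact: num_real.
  by move=> y Cy x _; apply: le_trans (fC x) (ltW Cy).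
Qed.

Lemma integrable_cc (f : R * R -> R) (M : R) : continuous f ->
  (forall x : R * R, M < `|x| -> f x = 0) -> (@lebesgue2 R).-integrable setT (EFin \o f).
Proof.
move=> cf f0; have [C hC] := continuous_bounded_on_compact cf (@compact_box M).
apply: (@integrable_bounded_support f `|C| M) => //.
- exact: continuous_measurable2.
- move=> x; have [xM|/f0->] := leP `|x| M; last by rewrite normr0.
  by apply: le_trans (ler_norm C); apply: hC.
Qed.

Lemma Lloc_cvg_dominated (p : R) (f_ : nat -> R * R -> R) (f : R * R -> R) : 1 <= p ->
  (forall n, measurable_fun setT (f_ n : mR * mR -> mR)) ->
  measurable_fun setT (f : mR * mR -> mR) ->
  (forall K : set (R * R), compact K -> exists M : R, forall x, K x ->
     `|f x| <= M /\ forall n, `|f_ n x| <= M) ->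
  {ae lebesgue2, forall x, f_ ^~ x @ \oo --> f x} ->
  Lloc_cvg p%:E f_ f.
Proof.
move=> p1 mf_ mf hM cvf K cK; have [M {}hM] := hM K cK.
apply: (@Lnorm_restrict_cvg0 _ _ _ _ _ _ _ _ M) => //.
- exact: lt_le_trans p1.
- exact: compact_measurable2.
- exact: compact_finite_measure2.
- by move=> x /hM[].
- by move=> n x /hM[].
Qed.

End LocalBounds.

Section AlmostEverywhere.
Context {R : realType} d (T : measurableType d) (mu : {measure set T -> \bar R}).

Lemma ae_mono (P Q : T -> Prop) : (forall x, P x -> Q x) ->
  {ae mu, forall x, P x} -> {ae mu, forall x, Q x}.
Proof. by move=> PQ; apply: filterS. Qed.

Lemma ae_and (P Q : T -> Prop) : {ae mu, forall x, P x} -> {ae mu, forall x, Q x} ->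
  {ae mu, forall x, P x /\ Q x}.
Proof. by move=> hP hQ; apply: filterS2 hP hQ. Qed.

Lemma ae_all_nat (P : nat -> T -> Prop) : (forall n, {ae mu, forall x, P n x}) ->
  {ae mu, forall x n, P n x}.
Proof. by move=> h; apply/ae_foralln. Qed.

End AlmostEverywhere.

(** * Weak gradients of Lipschitz maps *)

Section DifferenceQuotients.
Context {R : realType}.
Notation mR := (measurableTypeR R).
Implicit Types (f g psi : R * R -> R) (x y e : R * R).

Lemma is_derive_line psi x e (t : R) : derivable psi (t *: e + x) e ->
  is_derive t (1 : R) (fun s : R => psi (s *: e + x)) ('D_e psi (t *: e + x)).
Proof.
move=> d.
have E : (fun h : R => h^-1 *: (((fun s : R => psi (s *: e + x)) \o shift t) (h *: (1 : R))
      - psi (t *: e + x))) =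
    (fun h : R => h^-1 *: ((psi \o shift (t *: e + x)) (h *: e) - psi (t *: e + x))).
  by apply/funext => h /=; rewrite scalerDl addrA [h *: 1]mulr1.
by apply: DeriveDef; rewrite ?/derivable ?/derive E.
Qed.

Lemma dominated_lipschitz_continuous f (L : R) :
  (forall x y, `|f x - f y| <= L * `|x - y|) -> continuous f.
Proof.
move=> hf x; apply/cvgrPdist_lt => e e0.
have L0 : 0 < `|L| + 1 by rewrite ltr_pwDr.
near=> y.
have h : `|x - y| < e / (`|L| + 1).
  by near: y; apply: cvgr_dist_lt; rewrite ?divr_gt0//; exact: cvg_id.
apply: le_lt_trans (hf x y) _; apply: (@le_lt_trans _ _ ((`|L| + 1) * `|x - y|)).
  by apply: ler_wpM2r => //; apply: le_trans (ler_norm L) _; rewrite lerDl.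
by rewrite mulrC -ltr_pdivlMr.
Unshelve. all: by end_near. Qed.

Lemma integrable_cst_box (c M : R) :
  (@lebesgue2 R).-integrable setT ((EFin \o cst c) \_ [set x : R * R | `|x| <= M]).
Proof.
have cB := @compact_box _ M; have mB := compact_measurable2 cB.
apply/(integrable_mkcond _ mB)/measurable_bounded_integrable => //.
- exact: compact_finite_measure2.
- by exists `|c|; split; [exact: num_real|move=> y Cy x _ /=; exact: ltW].
Qed.

Lemma derive_eq0_out psi e (M : R) x : (forall y, M < `|y| -> psi y = 0) ->
  M < `|x| -> 'D_e psi x = 0.
Proof.
move=> p0 xM; have <- : 'D_e (cst 0 : R * R -> R) x = 0 by rewrite derive_cst.
have oM : open [set y : R * R | M < `|y|].
  have /continuousP cn : continuous (fun y : R * R => `|y|) by move=> y; exact: norm_continuous.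
  by have := cn _ (@open_gt _ M).
apply: near_eq_derive.
apply: (@filterS _ _ _ [set y : R * R | M < `|y|]).
  by move=> y /= /p0 ->.
exact: open_nbhs_nbhs.
Qed.

(** Only the steps [m.+1%:R^-1] occur, so that limits are limits of sequences
    and their limits superior are measurable. *)
Definition dquot (j : 'I_2) f (m : nat) x : R :=
  m.+1%:R * (f (x + m.+1%:R^-1 *: basis j) - f x).

Lemma continuous_addc f e : continuous f -> continuous (fun x => f (x + e)).
Proof.
move=> cf x; apply: (@continuous_comp _ _ _ (fun y => y + e) f); last exact: cf.
by apply: continuousD; [exact: cvg_id|exact: cvg_cst].
Qed.

Lemma contM f g : continuous f -> continuous g -> continuous (fun x => f x * g x).
Proof. by move=> cf cg x; apply: cvgM; [exact: cf|exact: cg]. Qed.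

Lemma contD f g : continuous f -> continuous g -> continuous (fun x => f x + g x).
Proof. by move=> cf cg x; apply: cvgD; [exact: cf|exact: cg]. Qed.

Lemma contN f : continuous f -> continuous (fun x => - f x).
Proof. by move=> cf x; apply: cvgN; exact: cf. Qed.

Lemma contC (c : R) : continuous (fun _ : R * R => c).
Proof. by move=> x; exact: cvg_cst. Qed.

Lemma norm_basis (j : 'I_2) : `|basis j : R * R| = 1.
Proof.
rewrite /basis; case: ifP => _; rewrite prod_normE /= normr0 normr1.
  by rewrite max_l.
by rewrite max_r.
Qed.

Lemma cvg_natSinv : (fun m => m.+1%:R^-1 : R) @ \oo --> (0 : R).
Proof. exact: cvg_harmonic. Qed.

Lemma dquot_bound (j : 'I_2) f (L : R) m x :
  (forall x y, `|f x - f y| <= L * `|x - y|) -> `|dquot j f m x| <= L.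
Proof.
move=> fL; rewrite /dquot normrM ger0_norm ?ler0n// mulrC -ler_pdivlMr ?ltr0n//.
apply: le_trans (fL _ _) _; rewrite [x + _]addrC addrK normrZ norm_basis mulr1.
by rewrite ger0_norm// invr_ge0.
Qed.

(** Integration by parts for difference quotients: translation invariance moves
    the quotient from [f] to the test function.  Both sides converge by dominated
    convergence, the quotients of [f] being bounded by [L]. *)
Theorem weak_partial_lipschitz (j : 'I_2) f g (L : R) :
  (forall x y, `|f x - f y| <= L * `|x - y|) ->
  measurable_fun setT (g : mR * mR -> mR) ->
  {ae lebesgue2, forall x, dquot j f ^~ x @ \oo --> g x} ->
  weak_partial j f g.
Proof.
move=> fL mg cvgq psi [psiS [K [cK K0]]].
have cf := dominated_lipschitz_continuous fL.
have L0 : 0 <= L.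
  have := fL (basis j) 0; rewrite subr0 norm_basis mulr1; exact: le_trans.
pose e : R * R := basis j; set Dp := 'D_(basis j) psi.
have [cpsi dpsi] := psiS [::]; have [cD _] := psiS [:: e].
rewrite /= in cpsi dpsi cD.
have [M psi0] : exists M : R, forall y : R * R, M < `|y| -> psi y = 0.
  have /compact_bounded [M [_ hM]] := cK.
  exists (M + 1) => y My; apply: K0 => Ky.
  have := hM (M + 1); rewrite ltrDl => /(_ ltr01 y Ky) /=.
  by move: My; case: ltgtP.
have D0 y : M < `|y| -> Dp y = 0 by exact: derive_eq0_out.
have [C0 hC0] := continuous_bounded_on_compact cD (@compact_box _ M).
pose C : R := `|C0|.
have hC y : `|Dp y| <= C.
  have [yM|/D0->] := leP `|y| M; last by rewrite normr0 /C.
  by apply: le_trans (hC0 _ yM) (ler_norm _).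
pose h m : R := m.+1%:R^-1.
have h0 m : 0 < h m by rewrite /h invr_gt0.
have h1 m : h m <= 1 by rewrite /h invf_le1// ler1n.
have hV m : m.+1%:R * h m = 1 by rewrite /h mulfV.
pose dm m x : R := m.+1%:R * (psi x - psi (x - h m *: e)).
have dm_bound m x : `|dm m x| <= C.
  pose y : R * R := x - h m *: e.
  have yx : h m *: e + y = x by rewrite /y addrC subrK.
  have [|//|] := @MVT_segment _ (fun t => psi (t *: e + y)) (fun t => Dp (t *: e + y)) 0 (h m) (ltW (h0 m)).
  - move=> t _; exact: is_derive_line.
  - apply: continuous_subspaceT => t.
    apply: (@continuous_comp _ _ _ (fun t : R => t *: e + y) psi); last exact: cpsi.
    by apply: continuousD; [apply: continuousZl; exact: cvg_id|exact: cvg_cst].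
  - move=> c _; rewrite yx scale0r add0r subr0 => E.
    by rewrite /dm E mulrCA hV mulr1; exact: hC.
have far m x : M + 1 < `|x| -> M < `|x - h m *: e|.
  move=> xM; have : `|x| <= `|x - h m *: e| + 1.
    rewrite -{1}(subrK (h m *: e) x); apply: le_trans (ler_normD _ _) _.
    by rewrite lerD2l normrZ norm_basis mulr1 ger0_norm ?(ltW (h0 m)).
  by move: xM => /lt_le_trans/[apply]; rewrite ltrD2r.
have dm_out m x : M + 1 < `|x| -> dm m x = 0.
  move=> xM; rewrite /dm !psi0 ?subrr ?mulr0 ?far//.
  by apply: lt_trans xM; rewrite ltrDl.
have dm_cvg x : dm ^~ x @ \oo --> Dp x.
  have c0 : (fun m => - h m) @ \oo --> (0 : R).
    by rewrite -oppr0; apply: cvgN; exact: cvg_natSinv.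
  have c0' : (fun m => - h m) @ \oo --> (0 : R)^'.
    move=> A A0; have {}A0 : nbhs (0 : R) [set y | y != 0 -> A y] := A0.
    apply: (@filterS _ (nbhs \oo) _ (fun m => - h m != 0 -> A (- h m)) _ _ (c0 _ A0)).
    by move=> m; apply; rewrite oppr_eq0 gt_eqF.
  have := cvg_comp _ _ c0' (dpsi x (basis j)).
  rewrite -/(derive psi x (basis j)) -/Dp.
  rewrite [X in X @ _ --> _](_ : _ = dm ^~ x) //.
  apply/funext => m; rewrite /dm /= /h invrN invrK scaleNr -scalerN opprB.
  by rewrite scaleNr (addrC (- _) x).
pose I1 m := (\int[@lebesgue2 R]_x (dquot j f m x * psi x)%:E)%E.
pose I2 m := (\int[@lebesgue2 R]_x (f x * dm m x)%:E)%E.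
have I12 m : (I1 m = - I2 m)%E.
  pose A x := m.+1%:R * (f x * psi (x - h m *: e)).
  pose B x := m.+1%:R * (f x * psi x).
  have cA : continuous A.
    exact: (contM (@contC _) (contM cf (continuous_addc cpsi))).
  have cB : continuous B.
    exact: (contM (@contC _) (contM cf cpsi)).
  have iB : (@lebesgue2 R).-integrable setT (EFin \o B).
    by apply: (@integrable_cc _ _ M cB) => x /psi0; rewrite /B => ->; rewrite !mulr0.
  have iA : (@lebesgue2 R).-integrable setT (EFin \o A).
    apply: (@integrable_cc _ _ (M + 1) cA) => x xM; by rewrite /A psi0 ?mulr0 ?far.
  have iA' : (@lebesgue2 R).-integrable setT (EFin \o (fun x => A (x + h m *: e))).
    apply: (@integrable_cc _ _ M); first exact: continuous_addc.
    by move=> x /psi0 xM; rewrite /A addrK xM !mulr0.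
  have -> : I2 m = (\int[@lebesgue2 R]_x (B x)%:E - \int[@lebesgue2 R]_x (A x)%:E)%E.
    rewrite -integralB_EFin//; apply: eq_integral => x _.
    by rewrite -EFinB /B /A /dm; congr EFin; ring.
  have <- : (\int[@lebesgue2 R]_x (A (x + h m *: e))%:E = \int[@lebesgue2 R]_x (A x)%:E)%E.
    apply: (integral_shift2 (h m *: e) (f := EFin \o A)).
    by apply/measurable_EFinP; exact: continuous_measurable2.
  rewrite oppeB; last first.
    by rewrite fin_num_adde_defr// integrable_fin_num.
  rewrite addeC -integralB_EFin//; apply: eq_integral => x _.
  by rewrite -EFinB /B /A /dquot addrK; congr EFin; ring.
have cI1 : I1 @ \oo --> (\int[@lebesgue2 R]_x (g x * psi x)%:E)%E.
  have := @dominated_convergence _ _ R (@lebesgue2 R) setT measurableT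
    (fun m x => (dquot j f m x * psi x)%:E) (fun x => (g x * psi x)%:E)
    (fun x => (L * `|psi x|)%:E).
  case=> //.
  - move=> m; apply/measurable_EFinP; apply: continuous_measurable2.
    exact: (contM (contM (@contC _) (contD (continuous_addc cf) (contN cf))) cpsi).
  - apply/measurable_EFinP; apply: measurable_funM => //; exact: continuous_measurable2.
  - apply: ae_mono cvgq => x cx _; apply: cvg_EFin; first by near=> n.
    by apply: cvgM => //; exact: cvg_cst.
  - apply: (@integrable_cc _ (fun x => L * `|psi x|) M).
      apply: (contM (@contC _)) => x.
      by apply: (@continuous_comp _ _ _ psi Num.norm); [exact: cpsi|exact: norm_continuous].
    by move=> x /psi0 ->; rewrite normr0 mulr0.
  - apply: aeW => x m _; by rewrite /= lee_fin normrM ler_wpM2r// dquot_bound.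
have cI2 : I2 @ \oo --> (\int[@lebesgue2 R]_x (f x * Dp x)%:E)%E.
  have [F0 hF] := continuous_bounded_on_compact cf (@compact_box _ (M + 1)).
  have := @dominated_convergence _ _ R (@lebesgue2 R) setT measurableT
    (fun m x => (f x * dm m x)%:E) (fun x => (f x * Dp x)%:E)
    ((EFin \o cst (F0 * C)) \_ [set x : R * R | `|x| <= M + 1]).
  case=> //.
  - move=> m; apply/measurable_EFinP; apply: continuous_measurable2.
    exact: (contM cf (contM (@contC _) (contD cpsi (contN (continuous_addc cpsi))))).
  - apply/measurable_EFinP; apply: continuous_measurable2.
    exact: (contM cf cD).
  - apply: aeW => x _; apply: cvg_EFin; first by near=> n.
    by apply: cvgM; [exact: cvg_cst|exact: dm_cvg].
  - exact: integrable_cst_box.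
  - apply: aeW => x m _; rewrite /= patchE; case: ifPn => [/[!inE] /= xM|].
      by rewrite lee_fin normrM ler_pM//; exact: hF.
    by rewrite notin_setE /= => /negP; rewrite -ltNge => /dm_out ->; rewrite mulr0 normr0.
have : (fun m => - I2 m)%E @ \oo --> (- \int[@lebesgue2 R]_x (f x * Dp x)%:E)%E.
  exact: cvgeN.
rewrite (_ : (fun m => - I2 m)%E = I1); last by apply/funext => m; rewrite I12.
move=> /(cvg_lim (@ereal_hausdorff R)).
by rewrite (cvg_lim (@ereal_hausdorff R) cI1) => ->; rewrite oppeK.
Unshelve. all: by end_near. Qed.

End DifferenceQuotients.

Section LipschitzGradient.
Context {R : realType}.
Notation mR := (measurableTypeR R).
Implicit Types (f : R * R -> R) (v : R * R -> R * R) (x y : R * R) (A : 'M[R]_2).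

(** A limit superior, so that this gradient is measurable and bounded for every
    Lipschitz map; it is the gradient wherever the quotients converge. *)
Definition lgrad v x : 'M[R]_2 :=
  \matrix_(i, j) limn_sup (dquot j (coord i \o v) ^~ x).

Lemma limn_sup_bound (u : (R^o)^nat) (L : R) : (forall n, `|u n| <= L) -> `|limn_sup u| <= L.
Proof.
move=> uL.
have ub : has_ubound (range u).
  by exists L => _ [n _ <-]; apply: le_trans (ler_norm _) (uL n).
have lb : has_lbound (range u).
  by exists (- L) => _ [n _ <-]; have := uL n; rewrite ler_norml => /andP[].
have cs : cvgn (sups u) by apply/cvg_ex; eexists; exact: cvg_sups_inf.
have sL n : - L <= sups u n <= L.
  apply/andP; split.
    apply: (@le_trans _ _ (u n)); first by have := uL n; rewrite ler_norml => /andP[].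
    apply: ub_le_sup; first exact: has_ubound_sdrop.
    by exists n => /=.
  apply: ge_sup; first by exists (u n); exists n => /=.
  by move=> _ [k _ <-]; apply: le_trans (ler_norm _) (uL k).
rewrite /limn_sup ler_norml; apply/andP; split.
  by apply: limr_ge => //; apply: nearW => n; case/andP: (sL n).
by apply: limr_le => //; apply: nearW => n; case/andP: (sL n).
Qed.

Lemma lgrad_bound v (L : R) i j x :
  (forall i x y, `|coord i (v x) - coord i (v y)| <= L * `|x - y|) ->
  `|lgrad v x i j| <= L.
Proof.
move=> vL; rewrite /lgrad mxE; apply: limn_sup_bound => n.
exact: dquot_bound (vL i).
Qed.

Lemma lgradE v x i j (d : R) : dquot j (coord i \o v) ^~ x @ \oo --> d -> lgrad v x i j = d.
Proof.
move=> cd; rewrite /lgrad mxE cvg_limn_supE; last by apply/cvg_ex; exists d.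
exact: (cvg_lim _ cd).
Qed.

Lemma measurable_lgrad v (L : R) i j :
  (forall i x y, `|coord i (v x) - coord i (v y)| <= L * `|x - y|) ->
  measurable_fun setT ((fun x => lgrad v x i j) : mR * mR -> mR).
Proof.
move=> vL; under eq_fun do rewrite /lgrad mxE.
have bd x n : `|dquot j (coord i \o v) n x| <= L by exact: dquot_bound (vL i).
apply: measurable_fun_limn_sup.
- by move=> x _; exists L => _ [n _ <-]; apply: le_trans (ler_norm _) (bd x n).
- by move=> x _; exists (- L) => _ [n _ <-]; have := bd x n; rewrite ler_norml => /andP[].
- move=> n; apply: continuous_measurable2.
  have cf : continuous (coord i \o v) := dominated_lipschitz_continuous (vL i).
  exact: (contM (@contC _ _) (contD (continuous_addc cf) (contN cf))).
Qed.

Theorem W1loc_lipschitz (p : \bar R) v (L : R) : (0 < p)%E ->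
  (forall i x y, `|coord i (v x) - coord i (v y)| <= L * `|x - y|) ->
  {ae lebesgue2, forall x, forall i j, cvgn (dquot j (coord i \o v) ^~ x)} ->
  W1loc p v (lgrad v).
Proof.
move=> p0 vL cvq; split.
- move=> i; have cf := dominated_lipschitz_continuous (vL i).
  apply: Lloc_bounded => //; first exact: continuous_measurable2.
  by move=> K cK; exact: (continuous_bounded_on_compact cf cK).
- move=> i j; have mg := @measurable_lgrad v L i j vL; apply: (Lloc_bounded p0 mg).
  by move=> K cK; exists L => x _; exact: lgrad_bound.
- move=> i j; apply: (@weak_partial_lipschitz _ _ _ _ L); first exact: vL.
    exact: (@measurable_lgrad v L i j vL).
  apply: ae_mono cvq => x /(_ i j) /cvg_ex[d cd].
  by rewrite (lgradE cd).
Qed.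

Lemma ord2 (i : 'I_2) : i = ord0 \/ i = ord_max.
Proof. by case: i => -[|[|//]] h; [left|right]; exact/val_inj. Qed.

Lemma coord_mxact A i j (t : R) : coord i (mxact A (t *: basis j)) = t * A i j.
Proof.
by case: (ord2 i) => ->; case: (ord2 j) => ->; rewrite /coord /mxact /basis /=;
  rewrite /GRing.scale /= ?(mulr0, mulr1, addr0, add0r) mulrC.
Qed.

Lemma dquot_cvg_affine v x A :
  (\forall y \near x, v y = v x + mxact A (y - x)) ->
  forall i j, dquot j (coord i \o v) ^~ x @ \oo --> A i j.
Proof.
move=> hv i j.
have cx : (fun m => x + m.+1%:R^-1 *: basis j) @ \oo --> x.
  rewrite -[X in _ --> X]addr0; apply: cvgD; first exact: cvg_cst.
  by rewrite -[X in _ --> X](scale0r (basis j)); apply: cvgZr_tmp; exact: cvg_natSinv.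
apply: cvg_near_cst; near=> m.
have h : v (x + m.+1%:R^-1 *: basis j) = v x + mxact A (x + m.+1%:R^-1 *: basis j - x).
  by near: m; exact: (cx _ hv).
rewrite /dquot /= h [x + _]addrC addrK.
have cD (a b : R * R) : coord i (a + b) = coord i a + coord i b.
  by rewrite /coord; case: ifP.
by rewrite cD addrAC subrr add0r coord_mxact mulrA mulfV ?mul1r// pnatr_eq0.
Unshelve. all: by end_near. Qed.

Lemma lgrad_affine v x A :
  (\forall y \near x, v y = v x + mxact A (y - x)) -> lgrad v x = A.
Proof. by move=> hv; apply/matrixP => i j; apply: lgradE; exact: dquot_cvg_affine. Qed.

End LipschitzGradient.

(** * Null lines and circles *)

Section NullSets.
Context {R : realType}.
Notation mR := (measurableTypeR R).

Lemma null_sections (A : set (R * R)) : measurable (A : set (mR * mR)) ->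
  (forall x, lebesgue_measure (xsection A x : set mR) = 0%E) -> lebesgue2 (A : set (mR * mR)) = 0%E.
Proof.
move=> mA h.
have -> : lebesgue2 (A : set (mR * mR)) = (\int[lebesgue_measure]_x (lebesgue_measure (xsection A x : set mR)))%E.
  by [].
by apply: integral0_eq => x _; rewrite h.
Qed.

Lemma null_point (a : R) : lebesgue_measure ([set a] : set mR) = 0%E.
Proof. exact: lebesgue_measure_set1. Qed.

Lemma lebesgue_subset0 (A B : set mR) : measurable A -> measurable B -> A `<=` B ->
  lebesgue_measure B = 0%E -> lebesgue_measure A = 0%E.
Proof. by move=> mA mB AB B0; exact: (subset_measure0 mA mB AB B0). Qed.

Lemma continuous_fst2 : continuous (fst : R * R -> R).
Proof. by move=> x; exact: cvg_fst. Qed.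
Lemma continuous_snd2 : continuous (snd : R * R -> R).
Proof. by move=> x; exact: cvg_snd. Qed.

Lemma closed_level (f : R * R -> R) (c : R) : continuous f -> closed [set x | f x = c].
Proof.
move=> cf; apply: (@closed_comp _ _ f [set c]); first by move=> x _; exact: cf.
exact: closed_eq.
Qed.

(** The sections of a non-vertical line are points; a vertical line is a product
    with a null factor. *)
Lemma ae_line (a b c : R) : a != 0 \/ b != 0 ->
  {ae lebesgue2, forall x : mR * mR, a * x.1 + b * x.2 != c}.
Proof.
move=> ab.
pose A : set (R * R) := [set x | a * x.1 + b * x.2 = c].
have mA : measurable (A : set (mR * mR)).
  apply: closed_measurable2; apply: closed_level.
  exact: (contD (contM (@contC _ _) continuous_fst2) (contM (@contC _ _) continuous_snd2)).
suff A0 : lebesgue2 (A : set (mR * mR)) = 0%E.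
  exists A; split => // x /= /negP; rewrite negbK => /eqP; exact.
have [b0|b0] := eqVneq b 0.
  have a0 : a != 0 by case: ab; rewrite // b0 eqxx.
  have AE : A `<=` [set c / a] `*` setT.
    move=> [x y] /=; rewrite /A /= b0 mul0r addr0 => <-; split => //=.
    by rewrite mulrAC mulfV// mul1r.
  have mB : measurable ([set c / a] `*` setT : set (mR * mR)).
    by apply: measurableX => //; exact: measurable_set1.
  apply: (subset_measure0 mA mB AE).
  have E : lebesgue2 ([set c / a] `*` setT : set (mR * mR)) =
     (lebesgue_measure ([set (c / a)%R] : set mR) * lebesgue_measure (setT : set mR))%E.
    by apply: product_measure1E => //; exact: measurable_set1.
  by rewrite null_point mul0e in E.
apply: null_sections => // x.
apply: (@lebesgue_subset0 _ [set (c - a * x) / b]).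
- exact: measurable_xsection.
- exact: measurable_set1.
- move=> y; rewrite /xsection /= inE /A /= => <-.
  by rewrite addrC addKr mulrAC mulfV// mul1r.
- exact: null_point.
Qed.

(** Every section of a circle has at most two points. *)
Lemma ae_circle (r : R) : {ae lebesgue2, forall x : mR * mR, enorm x != r}.
Proof.
pose A : set (R * R) := [set x | enorm x = r].
have cE : continuous (@enorm R).
  move=> x; rewrite /enorm; apply: (@continuous_comp _ _ _ (fun x : R * R => x.1 ^+ 2 + x.2 ^+ 2) Num.sqrt).
    exact: (contD (contM continuous_fst2 continuous_fst2) (contM continuous_snd2 continuous_snd2)).
  exact: sqrt_continuous.
have mA : measurable (A : set (mR * mR)).
  by apply: closed_measurable2; apply: closed_level.
suff A0 : lebesgue2 (A : set (mR * mR)) = 0%E.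
  exists A; split => // x /= /negP; rewrite negbK => /eqP; exact.
apply: null_sections => // x.
pose s := Num.sqrt (r ^+ 2 - x ^+ 2).
apply: (@lebesgue_subset0 _ ([set s] `|` [set - s])).
- exact: measurable_xsection.
- by apply: measurableU; exact: measurable_set1.
- move=> y; rewrite /xsection /= inE /A /= /enorm /= => hr.
  have {}hr : x ^+ 2 + y ^+ 2 = r ^+ 2 by rewrite -hr sqr_sqrtr ?addr_ge0 ?sqr_ge0.
  have -> : s = `|y| by rewrite /s -hr addrAC subrr add0r sqrtr_sqr.
  by case: (ger0P y) => _; [left|right; rewrite opprK].
- have m1 (z : R) : measurable ([set z] : set mR) by exact: measurable_set1.
  by apply: etrans (measureU0 (m1 s) (m1 (- s)) (null_point _)) (null_point _).
Qed.

End NullSets.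

(** The rule for derivatives is applied to a syntactically different function
    and value; this transports the result. *)
Lemma isdE (K : numFieldType) (V W : normedModType K) (f g : V -> W) (x v : V) (d d' : W) :
  is_derive x v f d -> (forall y, f y = g y) -> d = d' -> is_derive x v g d'.
Proof. by move=> H /funext <- <-. Qed.

(** * Smooth test functions *)

Section Flat.
Context {R : realType}.
Implicit Types (P : {poly R}) (t : R).

(** These profiles vanish to infinite order at 0 and are closed under
    differentiation, which makes smoothness provable by induction. *)
Definition flat P t : R := if 0 < t then P.[t^-1] * expR (- t^-1) else 0.

Lemma flat_out P t : t <= 0 -> flat P t = 0.
Proof. by rewrite /flat leNgt => /negbTE ->. Qed.

Lemma expR_ge_pow n (s : R) : 0 <= s -> (s / n.+1%:R) ^+ n.+1 <= expR s.
Proof.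
move=> s0; have -> : expR s = expR (s / n.+1%:R) ^+ n.+1.
  by rewrite -expRM_natl mulrC mulfVK// pnatr_eq0.
apply: lerXn2r; rewrite ?nnegrE ?expR_ge0 ?divr_ge0//.
by apply: le_trans (expR_ge1Dx _); rewrite lerDr.
Qed.

(** The exponential beats every power of [t^-1]; a quadratic bound is what the
    derivative at 0 requires. *)
Lemma flat_bound P : exists C : R, forall t, `|t| <= 1 -> `|flat P t| <= C * t ^+ 2.
Proof.
pose d := size P; pose A : R := \sum_(i < d) `|P`_i|.
pose K : R := d.+2%:R ^+ d.+2.
have A0 : 0 <= A by apply: sumr_ge0.
have K0 : 0 <= K by apply: exprn_ge0.
exists (A * K) => t t1; have [t0|/flat_out->] := ltP 0 t; last first.
  by rewrite normr0 mulr_ge0 ?sqr_ge0// mulr_ge0.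
rewrite /flat t0; set s := t^-1.
have s1 : 1 <= s by rewrite /s invf_ge1// -(ger0_norm (ltW t0)).
have s0 : 0 < s by apply: lt_le_trans s1.
have hP : `|P.[s]| <= A * s ^+ d.
  rewrite horner_coef; apply: le_trans (ler_norm_sum _ _ _) _.
  rewrite mulr_suml; apply: ler_sum => i _; rewrite normrM ler_wpM2l//.
  rewrite ger0_norm ?exprn_ge0 ?(ltW s0)//.
  by apply: ler_weXn2l => //; exact: ltnW.
have hE : expR (- s) <= K / s ^+ d.+2.
  rewrite expRN -[leRHS]invrK lef_pV2 ?posrE ?expR_gt0 ?invr_gt0 ?divr_gt0 ?exprn_gt0//.
  by rewrite invf_div -expr_div_n; apply: expR_ge_pow; exact: ltW.
rewrite normrM [`|expR _|]ger0_norm ?expR_ge0//.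
apply: (@le_trans _ _ ((A * s ^+ d) * (K / s ^+ d.+2))).
  by apply: ler_pM => //; exact: expR_ge0.
rewrite -addn2 exprD invfM /s -!exprVn invrK.
have -> : t^-1 ^+ d = (t ^+ d)^-1 by rewrite exprVn.
have tn0 : t ^+ d != 0 by rewrite expf_neq0// gt_eqF.
by rewrite le_eqVlt; apply/orP; left; apply/eqP; field.
Qed.

Lemma is_derive_flat P t :
  is_derive t (1 : R) (flat P) (flat ('X^2 * (P - P^`())) t).
Proof.
have [t0|t0|->] := ltgtP t 0.
- rewrite flat_out ?(ltW t0)//.
  apply: (@near_eq_is_derive _ _ _ (cst (0 : R))).
    near=> s; rewrite flat_out//.
    by apply: ltW; near: s; exact: lt_nbhsl.
- rewrite {2}/flat t0.
  apply: (@near_eq_is_derive _ _ _ (fun s : R => P.[s^-1] * expR (- s^-1) : R)).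
    near=> s; rewrite /flat ifT//; near: s; exact: lt_nbhsr.
  have tN0 : t != 0 by rewrite gt_eqF.
  have dV : is_derive t (1 : R) (fun s : R => s^-1) (- t ^- 2).
    by apply: (isdE (is_deriveV tN0 (is_derive_id t (1 : R)))) => //; rewrite [_ *: 1]mulr1.
  have dP : is_derive t (1 : R) (fun s : R => P.[s^-1]) (- t ^- 2 * P^`().[t^-1]).
    by apply: (isdE (is_derive1_comp (is_derive_poly P t^-1) dV)) => //; rewrite mulrC.
  have dE : is_derive t (1 : R) (fun s : R => expR (- s^-1)) (t ^- 2 * expR (- t^-1)).
    have dN : is_derive t (1 : R) (fun s : R => - s^-1) (- - t ^- 2) by exact: is_deriveN.
    apply: (isdE (@is_derive1_comp _ expR (fun s : R => - s^-1) t _ _ (is_derive_expR (- t^-1)) dN)) => //.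
    by rewrite opprK mulrC.
  apply: (isdE (is_deriveM dP dE)) => //.
  rewrite !hornerE /GRing.scale /=.
  by field.
- rewrite flat_out//; have [C hC] := flat_bound P.
  have c : h^-1 *: ((flat P \o shift 0) (h *: (1 : R)) - flat P 0) @[h --> (0 : R)^'] --> (0 : R).
    apply/cvgr0Pnorm_lt => e e0; near=> h.
    have h0 : h != 0 by near: h; exact: nbhs_dnbhs_neq.
    have h1 : `|h| < Num.min 1 (e / (`|C| + 1)).
      near: h; apply: dnbhs0_lt; rewrite lt_min ltr01 divr_gt0// ltr_pwDr//.
    move: h1; rewrite lt_min => /andP[h1 h2].
    rewrite /= addr0 [h *: 1]mulr1 (flat_out P (lexx 0)) subr0 /GRing.scale /=.
    rewrite normrM normfV mulrC ltr_pdivrMr ?normr_gt0//.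
    apply: le_lt_trans (hC h (ltW h1)) _; rewrite -(real_normK (num_real h)) expr2 mulrA ltr_pM2r ?normr_gt0//.
    apply: (@le_lt_trans _ _ ((`|C| + 1) * `|h|)).
      by apply: ler_wpM2r => //; apply: le_trans (ler_norm C) _; rewrite lerDl.
    by rewrite mulrC -ltr_pdivlMr ?ltr_pwDr.
  by apply: DeriveDef; [apply/cvg_ex; exists 0|exact: (cvg_lim _ c)].
Unshelve. all: by end_near. Qed.

End Flat.

Section SmoothClass.
Context {R : realType}.
Implicit Types (f g : R * R -> R) (x e : R * R).

(** A class of functions that contains the directional derivatives of its
    members, so that all of them are smooth. *)
Inductive flatgen : (R * R -> R) -> Prop :=
| flatgen_flat P (a b c : R) : flatgen (fun x => flat P (a * x.1 + b * x.2 + c))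
| flatgen_cst (c : R) : flatgen (fun=> c)
| flatgen_add f g : flatgen f -> flatgen g -> flatgen (fun x => f x + g x)
| flatgen_mul f g : flatgen f -> flatgen g -> flatgen (fun x => f x * g x)
| flatgen_inv f : flatgen f -> (forall x, f x != 0) -> flatgen (fun x => (f x)^-1).

Lemma is_derive_of_line f x e (d : R) :
  is_derive (0 : R) (1 : R) (fun h : R => f (h *: e + x)) d -> is_derive x e f d.
Proof.
have E : (fun h : R => h^-1 *: (((fun s : R => f (s *: e + x)) \o shift 0) (h *: (1 : R))
      - f (0 *: e + x))) =
    (fun h : R => h^-1 *: ((f \o shift x) (h *: e) - f x)).
  by apply/funext => h /=; rewrite scale0r add0r addr0 [h *: 1]mulr1.
move=> [d1 d2]; rewrite /derivable E in d1; rewrite /derive E in d2.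
exact: DeriveDef.
Qed.

Lemma is_derive_affine (h : R -> R) (dh : R) (a b c : R) x e :
  is_derive (a * x.1 + b * x.2 + c) (1 : R) h dh ->
  is_derive x e (fun y => h (a * y.1 + b * y.2 + c)) (dh * (a * e.1 + b * e.2)).
Proof.
move=> H; apply: is_derive_of_line.
pose m := a * e.1 + b * e.2; pose t0 := a * x.1 + b * x.2 + c.
have -> : (fun s : R => h (a * (s *: e + x).1 + b * (s *: e + x).2 + c)) = h \o (fun s => m * s + t0).
  by apply/funext => s /=; congr h; rewrite /m /t0 /GRing.scale /=; ring.
apply: is_derive1_comp; first by rewrite mulr0 add0r.
have dm : is_derive (0 : R) (1 : R) (fun s : R => m * s) m.
  apply: (isdE (is_deriveZ m (is_derive_id (0 : R) (1 : R)))) => //.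
  by rewrite [m *: 1]mulr1.
by apply: (isdE (is_deriveD dm (is_derive_cst t0 (0 : R) (1 : R)))) => //; rewrite addr0.
Qed.

Lemma flatgen_continuous f : flatgen f -> continuous f.
Proof.
elim=> {f} [P a b c|c|f g _ cf _ cg|f g _ cf _ cg|f _ cf f0].
- move=> x; apply: (@continuous_comp _ _ _ (fun x : R * R => a * x.1 + b * x.2 + c) (flat P)).
    exact: (contD (contD (contM (@contC _ _) continuous_fst2) (contM (@contC _ _) continuous_snd2)) (@contC _ _)).
  have [d _] := is_derive_flat P (a * x.1 + b * x.2 + c).
  by apply: differentiable_continuous; apply/derivable1_diffP.
- exact: contC.
- exact: contD.
- exact: contM.
- by move=> x; apply: cvgV; [exact: f0|exact: cf].
Qed.

Lemma flatgen_derive f e : flatgen f -> exists g, flatgen g /\ forall x, is_derive x e f (g x).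
Proof.
elim=> {f} [P a b c|c|f g sf [df [sdf hf]] sg [dg [sdg hg]]|f g sf [df [sdf hf]] sg [dg [sdg hg]]
   |f sf [df [sdf hf]] f0].
- exists (fun x => flat ('X^2 * (P - P^`())) (a * x.1 + b * x.2 + c) * (a * e.1 + b * e.2)).
  split; first by apply: flatgen_mul; [exact: flatgen_flat|exact: flatgen_cst].
  by move=> x; apply: is_derive_affine; exact: is_derive_flat.
- exists (fun=> 0); split; first exact: flatgen_cst.
  by move=> x; exact: is_derive_cst.
- exists (fun x => df x + dg x); split; first exact: flatgen_add.
  by move=> x; exact: (is_deriveD (hf x) (hg x)).
- exists (fun x => f x * dg x + g x * df x).
  split; first by apply: flatgen_add; exact: flatgen_mul.
  by move=> x; exact: (is_deriveM (hf x) (hg x)).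
- exists (fun x => (- 1 * ((f x)^-1 * (f x)^-1)) * df x).
  split.
    apply: flatgen_mul => //; apply: flatgen_mul; first exact: flatgen_cst.
    by apply: flatgen_mul; exact: flatgen_inv.
  move=> x; apply: is_derive_of_line.
  have [d1 d2] := hf x.
  have dl : is_derive (0 : R) (1 : R) (fun s : R => f (s *: e + x)) (df x).
    have H : derivable f (0 *: e + x) e by rewrite scale0r add0r.
    by apply: (isdE (is_derive_line H)) => //; rewrite scale0r add0r.
  apply: (isdE (is_deriveV (f0 (0 *: e + x)) dl)) => //; rewrite scale0r add0r /GRing.scale /= mulN1r.
  by rewrite -invfM -expr2.
Qed.

Lemma flatgen_iter_deriv f s : flatgen f -> flatgen (iter_deriv s f).
Proof.
move=> sf; elim: s => [//|e s IH] /=.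
have [g [sg hg]] := flatgen_derive e IH.
have -> // : 'D_e (iter_deriv s f) = g.
by apply/funext => x; exact: (@derive_val _ _ _ _ _ _ _ (hg x)).
Qed.

Lemma flatgen_smooth f : flatgen f -> smooth f.
Proof.
move=> sf s; have sg := flatgen_iter_deriv s sf; split; first exact: flatgen_continuous.
by move=> x e; have [g [_ hg]] := flatgen_derive e sg; have [] := hg x.
Qed.

End SmoothClass.

Section DuBoisReymond.
Context {R : realType}.
Implicit Types (x y : R * R) (t : R).

Definition fl (t : R) : R := flat 1 t.
Definition fl' (t : R) : R := flat 'X^2 t.

Lemma fl_ge0 t : 0 <= fl t.
Proof. by rewrite /fl /flat; case: ifP => // _; rewrite hornerE mul1r expR_ge0. Qed.

Lemma fl_gt0 t : 0 < t -> 0 < fl t.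
Proof. by move=> t0; rewrite /fl /flat t0 hornerE mul1r expR_gt0. Qed.

Lemma fl'_ge0 t : 0 <= fl' t.
Proof.
rewrite /fl' /flat; case: ifP => // _.
by rewrite hornerXn mulr_ge0 ?expR_ge0 ?sqr_ge0.
Qed.

Lemma fl'_gt0 t : 0 < t -> 0 < fl' t.
Proof. by move=> t0; rewrite /fl' /flat t0 hornerXn mulr_gt0 ?expR_gt0 ?exprn_gt0 ?invr_gt0. Qed.

Lemma is_derive_fl t : is_derive t (1 : R) fl (fl' t).
Proof.
apply: (isdE (is_derive_flat 1 t)) => //.
by rewrite /fl' derivC subr0 mulr1.
Qed.

Lemma fl_den_gt0 t : 0 < fl t + fl (1 - t).
Proof.
have [t0|t0] := ltP 0 t; first by rewrite ltr_pwDl ?fl_gt0 ?fl_ge0.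
by rewrite ltr_wpDl ?fl_ge0// fl_gt0// subr_gt0 (le_lt_trans t0).
Qed.

(** A smooth transition from 0 to 1 over the unit interval. *)
Definition step (t : R) : R := fl t / (fl t + fl (1 - t)).
Definition step' (t : R) : R :=
  (fl' t * fl (1 - t) + fl t * fl' (1 - t)) / (fl t + fl (1 - t)) ^+ 2.
Definition bump (t : R) : R := fl t * fl (1 - t).

Lemma step_le0 t : t <= 0 -> step t = 0.
Proof. by move=> t0; rewrite /step /fl flat_out// mul0r. Qed.

Lemma step_ge1 t : 1 <= t -> step t = 1.
Proof.
move=> t1; rewrite /step /fl (@flat_out _ _ (1 - t)) ?subr_le0// addr0 divff//.
by rewrite gt_eqF// fl_gt0// (lt_le_trans _ t1).
Qed.

Lemma step'_ge0 t : 0 <= step' t.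
Proof. by rewrite /step' divr_ge0 ?sqr_ge0// addr_ge0// mulr_ge0 ?fl_ge0 ?fl'_ge0. Qed.

Lemma step'_out t : ~~ (0 < t < 1) -> step' t = 0.
Proof.
rewrite negb_and -!leNgt => /orP[t0|t1].
  by rewrite /step' /fl /fl' (flat_out _ t0) (flat_out _ t0) !mul0r addr0 mul0r.
have t1' : 1 - t <= 0 by rewrite subr_le0.
by rewrite /step' /fl /fl' (flat_out _ t1') (flat_out _ t1') !mulr0 addr0 mul0r.
Qed.

Lemma step'_gt0 t : 0 < t < 1 -> 0 < step' t.
Proof.
move=> /andP[t0 t1]; rewrite /step' divr_gt0 ?exprn_gt0 ?fl_den_gt0//.
by rewrite ltr_pwDl ?mulr_gt0 ?mulr_ge0 ?fl'_gt0 ?fl_gt0 ?fl_ge0 ?fl'_ge0 ?subr_gt0.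
Qed.

Lemma bump_ge0 t : 0 <= bump t.
Proof. by rewrite /bump mulr_ge0 ?fl_ge0. Qed.

Lemma bump_gt0 t : 0 < t < 1 -> 0 < bump t.
Proof. by move=> /andP[t0 t1]; rewrite /bump mulr_gt0 ?fl_gt0 ?subr_gt0. Qed.

Lemma bump_out t : ~~ (0 < t < 1) -> bump t = 0.
Proof.
rewrite negb_and -!leNgt => /orP[t0|t1].
  by rewrite /bump /fl (flat_out _ t0) mul0r.
by rewrite /bump /fl (@flat_out _ _ (1 - t)) ?subr_le0// mulr0.
Qed.

Lemma is_derive_fl_onem t : is_derive t (1 : R) (fun s : R => fl (1 - s)) (- fl' (1 - t)).
Proof.
have d1 : is_derive t (1 : R) (fun s : R => 1 - s) (- 1).
  apply: (isdE (is_deriveB (is_derive_cst (1 : R) t (1 : R)) (is_derive_id t (1 : R)))) => //.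
  by rewrite sub0r.
apply: (isdE (@is_derive1_comp _ fl (fun s : R => 1 - s) t _ _ (is_derive_fl (1 - t)) d1)) => //.
by rewrite mulrN1.
Qed.

Lemma is_derive_step t : is_derive t (1 : R) step (step' t).
Proof.
have N0 : fl t + fl (1 - t) != 0 by rewrite gt_eqF// fl_den_gt0.
have dN := is_deriveD (is_derive_fl t) (is_derive_fl_onem t).
have dV := @is_deriveV _ (fun s : R => fl s + fl (1 - s)) t _ 1 N0 dN.
apply: (isdE (is_deriveM (is_derive_fl t) dV)) => //; rewrite /step' /GRing.scale /=.
by field.
Qed.

Definition affine (a b c : R) x : R := a * x.1 + b * x.2 + c.

Lemma flatgen_fl_affine a b c : flatgen (fun x => fl (affine a b c x)).
Proof. exact: flatgen_flat. Qed.

Lemma flatgen_fl_affine1 a b c : flatgen (fun x => fl (1 - affine a b c x)).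
Proof.
have -> : (fun x => fl (1 - affine a b c x)) = (fun x => fl (affine (- a) (- b) (1 - c) x)).
  by apply/funext => x; congr fl; rewrite /affine; ring.
exact: flatgen_flat.
Qed.

Lemma flatgen_step a b c : flatgen (fun x => step (affine a b c x)).
Proof.
apply: flatgen_mul; first exact: flatgen_fl_affine.
apply: (@flatgen_inv _ (fun x => fl (affine a b c x) + fl (1 - affine a b c x))).
  by apply: flatgen_add; [exact: flatgen_fl_affine|exact: flatgen_fl_affine1].
by move=> x; rewrite gt_eqF// fl_den_gt0.
Qed.

Lemma flatgen_bump a b c : flatgen (fun x => bump (affine a b c x)).
Proof. by apply: flatgen_mul; [exact: flatgen_fl_affine|exact: flatgen_fl_affine1]. Qed.

Lemma flatgen_fl'_affine a b c : flatgen (fun x => fl' (affine a b c x)).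
Proof. exact: flatgen_flat. Qed.

Lemma flatgen_fl'_affine1 a b c : flatgen (fun x => fl' (1 - affine a b c x)).
Proof.
have -> : (fun x => fl' (1 - affine a b c x)) = (fun x => fl' (affine (- a) (- b) (1 - c) x)).
  by apply/funext => x; congr fl'; rewrite /affine; ring.
exact: flatgen_flat.
Qed.

Lemma flatgen_step' a b c : flatgen (fun x => step' (affine a b c x)).
Proof.
apply: flatgen_mul; first by apply: flatgen_add; apply: flatgen_mul;
  [exact: flatgen_fl'_affine|exact: flatgen_fl_affine1|exact: flatgen_fl_affine|exact: flatgen_fl'_affine1].
apply: (@flatgen_inv _ (fun x => (fl (affine a b c x) + fl (1 - affine a b c x)) ^+ 2)).
  by apply: flatgen_mul; apply: flatgen_add; [exact: flatgen_fl_affine|exact: flatgen_fl_affine1|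
    exact: flatgen_fl_affine|exact: flatgen_fl_affine1].
by move=> x; rewrite expf_neq0// gt_eqF// fl_den_gt0.
Qed.

End DuBoisReymond.

(** * Constant weak gradients *)

Section ConstantWeakPartial.
Context {R : realType}.
Notation mR := (measurableTypeR R).
Implicit Types (x y : R * R) (j : 'I_2).

Lemma lebesgue2_ball_gt0 y (e : R) : 0 < e -> (0 < lebesgue2 (ball y e : set (mR * mR)))%E.
Proof.
move=> e0.
have -> : (ball y e : set (R * R)) = ball y.1 e `*` ball y.2 e by [].
have mB (z : R) : measurable (ball z e : set mR) by apply: open_measurable; exact: ball_open.
have -> : lebesgue2 (ball y.1 e `*` ball y.2 e : set (mR * mR)) =
  (lebesgue_measure (ball y.1 e : set mR) * lebesgue_measure (ball y.2 e : set mR))%E.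
  exact: product_measure1E.
by rewrite !lebesgue_measure_ball ?(ltW e0)// -EFinM lte_fin; apply: mulr_gt0; rewrite pmulrn_lgt0.
Qed.

Lemma integral_eq0_cont (F : R * R -> R) (M : R) : continuous F -> (forall y, 0 <= F y) ->
  (forall y, M < `|y| -> F y = 0) ->
  (\int[@lebesgue2 R]_y (F y)%:E <= 0)%E -> forall y, F y = 0.
Proof.
move=> cF F0 Fout IF y; apply/eqP; case: eqVneq => // Fy.
have Fy0 : 0 < F y by rewrite lt_neqAle eq_sym Fy F0.
pose k := F y / 2; have k0 : 0 < k by rewrite divr_gt0.
have : \forall z \near y, k < F z.
  have /cvgrPdist_lt/(_ k k0) h := cF y.
  apply: filterS h => z; rewrite ltr_norml /k => /andP[_]; lra.
move=> /nbhs_ballP[e /= e0 he].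
have mB : measurable (ball y e : set (mR * mR)) by apply: open_measurable2; exact: ball_open.
exfalso; move: IF; apply/negP; rewrite -ltNge.
apply: (@lt_le_trans _ _ (\int[@lebesgue2 R]_(z in ball y e) (cst k%:E z))%E).
  by rewrite integral_cst//= mule_gt0 ?lte_fin// lebesgue2_ball_gt0.
rewrite integral_mkcond; apply: ge0_le_integral => //.
- by move=> z _; rewrite patchE; case: ifP => //= _; rewrite lee_fin ltW.
- by apply/(measurable_restrictT _ _).1.
- by apply/measurable_EFinP; exact: continuous_measurable2.
- move=> z _; rewrite patchE; case: ifPn => [/[!inE] /he /ltW|_] /=; last by rewrite lee_fin.
  by rewrite lee_fin.
Qed.

(** [pc j] is the coordinate along the [j]-th axis and [qc j] the other one, which
    treats the two partial derivatives at once. *)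
Definition pc j x : R := (basis j).1 * x.1 + (basis j).2 * x.2.
Definition qc j x : R := (basis j).2 * x.1 + (basis j).1 * x.2.

Lemma pq_norm j x y (r : R) : `|pc j y - pc j x| < r -> `|qc j y - qc j x| < r -> `|y - x| < r.
Proof.
rewrite prod_normE /= gt_max; case: (ord2 j) => ->; rewrite /pc /qc /=;
 by rewrite !(mul1r, mul0r, addr0, add0r) => -> ->.
Qed.

Lemma pc_e j : (basis j).1 * (basis j).1 + (basis j).2 * (basis j).2 = 1 :> R.
Proof. case: (ord2 j) => ->; rewrite /=; ring. Qed.

Lemma qc_e j : (basis j).2 * (basis j).1 + (basis j).1 * (basis j).2 = 0 :> R.
Proof. case: (ord2 j) => ->; rewrite /=; ring. Qed.

Lemma pc_basis j x (t : R) : pc j (x + t *: basis j) = pc j x + t.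
Proof.
rewrite /pc (_ : (x + t *: basis j).1 = x.1 + t * (basis j).1)//.
rewrite (_ : (x + t *: basis j).2 = x.2 + t * (basis j).2)//.
by rewrite -[t in RHS]mulr1 -(pc_e j); ring.
Qed.

Lemma qc_basis j x (t : R) : qc j (x + t *: basis j) = qc j x.
Proof.
rewrite /qc (_ : (x + t *: basis j).1 = x.1 + t * (basis j).1)//.
rewrite (_ : (x + t *: basis j).2 = x.2 + t * (basis j).2)//.
by rewrite -[RHS]addr0 -[X in _ = _ + X](mulr0 t) -(qc_e j); ring.
Qed.

Lemma is_derive_bump (t : R) :
  is_derive t (1 : R) bump (fl t * - fl' (1 - t) + fl (1 - t) * fl' t).
Proof. exact: (is_deriveM (is_derive_fl t) (is_derive_fl_onem t)). Qed.

Lemma pc_lip j x y : `|pc j x - pc j y| <= `|x - y|.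
Proof.
rewrite prod_normE /= le_max; case: (ord2 j) => ->; rewrite /pc /=;
 by rewrite !(mul1r, mul0r, addr0, add0r) lexx ?orbT.
Qed.

Lemma continuous_pc j : continuous (pc j).
Proof.
apply: (contD (contM (@contC _ _) continuous_fst2) (contM (@contC _ _) continuous_snd2)).
Qed.

Lemma weak_partial_affine j (c m : R) : weak_partial j (fun y => c * pc j y + m) (fun=> c).
Proof.
apply: (@weak_partial_lipschitz _ _ _ _ `|c|).
- move=> x y; rewrite opprD addrACA subrr addr0 -mulrBr normrM ler_wpM2l//; exact: pc_lip.
- exact: measurable_cst.
- apply: aeW => x; apply: cvg_near_cst; apply: nearW => n.
  rewrite /dquot pc_basis.
  have -> : c * (pc j x + n.+1%:R^-1) + m - (c * pc j x + m) = c / n.+1%:R by ring.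
  by rewrite mulrC mulfVK// pnatr_eq0.
Qed.

(** Suppose that [f] does not grow with slope [c] from [x] to [x + t *: basis j].
    Then [H], the difference of [f] and a function that is affine in [pc j] with
    slope [c], can be normalised to have opposite signs at the two end points.  A
    test function whose [j]-th derivative is a bump near [x] minus a bump near the
    other end makes the integral of [H] times this derivative nonzero.  But on the
    support of the test function the weak [j]-th derivative of [H] vanishes. *)
Theorem weak_partial_cst_line j (f g : R * R -> R) (c : R) x (r t : R) :
  continuous f -> measurable_fun setT (g : mR * mR -> mR) -> weak_partial j f g ->
  {ae lebesgue2, forall y, ball x r y -> g y = c} ->
  0 < t -> t < r / 2 -> f (x + t *: basis j) = f x + c * t.
Proof.
move=> cf mg wfg gc t0 tr.
pose d0 := f (x + t *: basis j) - f x - c * t.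
have [d00|d0N] := eqVneq d0 0.
  by move: d00; rewrite /d0; lra.
exfalso.
have r0 : 0 < r by lra.
(* the constant for which [H] is [- d0 / 2] at one end and [d0 / 2] at the other *)
pose m := f x - c * pc j x + d0 / 2.
pose H y := f y - (c * pc j y + m).
have Hx : - d0 * H x = d0 ^+ 2 / 2 by rewrite /H /m; field.
have Hx' : d0 * H (x + t *: basis j) = d0 ^+ 2 / 2.
  by rewrite /H /m pc_basis /d0; field.
pose k := d0 ^+ 2 / 4.
have d2 : 0 < d0 ^+ 2 by rewrite exprn_even_gt0.
have k0 : 0 < k by rewrite divr_gt0.
have cH : continuous H.
  exact: (contD cf (contN (contD (contM (@contC _ _) (@continuous_pc j)) (@contC _ _)))).
have [e1 /= e10 he1] : exists2 e, 0 < e & ball x e `<=` [set y | k < - d0 * H y].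
  suff /nbhs_ballP[e ? ?] : \forall y \near x, k < - d0 * H y by exists e.
  have cH' : continuous (fun y => - d0 * H y) by exact: (contM (@contC _ _) cH).
  have /cvgrPdist_lt/(_ k k0) := cH' x.
  by apply: filterS => z; rewrite Hx ltr_norml => /andP[_]; rewrite /k; lra.
have [e2 /= e20 he2] : exists2 e, 0 < e & ball (x + t *: basis j) e `<=` [set y | k < d0 * H y].
  suff /nbhs_ballP[e ? ?] : \forall y \near x + t *: basis j, k < d0 * H y by exists e.
  have cH' : continuous (fun y => d0 * H y) by exact: (contM (@contC _ _) cH).
  have /cvgrPdist_lt/(_ k k0) := cH' (x + t *: basis j).
  by apply: filterS => z; rewrite Hx' ltr_norml => /andP[_]; rewrite /k; lra.
have [e [e0 ee1 ee2 er]] : exists e, [/\ 0 < e, e <= e1, e <= e2 & e <= r / 4].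
  exists (Num.min e1 (Num.min e2 (r / 4))).
  by rewrite !lt_min e10 e20 divr_gt0// !ge_min !lexx !orbT.
pose Aa := affine (e^-1 * (basis j).1) (e^-1 * (basis j).2) (- e^-1 * pc j x).
pose Ab := affine (e^-1 * (basis j).1) (e^-1 * (basis j).2) (- e^-1 * (pc j x + t)).
pose Ac := affine (e^-1 * (basis j).2) (e^-1 * (basis j).1) (- e^-1 * qc j x).
have AaE y : Aa y = (pc j y - pc j x) / e by rewrite /Aa /affine /pc; ring.
have AbE y : Ab y = (pc j y - (pc j x + t)) / e by rewrite /Ab /affine /pc; ring.
have AcE y : Ac y = (qc j y - qc j x) / e by rewrite /Ac /affine /qc; ring.
have in01 (a b : R) : 0 < (b - a) / e < 1 -> `|b - a| < e.
  rewrite ltr_pdivrMr// mul1r pmulr_lgt0 ?invr_gt0// => /andP[h1 h2].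
  by rewrite gtr0_norm.
(* a plateau between the two ends, cut off in the transversal direction *)
pose psi y := (step (Aa y) - step (Ab y)) * bump (Ac y).
have smpsi : flatgen psi.
  apply: flatgen_mul; last exact: flatgen_bump.
  apply: flatgen_add; first exact: flatgen_step.
  have -> : (fun x => - step (Ab x)) = (fun x => -1 * step (Ab x)).
    by apply/funext => z; rewrite mulN1r.
  by apply: flatgen_mul; [exact: flatgen_cst|exact: flatgen_step].
pose dpsi y := e^-1 * ((step' (Aa y) - step' (Ab y)) * bump (Ac y)).
have dpsiE y : is_derive y (basis j) psi (dpsi y).
  have da := @is_derive_affine _ _ _ _ _ _ y (basis j) (is_derive_step (Aa y)).
  have db := @is_derive_affine _ _ _ _ _ _ y (basis j) (is_derive_step (Ab y)).
  have dc := @is_derive_affine _ _ _ _ _ _ y (basis j) (is_derive_bump (Ac y)).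
  apply: (isdE (is_deriveM (is_deriveB da db) dc)) => //.
  rewrite /dpsi /GRing.scale /= -![_ * _ * (basis j).1]mulrA -![_ * _ * (basis j).2]mulrA.
  by rewrite -!mulrDr pc_e qc_e; ring.
have psi_out y : ~ ball x r y -> psi y = 0.
  move=> nb; apply/eqP; case: eqVneq => // /eqP py; case: nb.
  have py' : `|y - x| < r.
    apply: (@pq_norm j).
      have [a0|a0] := ltP 0 (Aa y); last first.
        case: py; rewrite /psi !step_le0 ?subrr ?mul0r//.
        apply: le_trans a0; rewrite AaE AbE ler_pM2r ?invr_gt0//; lra.
      have [b1|b1] := ltP (Ab y) 1; last first.
        case: py; rewrite /psi !step_ge1 ?subrr ?mul0r//.
        apply: le_trans b1 _; rewrite AaE AbE ler_pM2r ?invr_gt0//; lra.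
      move: a0 b1; rewrite AaE AbE pmulr_lgt0 ?invr_gt0// ltr_pdivrMr// => a0 b1.
      rewrite gtr0_norm//; lra.
    have [c01|c01] := boolP (0 < Ac y < 1); last by case: py; rewrite /psi bump_out ?mulr0.
    by rewrite AcE in c01; apply: lt_le_trans (in01 _ _ c01) _; lra.
  by rewrite -ball_normE /= distrC.
have tpsi : test_function psi.
  split; first exact: flatgen_smooth.
  exists [set y : R * R | `|y| <= `|x| + r]; split; first exact: compact_box.
  move=> y /= /negP; rewrite -ltNge => yr; apply: psi_out; rewrite -ball_normE /= => xy.
  have := ler_normD (y - x) x; rewrite subrK distrC; lra.
pose dp : R * R -> R := 'D_(basis j) psi.
have dpE y : dp y = dpsi y by exact: (@derive_val _ _ _ _ _ _ _ (dpsiE y)).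
have cpsi : continuous psi by exact: flatgen_continuous.
have cdp : continuous dp by have [+ _] := tpsi.1 [:: basis j : R * R].
pose M := `|x| + r.
have psiM y : M < `|y| -> psi y = 0.
  move=> yr; apply: psi_out; rewrite -ball_normE /= => xy.
  move: yr; rewrite /M; have := ler_normD (y - x) x; rewrite subrK distrC; lra.
have dpM y : M < `|y| -> dp y = 0 by exact: derive_eq0_out.
have If : (@lebesgue2 R).-integrable setT (EFin \o (fun y => f y * dp y)).
  by apply: (@integrable_cc _ _ M (contM cf cdp)) => y /dpM ->; rewrite mulr0.
have Ia : (@lebesgue2 R).-integrable setT (EFin \o (fun y => (c * pc j y + m) * dp y)).
  apply: (@integrable_cc _ _ M) => [|y /dpM ->]; last by rewrite mulr0.
  exact: (contM (contD (contM (@contC _ _) (@continuous_pc j)) (@contC _ _)) cdp).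
have I0 : (\int[@lebesgue2 R]_y (f y * dp y)%:E = \int[@lebesgue2 R]_y ((c * pc j y + m) * dp y)%:E)%E.
  rewrite (wfg _ tpsi) (@weak_partial_affine j c m _ tpsi); congr (- _)%E.
  apply: ae_eq_integral => //.
  - by apply/measurable_EFinP; apply: measurable_funM => //; exact: continuous_measurable2.
  - by apply/measurable_EFinP; apply: measurable_funM => //; exact: continuous_measurable2.
  - apply: ae_mono gc => y gy _; have [b|nb] := pselect (ball x r y); first by rewrite gy.
    by rewrite psi_out// !mulr0.
have IH : (\int[@lebesgue2 R]_y (H y * dp y)%:E = 0)%E.
  have := integralB_EFin measurableT If Ia; rewrite I0 subee.
    by move=> <-; apply: eq_integral => y _; rewrite -EFinB -mulrBl.
  exact: integrable_fin_num.
pose W y := - d0 * (H y * dp y).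
have IW : (\int[@lebesgue2 R]_y (W y)%:E = 0)%E.
  have iH : (@lebesgue2 R).-integrable setT (EFin \o (fun y => H y * dp y)).
    by apply: (@integrable_cc _ _ M (contM cH cdp)) => y /dpM ->; rewrite mulr0.
  have := @integralZl _ _ _ (@lebesgue2 R) _ measurableT _ iH (- d0).
  by rewrite IH mule0.
(* the contribution of the end [x] alone bounds the integrand from below *)
pose L y := e^-1 * k * (step' (Aa y) * bump (Ac y)).
have L0 y : 0 <= L y.
  by apply: mulr_ge0; apply: mulr_ge0; rewrite ?invr_ge0 ?(ltW e0) ?(ltW k0) ?step'_ge0 ?bump_ge0.
have LW y : L y <= W y.
  have [c01|c01] := boolP (0 < Ac y < 1); last first.
    by rewrite /L /W dpE /dpsi bump_out// !mulr0.
  have qy : `|qc j y - qc j x| < e by apply: in01; rewrite -AcE.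
  have ha : k * step' (Aa y) <= - d0 * H y * step' (Aa y).
    have [a01|a01] := boolP (0 < Aa y < 1); last by rewrite step'_out// !mulr0.
    rewrite ler_pM2r ?step'_gt0//; apply: ltW; apply: he1.
    apply: (@le_ball _ _ _ e) => //.
    rewrite -ball_normE /= distrC; apply: (@pq_norm j) => //.
    by apply: in01; rewrite -AaE.
  have hb : 0 <= d0 * H y * step' (Ab y).
    have [a01|a01] := boolP (0 < Ab y < 1); last by rewrite step'_out// !mulr0.
    apply: mulr_ge0; last exact: step'_ge0.
    apply: le_trans (ltW k0) _; apply: ltW; apply: he2.
    apply: (@le_ball _ _ _ e) => //.
    rewrite -ball_normE /= distrC; apply: (@pq_norm j); last by rewrite qc_basis.
    by rewrite pc_basis; apply: in01; rewrite -AbE.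
  have -> : W y = e^-1 * bump (Ac y) * (- d0 * H y * step' (Aa y) + d0 * H y * step' (Ab y)).
    by rewrite /W dpE /dpsi; ring.
  have -> : L y = e^-1 * bump (Ac y) * (k * step' (Aa y)) by rewrite /L; ring.
  apply: ler_wpM2l; first by rewrite mulr_ge0 ?bump_ge0// invr_ge0 ltW.
  by rewrite -[leLHS]addr0; apply: lerD.
have caff a b c' : continuous (@affine R a b c').
  exact: (contD (contD (contM (@contC _ _) continuous_fst2) (contM (@contC _ _) continuous_snd2)) (@contC _ _)).
have cL : continuous L.
  apply: (contM (@contC _ _)); apply: contM; last exact: (flatgen_continuous (flatgen_bump _ _ _)).
  exact: (flatgen_continuous (flatgen_step' _ _ _)).
have Lout y : M < `|y| -> L y = 0.
  move=> yM; have [c01|c01] := boolP (0 < Ac y < 1); last by rewrite /L bump_out// !mulr0.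
  have [a01|a01] := boolP (0 < Aa y < 1); last by rewrite /L step'_out// mul0r mulr0.
  exfalso; have : `|y - x| < e by apply: (@pq_norm j); apply: in01; rewrite -?AaE -?AcE.
  have := ler_normD (y - x) x; rewrite subrK; move: yM; rewrite /M; lra.
have := @integral_eq0_cont L M cL L0 Lout.
have iL : (\int[@lebesgue2 R]_y (L y)%:E <= 0)%E.
  rewrite -IW; apply: ge0_le_integral => //.
  - by move=> y _; rewrite lee_fin.
  - by apply/measurable_EFinP; exact: continuous_measurable2.
  - apply/measurable_EFinP; apply: continuous_measurable2.
    exact: (contM (@contC _ _) (contM cH cdp)).
  - by move=> y _; rewrite lee_fin.
move=> /(_ iL) /(_ (x + (e / 2, e / 2))); apply/eqP; rewrite gt_eqF//.
have h2 : 0 < (2^-1 : R) < 1 by lra.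
have b12 : (basis j).1 + (basis j).2 = 1 :> R by case: (ord2 j) => ->; rewrite /= ?addr0 ?add0r.
have eN : e != 0 by rewrite gt_eqF.
have EA : Aa (x + (e / 2, e / 2)) = 2^-1.
  rewrite AaE /pc (_ : (x + (e / 2, e / 2)).1 = x.1 + e / 2)//.
  rewrite (_ : (x + (e / 2, e / 2)).2 = x.2 + e / 2)//.
  have -> : (basis j).1 = 1 - (basis j).2 :> R by rewrite -b12 addrK.
  by field.
have EC : Ac (x + (e / 2, e / 2)) = 2^-1.
  rewrite AcE /qc (_ : (x + (e / 2, e / 2)).1 = x.1 + e / 2)//.
  rewrite (_ : (x + (e / 2, e / 2)).2 = x.2 + e / 2)//.
  have -> : (basis j).1 = 1 - (basis j).2 :> R by rewrite -b12 addrK.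
  by field.
by rewrite /L EA EC; apply: mulr_gt0; apply: mulr_gt0; rewrite ?invr_gt0 ?step'_gt0 ?bump_gt0.
Qed.

End ConstantWeakPartial.

Section AffineOfGradient.
Context {R : realType}.
Notation mR := (measurableTypeR R).
Implicit Types (x y : R * R) (f : R * R -> R).

Lemma pD1 x y : (x + y).1 = x.1 + y.1. Proof. by []. Qed.
Lemma pD2 x y : (x + y).2 = x.2 + y.2. Proof. by []. Qed.
Lemma pN1 x : (- x).1 = - x.1. Proof. by []. Qed.
Lemma pN2 x : (- x).2 = - x.2. Proof. by []. Qed.
Lemma pZ1 (a : R) x : (a *: x).1 = a * x.1. Proof. by []. Qed.
Lemma pZ2 (a : R) x : (a *: x).2 = a * x.2. Proof. by []. Qed.
Definition pairE := (pD1, pD2, pN1, pN2, pZ1, pZ2).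

Lemma pair_ext x y : x.1 = y.1 -> x.2 = y.2 -> x = y.
Proof. by case: x y => [a b] [c d] /= -> ->. Qed.

Lemma weak_partial_cst_step j f (g : R * R -> R) (c : R) x (r t : R) :
  continuous f -> measurable_fun setT (g : mR * mR -> mR) -> weak_partial j f g ->
  {ae lebesgue2, forall y, ball x r y -> g y = c} ->
  forall z, `|z - x| < r / 4 -> `|t| < r / 4 -> f (z + t *: basis j) = f z + c * t.
Proof.
move=> cf mg wg gc z zx tr.
have main z' s : `|z' - x| < r / 2 -> 0 < s -> s < r / 4 -> f (z' + s *: basis j) = f z' + c * s.
  move=> zx' s0 sr; apply: (@weak_partial_cst_line _ j f g c z' (r / 2) s) => //; last by lra.
  apply: ae_mono gc => y gy yz; apply: gy; move: yz; rewrite -!ball_normE /= => yz.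
  have := ler_distD z' x y; rewrite [`|x - z'|]distrC; lra.
have [t0|t0|->] := ltgtP t 0.
- have := main (z + t *: basis j) (- t).
  have -> : z + t *: basis j + - t *: basis j = z by rewrite scaleNr addrK.
  move=> ->; first by ring.
  + have := ler_normD (z - x) (t *: basis j); rewrite addrAC normrZ norm_basis mulr1; lra.
  + by rewrite oppr_gt0.
  + by rewrite -(ltr0_norm t0).
- have r0 := le_lt_trans (normr_ge0 _) tr.
  by apply: main => //; [lra|rewrite -(gtr0_norm t0)].
- by rewrite scale0r mulr0 !addr0.
Qed.

Lemma basis_decomp x y : y = x + (y.1 - x.1) *: basis ord0 + (y.2 - x.2) *: basis ord_max.
Proof.
by apply: pair_ext; rewrite !pairE /basis /=; ring.
Qed.

Lemma affine_local f (g : 'I_2 -> R * R -> R) (c : 'I_2 -> R) x (r : R) : 0 < r ->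
  continuous f -> (forall j, measurable_fun setT (g j : mR * mR -> mR)) ->
  (forall j, weak_partial j f (g j)) ->
  (forall j, {ae lebesgue2, forall y, ball x r y -> g j y = c j}) ->
  forall y, `|y - x| < r / 4 -> f y = f x + (c ord0 * (y.1 - x.1) + c ord_max * (y.2 - x.2)).
Proof.
move=> r0 cf mg wg gc y yx.
have [y1 y2] : `|y.1 - x.1| < r / 4 /\ `|y.2 - x.2| < r / 4.
  by move: yx; rewrite prod_normE gt_max => /andP.
rewrite {1}(basis_decomp x y).
rewrite (weak_partial_cst_step cf (mg _) (wg ord_max) (gc ord_max))//; last first.
  by rewrite addrAC subrr add0r normrZ norm_basis mulr1.
rewrite (weak_partial_cst_step cf (mg _) (wg ord0) (gc ord0))//; first by rewrite addrA.
by rewrite subrr normr0 divr_gt0.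
Qed.

(** Near each point of [O] one reaches the neighbours by moving along the two axes
    in turn, so [f] is locally affine with the same slopes.  Hence the derivative
    of [f] along a segment in [O] is constant. *)
Theorem affine_of_weak_gradient f (g : 'I_2 -> R * R -> R) (c : 'I_2 -> R) (O : set (R * R)) :
  continuous f -> (forall j, measurable_fun setT (g j : mR * mR -> mR)) ->
  (forall j, weak_partial j f (g j)) -> open O ->
  (forall x y (t : R), O x -> O y -> 0 <= t <= 1 -> O (x + t *: (y - x))) ->
  (forall j, {ae lebesgue2, forall y, O y -> g j y = c j}) ->
  forall x y, O x -> O y -> f y = f x + (c ord0 * (y.1 - x.1) + c ord_max * (y.2 - x.2)).
Proof.
move=> cf mg wg oO convO gc x y Ox Oy.
pose m := c ord0 * (y.1 - x.1) + c ord_max * (y.2 - x.2).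
pose p (s : R) : R * R := x + s *: (y - x).
have cp : continuous p.
  by move=> s; apply: cvgD; [exact: cvg_cst|apply: cvgZr_tmp; exact: cvg_id].
have d01 (t : R) : t \in `]0, 1[ -> is_derive t (1 : R) (f \o p) m.
  rewrite in_itv /= => /andP[t0 t1].
  have Oz : O (p t) by apply: convO => //; rewrite !ltW.
  have /nbhs_ballP[r /= r0 hr] : nbhs (p t) O by exact: open_nbhs_nbhs.
  have loc : forall z, `|z - p t| < r / 4 ->
      f z = f (p t) + (c ord0 * (z.1 - (p t).1) + c ord_max * (z.2 - (p t).2)).
    apply: (@affine_local f g c (p t) r) => // j.
    by apply: ae_mono (gc j) => z gz /hr.
  have dl : is_derive t (1 : R) (fun s : R => f (p t) + (s - t) * m) m.
    have d1 := is_deriveB (is_derive_id t (1 : R)) (is_derive_cst t t (1 : R)).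
    have d2 := is_deriveD (is_derive_cst (f (p t)) t (1 : R)) (is_deriveM d1 (is_derive_cst m t (1 : R))).
    by apply: (isdE d2) => //; rewrite /GRing.scale /=; ring.
  apply: near_eq_is_derive dl.
  near=> s.
  have h : `|p s - p t| < r / 4.
    rewrite distrC; near: s.
    have r40 : 0 < r / 4 by rewrite divr_gt0.
    by have /cvgrPdist_lt/(_ _ r40) := cp t.
  rewrite /= (loc _ h); congr (_ + _).
  have -> : (p s).1 - (p t).1 = (s - t) * (y.1 - x.1) by rewrite /p !pairE; ring.
  have -> : (p s).2 - (p t).2 = (s - t) * (y.2 - x.2) by rewrite /p !pairE; ring.
  by rewrite /m; ring.
have cfp : {within `[0, 1], continuous (f \o p)}.
  apply: continuous_subspaceT => s; apply: continuous_comp; [exact: cp|exact: cf].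
have [_ _] := MVT_segment ler01 d01 cfp.
have -> : (f \o p) 1 = f y by rewrite /= /p scale1r addrC subrK.
have -> : (f \o p) 0 = f x by rewrite /= /p scale0r addr0.
rewrite -/m; lra.
Unshelve. all: by end_near. Qed.

End AffineOfGradient.

(** * Euclidean geometry of the plane *)

Section Euclid.
Context {R : realType}.
Implicit Types (x y z : R * R) (s t : R) (A B : 'M[R]_2).

Definition dotp x y : R := x.1 * y.1 + x.2 * y.2.
Definition det2 x y : R := x.1 * y.2 - x.2 * y.1.
Definition rv s : R * R := (cos s, sin s).
Definition rot s x : R * R := (cos s * x.1 - sin s * x.2, sin s * x.1 + cos s * x.2).

Lemma rotE1 s x : (rot s x).1 = cos s * x.1 - sin s * x.2. Proof. by []. Qed.
Lemma rotE2 s x : (rot s x).2 = sin s * x.1 + cos s * x.2. Proof. by []. Qed.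

Lemma mxact_rotation s x : mxact (rotation s) x = rot s x.
Proof. by rewrite /mxact /rot !mxE /= mulNr. Qed.

Lemma rotD s t x : rot (s + t) x = rot s (rot t x).
Proof. by apply: pair_ext; rewrite /rot /= cosD sinD; ring. Qed.

Lemma rot0 x : rot 0 x = x.
Proof. by apply: pair_ext; rewrite /rot /= cos0 sin0; ring. Qed.

Lemma rotK s x : rot (- s) (rot s x) = x.
Proof. by rewrite -rotD addNr rot0. Qed.

Lemma rotNK s x : rot s (rot (- s) x) = x.
Proof. by rewrite -rotD addrN rot0. Qed.

Lemma rotC s t x : rot s (rot t x) = rot t (rot s x).
Proof. by rewrite -!rotD addrC. Qed.

Lemma rotZ s (a : R) x : rot s (a *: x) = a *: rot s x.
Proof. by apply: pair_ext; rewrite !(rotE1, rotE2, pairE); ring. Qed.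

Lemma rotB s x y : rot s (x - y) = rot s x - rot s y.
Proof. by apply: pair_ext; rewrite !(rotE1, rotE2, pairE); ring. Qed.

Lemma rotDl s x y : rot s (x + y) = rot s x + rot s y.
Proof. by apply: pair_ext; rewrite !(rotE1, rotE2, pairE); ring. Qed.

Lemma rot_rv s t : rot s (rv t) = rv (s + t).
Proof. by apply: pair_ext; rewrite /rot /rv /= ?cosD ?sinD; ring. Qed.

Lemma c2s2 s : cos s * cos s + sin s * sin s = 1.
Proof. by rewrite -!expr2 cos2Dsin2. Qed.

Lemma dot_rot s x y : dotp (rot s x) (rot s y) = dotp x y.
Proof.
rewrite /dotp /rot /=; rewrite -[RHS]mul1r -(c2s2 s); ring.
Qed.

Lemma dot_rv s t : dotp (rv s) (rv t) = cos (s - t).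
Proof. by rewrite /dotp /rv /= cosB. Qed.

Lemma det_rv s t : det2 (rv s) (rv t) = sin (t - s).
Proof. by rewrite /det2 /rv /= sinB; ring. Qed.

Lemma enorm_ge0 x : 0 <= enorm x. Proof. exact: sqrtr_ge0. Qed.

Lemma enorm_sqr x : enorm x ^+ 2 = x.1 ^+ 2 + x.2 ^+ 2.
Proof. by rewrite /enorm sqr_sqrtr// addr_ge0 ?sqr_ge0. Qed.

Lemma enorm_dot x : enorm x ^+ 2 = dotp x x.
Proof. by rewrite enorm_sqr /dotp !expr2. Qed.

Lemma enorm_rot s x : enorm (rot s x) = enorm x.
Proof. by rewrite /enorm; congr Num.sqrt; have := dot_rot s x x; rewrite /dotp -!expr2. Qed.

Lemma enormZ (a : R) x : enorm (a *: x) = `|a| * enorm x.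
Proof.
rewrite /enorm !pairE !exprMn -mulrDr sqrtrM ?sqr_ge0//.
by rewrite sqrtr_sqr.
Qed.

Lemma enorm_rv s : enorm (rv s) = 1.
Proof. by rewrite /enorm /rv /= cos2Dsin2 sqrtr1. Qed.

Lemma enormN x : enorm (- x) = enorm x.
Proof. by rewrite /enorm !pairE !sqrrN. Qed.

Lemma enorm0 : enorm (0 : R * R) = 0.
Proof. by rewrite /enorm /= expr0n /= addr0 sqrtr0. Qed.

Lemma enormBC x y : enorm (x - y) = enorm (y - x).
Proof. by rewrite -enormN opprB. Qed.

Lemma dot_le x y : dotp x y <= enorm x * enorm y.
Proof.
have [//|h] := leP (dotp x y) 0.
  by move=> h; apply: le_trans h _; rewrite mulr_ge0 ?enorm_ge0.
rewrite -(ler_pXn2r (_ : 0 < 2)%N) ?nnegrE ?mulr_ge0 ?enorm_ge0 ?(ltW h)//.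
rewrite exprMn !enorm_sqr -subr_ge0.
have -> : (x.1 ^+ 2 + x.2 ^+ 2) * (y.1 ^+ 2 + y.2 ^+ 2) - dotp x y ^+ 2 = det2 x y ^+ 2.
  by rewrite /dotp /det2; ring.
exact: sqr_ge0.
Qed.

Lemma enormD x y : enorm (x + y) <= enorm x + enorm y.
Proof.
rewrite -(ler_pXn2r (_ : 0 < 2)%N) ?nnegrE ?addr_ge0 ?enorm_ge0//.
rewrite enorm_sqr !pairE [leRHS]sqrrD !enorm_sqr; have := dot_le x y; rewrite /dotp; lra.
Qed.

Lemma enorm_dist x y z : enorm (x - z) <= enorm (x - y) + enorm (y - z).
Proof. by rewrite -{1}(subrK y x) -addrA; exact: enormD. Qed.

Lemma enorm_lerB x y : `|enorm x - enorm y| <= enorm (x - y).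
Proof.
rewrite ler_norml; apply/andP; split.
  have := enormD (y - x) x; rewrite subrK enormBC; lra.
have := enormD (x - y) y; rewrite subrK; lra.
Qed.

Lemma coord_le_enorm x : `|x.1| <= enorm x /\ `|x.2| <= enorm x.
Proof.
split; rewrite -(ler_pXn2r (_ : 0 < 2)%N) ?nnegrE ?enorm_ge0 ?normr_ge0//
  real_normK ?num_real// enorm_sqr; have := sqr_ge0 x.1; have := sqr_ge0 x.2; lra.
Qed.

Lemma enorm_le_norm x : enorm x <= 2 * `|x|.
Proof.
have E : x = x.1 *: (1, 0) + x.2 *: (0, 1).
  by apply: pair_ext; rewrite !pairE /=; ring.
rewrite {1}E; apply: le_trans (enormD _ _) _.
rewrite !enormZ (_ : enorm (1, 0) = 1); last by rewrite /enorm /= expr1n expr0n addr0 sqrtr1.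
rewrite (_ : enorm (0, 1) = 1); last by rewrite /enorm /= expr1n expr0n add0r sqrtr1.
rewrite !mulr1 mulr_natl mulr2n prod_normE lerD// le_max lexx ?orbT//.
Qed.

Lemma norm_le_enorm x : `|x| <= enorm x.
Proof. by rewrite prod_normE ge_max; have [-> ->] := coord_le_enorm x. Qed.

Lemma enorm_eq0 x : enorm x = 0 -> x = 0.
Proof.
move=> x0; apply/eqP; rewrite -normr_eq0; apply/eqP/le_anti.
by rewrite normr_ge0 -x0 norm_le_enorm.
Qed.

Lemma continuous_enorm : continuous (@enorm R).
Proof.
move=> x; rewrite /enorm; apply: (@continuous_comp _ _ _ (fun x : R * R => x.1 ^+ 2 + x.2 ^+ 2) Num.sqrt).
  exact: (contD (contM continuous_fst2 continuous_fst2) (contM continuous_snd2 continuous_snd2)).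
exact: sqrt_continuous.
Qed.

Lemma polar x : exists rho t, [/\ 0 <= rho, 0 <= t < 2 * pi & x = rho *: rv t].
Proof.
have [->|x0] := eqVneq x 0.
  exists 0, 0; split => //; first by rewrite lexx mulr_gt0// pi_gt0.
  by rewrite scale0r.
have e0 : 0 < enorm x.
  by rewrite lt_neqAle enorm_ge0 andbT eq_sym; apply: contra x0 => /eqP/enorm_eq0 ->.
have eN : enorm x != 0 by rewrite gt_eqF.
pose a := x.1 / enorm x; pose b := x.2 / enorm x.
have ab : a ^+ 2 + b ^+ 2 = 1.
  by rewrite /a /b !expr_div_n -mulrDl -enorm_sqr divff// expf_neq0.
have a1 : -1 <= a <= 1.
  rewrite -ler_norml -(ler_pXn2r (_ : 0 < 2)%N) ?nnegrE//.
  rewrite real_normK ?num_real// expr1n -ab lerDl sqr_ge0 //.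
have xE t : cos t = a -> sin t = b -> x = enorm x *: rv t.
  by move=> ct st; apply: pair_ext; rewrite !pairE /rv /= ?ct ?st /a /b mulrC divfK.
have s1 : sin (acos a) = `|b|.
  by rewrite sin_acos// -ab addrAC subrr add0r sqrtr_sqr.
have [p0 p1] : 0 <= acos a /\ acos a <= pi by rewrite acos_ge0// acos_lepi.
have pi0 := pi_gt0 R.
have [b0|b0] := leP 0 b.
  exists (enorm x), (acos a); split; [exact: enorm_ge0|lra|].
  by apply: xE; rewrite ?acosK ?s1 ?ger0_norm// in_itv.
have p2 : 0 < acos a.
  rewrite lt_neqAle p0 andbT eq_sym; apply/eqP => h.
  by move: s1; rewrite h sin0 ltr0_norm// => /eqP; rewrite eq_sym oppr_eq0 lt_eqF.
exists (enorm x), (2 * pi - acos a); split; [exact: enorm_ge0|lra|].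
have E : 2 * pi - acos a = - acos a + pi *+ 2 by rewrite mulr2n; ring.
by apply: xE; rewrite E ?cosD2pi ?sinD2pi ?cosN ?sinN ?acosK ?in_itv ?s1 ?ltr0_norm ?opprK.
Qed.

(** Along the segment from [x] to [y] let [T] be the last time up to which the
    bound holds.  If [T < 1], then a piece that is met at times arbitrarily close
    after [T] is met at one such time [s], and the bound inside the piece, passed
    to the limit at [T], extends the bound up to [s].  So just after [T] every
    piece is avoided, which contradicts the covering by finitely many pieces. *)
Lemma piecewise_lipschitz (f : R * R -> R * R) (I : finType) (D : I -> set (R * R)) (L : R) :
  0 <= L -> continuous f -> (forall x, exists i, D i x) ->
  (forall i x y, D i x -> D i y -> enorm (f x - f y) <= L * enorm (x - y)) ->
  forall x y, enorm (f x - f y) <= L * enorm (x - y).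
Proof.
move=> L0 cf cov hD x y.
pose p (s : R) : R * R := x + s *: (y - x).
have cp : continuous p.
  by move=> s; apply: cvgD; [exact: cvg_cst|apply: cvgZr_tmp; exact: cvg_id].
have p1 : p 1 = y by rewrite /p scale1r addrC subrK.
have p0 : p 0 = x by rewrite /p scale0r addr0.
pose d := enorm (y - x); have d0 : 0 <= d by exact: enorm_ge0.
have pp s t : enorm (p s - p t) = `|s - t| * d.
  by rewrite /p opprD addrACA subrr add0r -scalerBl enormZ.
pose gap (a s : R) := enorm (f (p s) - f (p a)).
have cgap a : continuous (gap a).
  move=> s; apply: (@continuous_comp _ _ _ (fun s => f (p s) - f (p a)) (@enorm R)); last exact: continuous_enorm.
  by apply: cvgB; [apply: continuous_comp; [exact: cp|exact: cf]|exact: cvg_cst].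
pose S : set R := [set t | 0 <= t <= 1 /\ gap 0 t <= L * (t * d)].
have S0 : S 0 by split; rewrite ?lexx ?ler01// /gap subrr enorm0 mul0r mulr0.
have ubS : has_ubound S by exists 1 => t [/andP[_ t1] _].
have supS : has_sup S by split => //; exists 0.
pose T := sup S.
have T0 : 0 <= T by apply: ub_le_sup.
have T1 : T <= 1 by apply: ge_sup; [exists 0|move=> t [/andP[_ ?] _]].
have ST : S T.
  split; first by rewrite T0.
  rewrite leNgt; apply/negP => bad.
  pose F t := gap 0 t - L * (t * d).
  have cF : continuous F.
    move=> t; apply: cvgB; first exact: cgap.
    by apply: cvgM; [exact: cvg_cst|apply: cvgM; [exact: cvg_id|exact: cvg_cst]].
  have FT : 0 < F T by rewrite /F subr_gt0.
  have /nbhs_ballP[e /= e0 he] : \forall t \near T, 0 < F t.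
    have /cvgrPdist_lt/(_ _ FT) := cF T.
    by apply: filterS => t; rewrite ltr_norml => /andP[_]; lra.
  have [t St tT] := sup_adherent e0 supS; rewrite -/T in tT.
  have tT' : t <= T by apply: ub_le_sup.
  have : 0 < F t by apply: he; rewrite -ball_normE /= ger0_norm ?subr_ge0//; lra.
  by case: St => _; rewrite /F => h1 h2; lra.
have [T1'|T1'] := eqVneq T 1.
  have : gap 0 1 <= L * (1 * d) by rewrite -T1'; case: ST.
  by rewrite /gap p1 p0 mul1r enormBC /d [enorm (x - y)]enormBC.
have {T1'}T1 : T < 1 by rewrite lt_neqAle T1'.
exfalso.
have bad s : T < s -> s <= 1 -> L * ((s - T) * d) < gap T s.
  move=> Ts s1; rewrite ltNge; apply/negP => good.
  have : S s.
    split; first by rewrite s1 andbT (le_trans T0)// ltW.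
    apply: le_trans (enorm_dist _ (f (p T)) _) _.
    by case: ST => _; rewrite /gap => h; move: good; rewrite /gap; lra.
  by move=> /(ub_le_sup ubS); rewrite leNgt Ts.
have ev i : \forall s \near T^'+, ~ D i (p s).
  have [[s [Ts s1 Ds]]|h] := pselect (exists s, [/\ T < s, s <= 1 & D i (p s)]); last first.
    near=> s => Ds; apply: h; exists s; split => //; near: s; exact: nbhs_right_le.
  (* positive at [T], hence near [T]; but nonpositive on the piece of [p s] *)
  pose F t := gap s t - L * ((s - t) * d).
  have cF : continuous F.
    move=> t; apply: cvgB; first exact: cgap.
    apply: cvgM; first exact: cvg_cst.
    by apply: cvgM; [apply: cvgB; [exact: cvg_cst|exact: cvg_id]|exact: cvg_cst].
  have FT : 0 < F T by rewrite /F subr_gt0 /gap enormBC; apply: bad.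
  have nF : \forall t \near T, 0 < F t.
    have /cvgrPdist_lt/(_ _ FT) := cF T.
    by apply: filterS => t; rewrite ltr_norml => /andP[_]; lra.
  have nF' : \forall t \near T^'+, 0 < F t by rewrite /at_right near_withinE; apply: filterS nF.
  near=> t => Dt.
  have : 0 < F t by near: t; exact: nF'.
  have ts : t < s by near: t; exact: nbhs_right_lt.
  have := hD i _ _ Dt Ds; rewrite pp /F /gap distrC gtr0_norm ?subr_gt0//; lra.
have H : \forall s \near T^'+, forall i, ~ D i (p s) by apply: filter_forall.
have [s hs] := @filter_ex _ _ (at_right_proper_filter T) _ H.
by have [i Di] := cov (p s); exact: (hs i).
Unshelve. all: by end_near. Qed.

End Euclid.

(** * Convex hulls and triangles *)

Section Convexity.
Context {R : realType}.
Implicit Types (x y z a b c : R * R) (S C : set (R * R)).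

Lemma convex_setP C : convex_set C <->
  forall x y (t : R), C x -> C y -> 0 <= t <= 1 -> C (x + t *: (y - x)).
Proof.
split=> [cC x y t Cx Cy /andP[t0 t1]|h x y l].
  have := cC y x (Itv01 t0 t1); rewrite !inE => /(_ Cy Cx) /=.
  suff -> : x + t *: (y - x) = t *: y + (1 - t) *: x by [].
  by apply: pair_ext; rewrite !pairE; ring.
rewrite !inE => Cx Cy.
have l01 : 0 <= l%:num <= 1 by rewrite ge0 le1.
have := h y x l%:num Cy Cx l01.
suff -> : y + l%:num *: (x - y) = l%:num *: x + (1 - l%:num) *: y by [].
by apply: pair_ext; rewrite !pairE; ring.
Qed.

Lemma hull_sub S : S `<=` convex_hull S.
Proof. exact: sub_gen_smallest. Qed.

Lemma hull_min S C : convex_set C -> S `<=` C -> convex_hull S `<=` C.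
Proof. exact: smallest_sub. Qed.

Lemma hull_convex S x y (t : R) : convex_hull S x -> convex_hull S y -> 0 <= t <= 1 ->
  convex_hull S (x + t *: (y - x)).
Proof.
move=> hx hy t01 C [cC SC]; move/convex_setP: (cC); apply => //; [exact: hx|exact: hy].
Qed.

Lemma convex_hull_convex S : convex_set (convex_hull S).
Proof. by apply/convex_setP => x y t; exact: hull_convex. Qed.

Lemma hull_mono S C : S `<=` C -> convex_hull S `<=` convex_hull C.
Proof. by move=> SC; apply: hull_min; [exact: convex_hull_convex|move=> x /SC; exact: hull_sub]. Qed.

Lemma convex3 C a b c (l m k : R) : convex_set C -> C a -> C b -> C c ->
  0 <= l -> 0 <= m -> 0 <= k -> l + m + k = 1 -> C (l *: a + m *: b + k *: c).
Proof.
move=> /convex_setP cC Ca Cb Cc l0 m0 k0 lmk.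
have [k1|k1] := eqVneq k 1.
  have -> : l = 0 by lra.
  have -> : m = 0 by lra.
  by rewrite k1 !scale0r scale1r !add0r.
have k1' : 1 - k != 0 by rewrite subr_eq0 eq_sym.
have k2 : 0 < 1 - k by rewrite lt_neqAle eq_sym k1' /=; lra.
have -> : l *: a + m *: b + k *: c = (a + (m / (1 - k)) *: (b - a)) + k *: (c - (a + (m / (1 - k)) *: (b - a))).
  have -> : l = 1 - k - m by lra.
  by apply: pair_ext; rewrite !pairE; field.
apply: (cC) => //; last by apply/andP; split; lra.
apply: (cC) => //; apply/andP; split; first by rewrite divr_ge0// ltW.
by rewrite ler_pdivrMr// mul1r; lra.
Qed.

Lemma dotpDl x y z : dotp (x + y) z = dotp x z + dotp y z.
Proof. by rewrite /dotp !pairE; ring. Qed.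
Lemma dotpZl (k : R) x z : dotp (k *: x) z = k * dotp x z.
Proof. by rewrite /dotp !pairE; ring. Qed.
Lemma dotpBl x y z : dotp (x - y) z = dotp x z - dotp y z.
Proof. by rewrite /dotp !pairE; ring. Qed.

Lemma convex_halfplane z (q : R) : convex_set [set x | dotp x z <= q].
Proof.
apply/convex_setP => x y t /= hx hy /andP[t0 t1].
rewrite dotpDl dotpZl dotpBl.
have -> : dotp x z + t * (dotp y z - dotp x z) = (1 - t) * dotp x z + t * dotp y z by ring.
have -> : q = (1 - t) * q + t * q by ring.
by rewrite lerD// ler_wpM2l//; lra.
Qed.

(** A similarity and its inverse preserve convexity, and the hull is the smallest
    convex set. *)
Lemma hull_similar S (k s : R) : k != 0 ->
  convex_hull [set k *: rot s x | x in S] = [set x | convex_hull S (k^-1 *: rot (- s) x)].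
Proof.
move=> k0; apply/seteqP; split.
  apply: hull_min.
    apply/convex_setP => x y t /= hx hy t01.
    have -> : k^-1 *: rot (- s) (x + t *: (y - x)) =
       k^-1 *: rot (- s) x + t *: (k^-1 *: rot (- s) y - k^-1 *: rot (- s) x).
      by rewrite rotDl rotZ rotB; apply: pair_ext; rewrite !pairE; ring.
    exact: hull_convex.
  move=> _ [x Sx <-] /=; rewrite rotZ rotK scalerA mulVf// scale1r.
  exact: hull_sub.
move=> x /= hx.
have : convex_hull S `<=` [set y | convex_hull [set k *: rot s x | x in S] (k *: rot s y)].
  apply: hull_min.
    apply/convex_setP => y z t /= hy hz t01.
    have -> : k *: rot s (y + t *: (z - y)) = k *: rot s y + t *: (k *: rot s z - k *: rot s y).
      by rewrite rotDl rotZ rotB; apply: pair_ext; rewrite !pairE; ring.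
    exact: hull_convex.
  by move=> y Sy /=; apply: hull_sub; exists y.
move=> /(_ _ hx) /=; rewrite rotZ rotNK scalerA mulfV// scale1r.
exact.
Qed.

(** Twice the signed area of the triangle. *)
Definition or3 a b c : R := det2 (b - a) (c - a).

Lemma or3E a b c : or3 a b c = det2 a b + det2 b c + det2 c a.
Proof. by rewrite /or3 /det2 !pairE; ring. Qed.

(** Triangles are described by the signs of the barycentric coordinates. *)
Definition ctri a b c x : Prop := [/\ 0 <= or3 x b c, 0 <= or3 a x c & 0 <= or3 a b x].
Definition otri a b c x : Prop := [/\ 0 < or3 x b c, 0 < or3 a x c & 0 < or3 a b x].

Lemma or3_sum a b c x : or3 x b c + or3 a x c + or3 a b x = or3 a b c.
Proof. by rewrite /or3 /det2 !pairE; ring. Qed.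

Lemma bary a b c x : or3 a b c != 0 ->
  x = (or3 x b c / or3 a b c) *: a + (or3 a x c / or3 a b c) *: b + (or3 a b x / or3 a b c) *: c.
Proof.
move=> D0.
have E1 : or3 x b c * a.1 + or3 a x c * b.1 + or3 a b x * c.1 = or3 a b c * x.1.
  by rewrite /or3 /det2 !pairE; ring.
have E2 : or3 x b c * a.2 + or3 a x c * b.2 + or3 a b x * c.2 = or3 a b c * x.2.
  by rewrite /or3 /det2 !pairE; ring.
by apply: pair_ext; rewrite !pairE !(mulrAC _ (or3 a b c)^-1) -!mulrDl ?E1 ?E2 mulrAC mulfV// mul1r.
Qed.

Lemma ctri_in_convex a b c x C : 0 < or3 a b c -> convex_set C -> C a -> C b -> C c ->
  ctri a b c x -> C x.
Proof.
move=> D0 cC Ca Cb Cc [h1 h2 h3]; rewrite (@bary a b c x) ?gt_eqF//.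
have DN : or3 a b c != 0 by rewrite gt_eqF.
apply: convex3 => //; rewrite ?divr_ge0 ?(ltW D0)//.
by rewrite -!mulrDl or3_sum divff.
Qed.

Lemma or3_rotl a b c : or3 a b c = or3 b c a.
Proof. by rewrite !or3E; ring. Qed.

Lemma continuous_or3 a b : continuous (fun x => or3 a b x).
Proof.
have -> : (fun x => or3 a b x) = (fun x => (b - a).1 * (x.2 - a.2) - (b - a).2 * (x.1 - a.1)).
  by apply/funext => x.
apply: contD; [apply: contM|apply: contN; apply: contM]; try exact: contC.
- exact: (contD continuous_snd2 (@contC _ _)).
- exact: (contD continuous_fst2 (@contC _ _)).
Qed.

Lemma open_gt0 (f : R * R -> R) : continuous f -> open [set x | 0 < f x].
Proof. by move=> /continuousP cf; have := cf _ (@open_gt _ 0). Qed.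

Lemma otri_open a b c : open (otri a b c : set (R * R)).
Proof.
have -> : (otri a b c : set (R * R)) = [set x | 0 < or3 b c x] `&` [set x | 0 < or3 c a x] `&` [set x | 0 < or3 a b x].
  apply/seteqP; split => x /=; rewrite /otri (or3_rotl x b c) -(or3_rotl c a x).
    by move=> [].
  by move=> [[]].
by apply: openI; [apply: openI|]; apply: open_gt0; exact: continuous_or3.
Qed.

Lemma otri_ctri a b c x : otri a b c x -> ctri a b c x.
Proof. by move=> [h1 h2 h3]; split; exact: ltW. Qed.

Lemma otri_sub_open_triangle a b c : 0 < or3 a b c -> otri a b c `<=` open_triangle a b c.
Proof.
move=> D0 x hx; rewrite /open_triangle /interior.
apply: (@filterS _ _ _ (otri a b c)); last by apply: open_nbhs_nbhs; split => //; exact: otri_open.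
move=> y /otri_ctri; apply: ctri_in_convex => //; first exact: convex_hull_convex.
- by apply: hull_sub; exact: Or31.
- by apply: hull_sub; exact: Or32.
- by apply: hull_sub; exact: Or33.
Qed.

Lemma or3_affine a b x y (t : R) : or3 a b (x + t *: (y - x)) = (1 - t) * or3 a b x + t * or3 a b y.
Proof. by rewrite /or3 /det2 !pairE; ring. Qed.

Lemma or3_affine1 a b x y (t : R) : or3 (x + t *: (y - x)) a b = (1 - t) * or3 x a b + t * or3 y a b.
Proof. by rewrite !(or3_rotl _ a b) or3_affine. Qed.

Lemma or3_affine2 a b x y (t : R) : or3 a (x + t *: (y - x)) b = (1 - t) * or3 a x b + t * or3 a y b.
Proof. by rewrite /or3 /det2 !pairE; ring. Qed.

Lemma otri_convex a b c x y (t : R) : otri a b c x -> otri a b c y -> 0 <= t <= 1 ->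
  otri a b c (x + t *: (y - x)).
Proof.
move=> [x1 x2 x3] [y1 y2 y3] /andP[t0 t1].
have pos (u v : R) : 0 < u -> 0 < v -> 0 < (1 - t) * u + t * v.
  move=> u0 v0; have [->|t0'] := eqVneq t 0; first by rewrite subr0 mul1r mul0r addr0.
  by rewrite ltr_wpDl ?mulr_gt0 ?mulr_ge0 ?(ltW u0) ?subr_ge0// lt_neqAle eq_sym t0'.
by split; rewrite ?or3_affine1 ?or3_affine2 ?or3_affine; apply: pos.
Qed.

(** Along a segment to an interior point the barycentric coordinates are affine
    and positive at the end; hence closed triangles are limits of open ones. *)
Lemma ctri_otri_segment a b c x y (t : R) : ctri a b c x -> otri a b c y -> 0 < t <= 1 ->
  otri a b c (x + t *: (y - x)).
Proof.
move=> [x1 x2 x3] [y1 y2 y3] /andP[t0 t1].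
have pos (u v : R) : 0 <= u -> 0 < v -> 0 < (1 - t) * u + t * v.
  by move=> u0 v0; rewrite ltr_wpDl ?mulr_gt0 ?mulr_ge0 ?subr_ge0.
by split; rewrite ?or3_affine1 ?or3_affine2 ?or3_affine; apply: pos.
Qed.

Lemma otri_center a b c : 0 < or3 a b c -> otri a b c (3^-1 *: (a + b + c)).
Proof.
move=> D0; have D3 : 0 < or3 a b c / 3 by rewrite divr_gt0.
split; [have -> : or3 (3^-1 *: (a + b + c)) b c = or3 a b c / 3|
 have -> : or3 a (3^-1 *: (a + b + c)) c = or3 a b c / 3|
 have -> : or3 a b (3^-1 *: (a + b + c)) = or3 a b c / 3] => //;
 by rewrite /or3 /det2 !pairE; field.
Qed.

End Convexity.

(** * The regular polygon *)

Section Polygon.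
Context {R : realType}.
Variable n : nat.
Hypothesis n3 : (3 <= n)%N.
Implicit Types (x y z : R * R) (t : R).

Let th : R := theta n.

Lemma n_gt0 : 0 < n%:R :> R. Proof. by rewrite ltr0n; case: n n3. Qed.

Lemma theta_mul_n : th * n%:R = 2 * pi.
Proof. by rewrite /th /theta mulfVK// gt_eqF// n_gt0. Qed.

Lemma theta_gt0 : 0 < th.
Proof. by rewrite /th /theta divr_gt0 ?n_gt0// mulr_gt0// pi_gt0. Qed.

Lemma theta_mul3_le : th * 3 <= 2 * pi.
Proof. by rewrite -theta_mul_n ler_pM2l ?theta_gt0// ler_nat. Qed.

Lemma theta_lt_pi : th < pi.
Proof. have := theta_mul3_le; have := pi_gt0 R; lra. Qed.

Lemma pi_div_n : pi / n%:R = th / 2.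
Proof. by rewrite /th /theta; field; rewrite gt_eqF// n_gt0. Qed.

Definition apothem : R := cos (th / 2).

Lemma apothem_gt0 : 0 < apothem.
Proof.
have := theta_mul3_le; have := theta_gt0; have := pi_gt0 R => p0 t0 t3.
by rewrite /apothem cos_gt0_pihalf//; apply/andP; split; lra.
Qed.

Lemma cos_lt (a b : R) : 0 <= a -> a < b -> b <= pi -> cos b < cos a.
Proof.
move=> a0 ab bp; rewrite ltr_cos// in_itv /=; apply/andP; split => //; lra.
Qed.

Lemma cos_le (a b : R) : 0 <= a -> a <= b -> b <= pi -> cos b <= cos a.
Proof. by move=> a0; rewrite le_eqVlt => /orP[/eqP->//|ab bp]; apply/ltW/cos_lt. Qed.

Lemma sin_gt0_th t : 0 < t < pi -> 0 < sin t.
Proof. by move=> /andP[t0 t1]; apply: sin_gt0_pi; rewrite t0. Qed.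

Lemma sinth_gt0 : 0 < sin th.
Proof. by apply: sin_gt0_th; rewrite theta_gt0 theta_lt_pi. Qed.

(** The cosine decreases with the distance from 0 on the circle, and these angles
    stay at least [th / 2] away from 0. *)
Lemma cos_half t : th / 2 <= `|t| <= 2 * pi - th / 2 -> cos t <= apothem.
Proof.
move=> /andP[t1 t2]; have t0 := theta_gt0; have tp := theta_lt_pi; have p0 := pi_gt0 R.
have -> : cos t = cos `|t| by case: (ger0P t) => // _; rewrite cosN.
have [tpi|tpi] := leP `|t| pi.
  by apply: cos_le; lra.
have -> : cos `|t| = cos (2 * pi - `|t|).
  have -> : 2 * pi - `|t| = - `|t| + pi *+ 2 by rewrite mulr2n; ring.
  by rewrite cosD2pi cosN.
by apply: cos_le; lra.
Qed.

Definition vertE (i : nat) : R * R := rv (th * i%:R).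

Lemma E_ptE i : E_pt n i.+1 = vertE i.
Proof.
rewrite /E_pt /Qn mxact_rotation (_ : e1 = rv 0); last by rewrite /e1 /rv cos0 sin0.
by rewrite rot_rv addr0 /vertE -/th -natr1 addrK.
Qed.

Definition halfplane_polygon : set (R * R) :=
  [set x | forall i, (i < n)%N -> dotp x (rv (th * (i%:R + 2^-1))) <= apothem].

Lemma vertE_dot i k : (i < n)%N -> (k < n)%N -> dotp (vertE i) (rv (th * (k%:R + 2^-1))) <= apothem.
Proof.
move=> ni nk; rewrite /vertE dot_rv -mulrBr; apply: cos_half.
have t0 := theta_gt0; rewrite normrM (gtr0_norm t0) -theta_mul_n.
have -> : th * n%:R - th / 2 = th * (n%:R - 2^-1) by ring.
rewrite !ler_pM2l//.
have [ik|ki] := leqP i k.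
  have : (i%:R : R) <= k%:R by rewrite ler_nat.
  have : (k%:R : R) + 1 <= n%:R by rewrite natr1 ler_nat.
  have : 0 <= (i%:R : R) by [].
  by move=> h1 h2 h3; rewrite ltr0_norm; [apply/andP; split|]; lra.
have : (k%:R : R) + 1 <= i%:R by rewrite natr1 ler_nat.
have : (i%:R : R) + 1 <= n%:R by rewrite natr1 ler_nat.
have : 0 <= (k%:R : R) by [].
by move=> h1 h2 h3; rewrite gtr0_norm; [apply/andP; split|]; lra.
Qed.

Lemma vertE_n : vertE n = vertE 0.
Proof.
have E : 2 * pi = 0 + pi *+ 2 :> R by rewrite add0r mulr2n; ring.
by rewrite /vertE theta_mul_n mulr0 /rv E cosD2pi sinD2pi.
Qed.

Lemma OmegaE_set : [set E_pt n i | i in [set i | (1 <= i <= n)%N]] = [set vertE i | i in [set i | (i < n)%N]] :> set (R * R).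
Proof.
apply/seteqP; split => x /= [i hi <-].
  by case: i hi => // i /= hi; exists i => //; rewrite E_ptE.
by exists i.+1 => //; rewrite E_ptE.
Qed.

Lemma OmegaE_vertE i : (i < n)%N -> OmegaE n (vertE i).
Proof. by move=> ni; rewrite /OmegaE OmegaE_set; apply: hull_sub; exists i. Qed.

Lemma OmegaE_vertE_le i : (i <= n)%N -> OmegaE n (vertE i).
Proof.
rewrite leq_eqVlt => /orP[/eqP->|]; last exact: OmegaE_vertE.
by rewrite vertE_n; apply: OmegaE_vertE; case: n n3.
Qed.

Lemma OmegaE_sub_halfplanes : OmegaE n `<=` halfplane_polygon.
Proof.
rewrite /OmegaE OmegaE_set; apply: hull_min.
  have -> : halfplane_polygon = \bigcap_(i in [set i | (i < n)%N]) [set x | dotp x (rv (th * (i%:R + 2^-1))) <= apothem].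
    by apply/seteqP; split => x.
  apply/convex_setP => x y t hx hy t01 i ni.
  by have /convex_setP := @convex_halfplane R (rv (th * (i%:R + 2^-1))) apothem; apply => //; [exact: hx|exact: hy].
by move=> _ [i ni <-] k nk; exact: vertE_dot.
Qed.

Lemma mean_in (C : set (R * R)) k : convex_set C -> (forall i, (i < n)%N -> C (vertE i)) ->
  (k < n)%N -> C ((k.+1%:R)^-1 *: \sum_(i < k.+1) vertE i).
Proof.
move=> /convex_setP cC hC; elim: k => [|k IH] kn.
  by rewrite big_ord_recr big_ord0 /= add0r invr1 scale1r; exact: hC.
have kn' : (k < n)%N by exact: ltnW.
rewrite big_ord_recr /=.
have -> : k.+2%:R^-1 *: (\sum_(i < k.+1) vertE i + vertE k.+1) =
  k.+1%:R^-1 *: (\sum_(i < k.+1) vertE i) + k.+2%:R^-1 *: (vertE k.+1 - k.+1%:R^-1 *: (\sum_(i < k.+1) vertE i)).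
  set S := \sum_(_ < _) _.
  have k1 : (k.+1%:R : R) != 0 by rewrite pnatr_eq0.
  have k2 : (k.+2%:R : R) != 0 by rewrite pnatr_eq0.
  have k3 : (k.+2%:R : R) = k.+1%:R + 1 by rewrite natr1.
  have k4 : (k.+1%:R : R) + 1 != 0 by rewrite -k3.
  rewrite k3; move: (k.+1%:R : R) k1 k4 => a k1 k4.
  by apply: pair_ext; rewrite !pairE; field; rewrite k1 k4.
apply: cC; [exact: IH|exact: hC|].
by rewrite invr_ge0 ler0n/= invf_le1// ler1n.
Qed.

(** The sum is fixed by the rotation of angle [th], so it vanishes. *)
Lemma sum_vertE : \sum_(i < n) vertE i = 0.
Proof.
set S := \sum_(_ < _) _.
have rotsum : rot th S = S.
  have -> : rot th S = \sum_(i < n) vertE i.+1.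
    rewrite /S (big_morph (rot th) (rotDl th) (id1 := 0)); last first.
      by apply: pair_ext; rewrite /rot /=; ring.
    by apply: eq_bigr => i _; rewrite /vertE rot_rv -natr1 mulrDr mulr1 addrC.
  rewrite /S; case: n n3 vertE_n => // m _ hm.
  by rewrite big_ord_recr [RHS]big_ord_recl /= addrC hm.
have c1 : cos th < 1.
  by rewrite -[ltRHS](@cos0 R); apply: cos_lt => //; [exact: theta_gt0|exact/ltW/theta_lt_pi].
have := congr1 fst rotsum; have := congr1 snd rotsum; rewrite !(rotE1, rotE2) => h2 h1.
have D0 : 2 * (1 - cos th) != 0 by rewrite gt_eqF// mulr_gt0// subr_gt0.
have cs := c2s2 th.
apply: pair_ext; apply: (mulfI D0); rewrite mulr0.
  have -> : 2 * (1 - cos th) * S.1 = (cos th - 1) * (cos th * S.1 - sin th * S.2 - S.1) + sin th * (sin th * S.1 + cos th * S.2 - S.2)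
     + (1 - (cos th * cos th + sin th * sin th)) * S.1 by ring.
  by rewrite h1 h2 cs !subrr; ring.
have -> : 2 * (1 - cos th) * S.2 = (cos th - 1) * (sin th * S.1 + cos th * S.2 - S.2) - sin th * (cos th * S.1 - sin th * S.2 - S.1)
     + (1 - (cos th * cos th + sin th * sin th)) * S.2 by ring.
by rewrite h1 h2 cs !subrr; ring.
Qed.

Lemma OmegaE0 : OmegaE n (0 : R * R).
Proof.
have nn : (n.-1 < n)%N by case: n n3.
have := @mean_in (OmegaE n) n.-1 (@convex_hull_convex _ _) OmegaE_vertE nn.
by rewrite prednK; [rewrite sum_vertE scaler0|case: n n3].
Qed.

Lemma rv_decomp (s d t : R) : sin d *: rv (s + t) = sin (d - t) *: rv s + sin t *: rv (s + d).
Proof. by apply: pair_ext; rewrite !pairE /rv /= !(cosD, sinD, cosN, sinN); ring. Qed.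

Lemma sector x : exists i rho t, [/\ (i < n)%N, 0 <= rho, 0 <= t < th & x = rho *: rv (th * i%:R + t)].
Proof.
have [rho [t [r0 /andP[t0 t2] xE]]] := polar x.
have thp := theta_gt0.
have u0 : 0 <= t / th by rewrite divr_ge0// ltW.
have /andP[h1 h2] := Num.Theory.truncn_itv u0.
exists (Num.truncn (t / th)), rho, (t - th * (Num.truncn (t / th))%:R).
have h1' : th * (Num.truncn (t / th))%:R <= t by rewrite mulrC -ler_pdivlMr.
have h2' : t < th * (Num.truncn (t / th)).+1%:R by rewrite mulrC -ltr_pdivrMr.
split => //.
- by rewrite -(ltr_nat R) -(ltr_pM2l thp) theta_mul_n; apply: le_lt_trans t2.
- by apply/andP; split; [lra|move: h2'; rewrite -natr1 mulrDr mulr1; lra].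
- by rewrite addrC subrK.
Qed.

(** In the sector between two consecutive vertices, the inequality of their edge
    says that the two coordinates with respect to them sum to at most 1; the
    remaining weight goes to the centre. *)
Lemma halfplanes_sub_OmegaE : halfplane_polygon `<=` OmegaE n.
Proof.
move=> x hx; have [i [rho [t [ni r0 /andP[t0 t1] xE]]]] := sector x.
have := hx i ni; have s0 := sinth_gt0; have sN : sin th != 0 by rewrite gt_eqF.
have tp := theta_lt_pi; have thp := theta_gt0; have q0 := apothem_gt0.
pose a := rho * sin (th - t) / sin th; pose b := rho * sin t / sin th.
have a0 : 0 <= a by rewrite divr_ge0 ?(ltW s0)// mulr_ge0// sin_ge0_pi//; apply/andP; split; lra.
have b0 : 0 <= b by rewrite divr_ge0 ?(ltW s0)// mulr_ge0// sin_ge0_pi//; apply/andP; split; lra.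
have E : x = a *: vertE i + b *: vertE i.+1.
  have h := rv_decomp (th * i%:R) th t.
  have -> : vertE i.+1 = rv (th * i%:R + th) by rewrite /vertE -natr1 mulrDr mulr1.
  have -> : a *: vertE i + b *: rv (th * i%:R + th) = (rho / sin th) *: (sin (th - t) *: rv (th * i%:R) + sin t *: rv (th * i%:R + th)).
    by rewrite /a /b /vertE; apply: pair_ext; rewrite !pairE; ring.
  by rewrite -h scalerA divfK// -xE.
rewrite {1}E dotpDl !dotpZl /vertE !dot_rv.
have -> : th * i%:R - th * (i%:R + 2^-1) = - (th / 2) by ring.
have -> : th * i.+1%:R - th * (i%:R + 2^-1) = th / 2 by rewrite -natr1; field.
rewrite cosN -/apothem -mulrDl ger_pMl// => ab.
rewrite E -[_ + _]addr0 -(scaler0 _ (1 - a - b)).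
apply: convex3 => //.
- exact: convex_hull_convex.
- exact: OmegaE_vertE.
- exact: OmegaE_vertE_le.
- exact: OmegaE0.
- lra.
- ring.
Qed.

Lemma OmegaE_halfplanes : OmegaE n = halfplane_polygon.
Proof. by apply/seteqP; split; [exact: OmegaE_sub_halfplanes|exact: halfplanes_sub_OmegaE]. Qed.

Lemma closed_halfplane z (q : R) : closed [set x | dotp x z <= q].
Proof.
have cf : continuous (fun x => dotp x z).
  exact: (contD (contM continuous_fst2 (@contC _ _)) (contM continuous_snd2 (@contC _ _))).
by apply: (@closed_comp _ _ (fun x => dotp x z) [set y | y <= q]) => //; exact: closed_le.
Qed.

Lemma closed_OmegaE : closed (OmegaE n : set (R * R)).
Proof.
rewrite OmegaE_halfplanes.
have -> : halfplane_polygon = \bigcap_(i in [set i | (i < n)%N]) [set x | dotp x (rv (th * (i%:R + 2^-1))) <= apothem].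
  by apply/seteqP; split => x.
by apply: closed_bigI => i _; exact: closed_halfplane.
Qed.

Lemma OmegaE_le1 x : OmegaE n x -> enorm x <= 1.
Proof.
have : OmegaE n `<=` [set x : R * R | enorm x <= 1].
  rewrite /OmegaE OmegaE_set; apply: hull_min; last by move=> _ [i _ <-] /=; rewrite /vertE enorm_rv.
  apply/convex_setP => y z t /= hy hz /andP[t0 t1].
  have -> : y + t *: (z - y) = (1 - t) *: y + t *: z by apply: pair_ext; rewrite !pairE; ring.
  apply: le_trans (enormD _ _) _; rewrite !enormZ !ger0_norm ?subr_ge0//.
  rewrite [leRHS](_ : 1 = (1 - t) * 1 + t * 1 :> R); last by ring.
  by apply: lerD; apply: ler_wpM2l => //; rewrite subr_ge0.
exact.
Qed.

Lemma ball_in_OmegaE x : enorm x <= apothem -> OmegaE n x.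
Proof.
move=> h; rewrite OmegaE_halfplanes => i _; apply: le_trans (dot_le _ _) _.
by rewrite enorm_rv mulr1.
Qed.

(** Strict edge inequalities, an explicit form of the interior. *)
Definition open_polygon : set (R * R) :=
  [set x | forall i, (i < n)%N -> dotp x (rv (th * (i%:R + 2^-1))) < apothem].

Lemma open_polygon_nbhs (x : R * R) : open_polygon x -> nbhs x open_polygon.
Proof.
move=> hx.
have ev (i : 'I_n) : \forall y \near x, dotp y (rv (th * ((i : nat)%:R + 2^-1))) < apothem.
  have cf : continuous (fun x => apothem - dotp x (rv (th * ((i : nat)%:R + 2^-1)))).
    apply: contD; first exact: contC.
    exact: (contN (contD (contM continuous_fst2 (@contC _ _)) (contM continuous_snd2 (@contC _ _)))).
  apply: (@filterS _ _ _ [set x | 0 < apothem - dotp x (rv (th * ((i : nat)%:R + 2^-1)))]).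
    by move=> y /=; rewrite subr_gt0.
  apply: open_nbhs_nbhs; split; first exact: open_gt0.
  by rewrite /= subr_gt0; exact: hx.
have : \forall y \near x, forall i : 'I_n, dotp y (rv (th * ((i : nat)%:R + 2^-1))) < apothem.
  exact: (@filter_forall _ _ (fun (i : 'I_n) y => dotp y (rv (th * ((i : nat)%:R + 2^-1))) < apothem) (nbhs x) _ ev).
by apply: filterS => y hy i ni; exact: (hy (Ordinal ni)).
Qed.

Lemma open_polygon_sub : open_polygon `<=` OmegaE n.
Proof. by move=> x hx; rewrite OmegaE_halfplanes => i ni; exact/ltW/hx. Qed.

Lemma scale_vertE_int (t : R) i : (i < n)%N -> 0 <= t < 1 -> open_polygon (t *: vertE i).
Proof.
move=> ni /andP[t0 t1] k nk; rewrite dotpZl.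
have := vertE_dot ni nk => h; have q0 := apothem_gt0.
apply: (@le_lt_trans _ _ (t * apothem)); first exact: ler_wpM2l.
by rewrite gtr_pMl.
Qed.

End Polygon.

(** * One ring and its triangulation *)

Section RingGeometry.
Context {R : realType}.
Variables (alpha : R) (n : nat).
Hypotheses (alpha01 : 0 < alpha < 1) (n3 : (3 <= n)%N).
Implicit Types (x y z : R * R) (t : R).

Let th : R := theta n.
Let q : R := apothem n.
Let r : R := r_I alpha n.

Lemma alpha_gt0 : 0 < alpha. Proof. by case/andP: alpha01. Qed.
Lemma alpha_lt1 : alpha < 1. Proof. by case/andP: alpha01. Qed.

Definition cn : R := cos (th / 2 * (1 - 2 * alpha)).
Definition sin_mean : R := Num.sqrt (sin (th * alpha) * sin (th * (1 - alpha))).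

Lemma r_IE : r = (cn - sin_mean) / q.
Proof. by rewrite /r /r_I (pi_div_n n3). Qed.

Lemma apothem_lt_cn : q < cn.
Proof.
have a0 := alpha_gt0; have a1 := alpha_lt1; have t0 := @theta_gt0 R n n3; have tp := @theta_lt_pi R n n3.
rewrite -/th in t0 tp; rewrite /q /apothem /cn -/th.
have -> : cos (th / 2 * (1 - 2 * alpha)) = cos (th / 2 * `|1 - 2 * alpha|).
  by case: (ger0P (1 - 2 * alpha)) => // _; rewrite mulrN cosN.
have h : `|1 - 2 * alpha| < 1 by rewrite ltr_norml; apply/andP; split; lra.
apply: cos_lt; last lra.
- by rewrite mulr_ge0// divr_ge0// ltW.
- by rewrite gtr_pMr// divr_gt0.
Qed.

Lemma sin_al : 0 < sin (th * alpha).
Proof.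
apply: sin_gt0_th; have a0 := alpha_gt0; have a1 := alpha_lt1; have t0 := @theta_gt0 R n n3; have tp := @theta_lt_pi R n n3.
rewrite mulr_gt0//=; apply: lt_trans tp; by rewrite gtr_pMr.
Qed.

Lemma sin_al' : 0 < sin (th * (1 - alpha)).
Proof.
apply: sin_gt0_th; have a0 := alpha_gt0; have a1 := alpha_lt1; have t0 := @theta_gt0 R n n3; have tp := @theta_lt_pi R n n3.
rewrite mulr_gt0 ?subr_gt0//=; apply: lt_trans tp; rewrite gtr_pMr//; lra.
Qed.

Lemma sin_mean_product : sin (th * alpha) * sin (th * (1 - alpha)) = cn ^+ 2 - q ^+ 2.
Proof.
have -> : th * alpha = th / 2 - th / 2 * (1 - 2 * alpha) by field.
have -> : th * (1 - alpha) = th / 2 + th / 2 * (1 - 2 * alpha) by field.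
rewrite sinB sinD /cn /q /apothem -/th.
have := cos2Dsin2 (th / 2); have := cos2Dsin2 (th / 2 * (1 - 2 * alpha)).
set a := cos (th / 2); set b := sin (th / 2); set c := cos (_ * _); set d := sin (_ * _) => h1 h2.
have -> : (b * c - a * d) * (b * c + a * d) = b ^+ 2 * c ^+ 2 - a ^+ 2 * d ^+ 2 by ring.
have -> : b ^+ 2 = 1 - a ^+ 2 by rewrite -h2; ring.
have -> : d ^+ 2 = 1 - c ^+ 2 by rewrite -h1; ring.
ring.
Qed.

Lemma sin_mean_sqr : sin_mean ^+ 2 = cn ^+ 2 - q ^+ 2.
Proof. by rewrite /sin_mean sqr_sqrtr ?sin_mean_product// -sin_mean_product mulr_ge0 ?ltW ?sin_al ?sin_al'. Qed.

Lemma sin_mean_ge0 : 0 <= sin_mean. Proof. exact: sqrtr_ge0. Qed.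

(** The product of the two sines under the square root is [cn ^+ 2 - q ^+ 2], so
    the formula for the inner radius is a root of this quadratic equation. *)
Lemma r_quad : r ^+ 2 * q - 2 * cn * r + q = 0.
Proof.
have q0 : q != 0 by rewrite gt_eqF// apothem_gt0.
rewrite r_IE; have := sin_mean_sqr; move: sin_mean cn => w c h.
have -> : ((c - w) / q) ^+ 2 * q - 2 * c * ((c - w) / q) + q = (w ^+ 2 - (c ^+ 2 - q ^+ 2)) / q by field.
by rewrite h subrr mul0r.
Qed.

Lemma r_gt0 : 0 < r.
Proof.
have q0 := @apothem_gt0 R n n3; have cq := apothem_lt_cn; rewrite -/q in q0 cq.
rewrite r_IE divr_gt0// subr_gt0 -(ltr_pXn2r (_ : 0 < 2)%N) ?nnegrE ?sin_mean_ge0//; last by lra.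
by rewrite sin_mean_sqr gtrBl exprn_gt0.
Qed.

Lemma r_lt1 : r < 1.
Proof.
have q0 := @apothem_gt0 R n n3; have cq := apothem_lt_cn; rewrite -/q in q0 cq.
rewrite r_IE ltr_pdivrMr// mul1r ltrBlDr -ltrBlDl -(ltr_pXn2r (_ : 0 < 2)%N) ?nnegrE ?sin_mean_ge0//; last by lra.
by rewrite sin_mean_sqr -subr_gt0 (_ : _ - _ = 2 * (q * (cn - q))); [rewrite !mulr_gt0// subr_gt0|ring].
Qed.

Lemma r_cn_lt_apothem : r * cn < q.
Proof.
have := r_quad; have r0 := r_gt0; have r1 := r_lt1; have q0 := @apothem_gt0 R n n3; rewrite -/q in q0.
have : r ^+ 2 * q < q.
  by rewrite gtr_pMl// expr_lt1// ltW.
lra.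
Qed.

Lemma r_apothem_lt_cn : r * q < cn.
Proof.
apply: le_lt_trans apothem_lt_cn; have q0 := @apothem_gt0 R n n3; rewrite -/q in q0.
by rewrite ger_pMl// ltW// r_lt1.
Qed.

Definition vertI (i : nat) : R * R := r *: rv (th * i%:R + th * alpha).

Lemma vertI_rot i : vertI i = r *: rot (th * alpha) (vertE n i).
Proof. by rewrite /vertI /vertE rot_rv addrC. Qed.

Lemma I_ptE i : I_pt alpha n i = r *: rv (th * (i%:R - 1 + alpha)).
Proof.
rewrite /I_pt /Qn mxact_rotation (_ : e1 = rv 0); last by rewrite /e1 /rv cos0 sin0.
by rewrite rot_rv addr0.
Qed.

Lemma I_ptS i : I_pt alpha n i.+1 = vertI i.
Proof. by rewrite I_ptE /vertI -natr1 addrK mulrDr. Qed.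

(** The inner polygon is a similar copy of the outer one, so that facts about the
    outer polygon transfer to it. *)
Lemma OmegaI_E : OmegaI alpha n = [set x | OmegaE n (r^-1 *: rot (- (th * alpha)) x)].
Proof.
rewrite -[RHS]/([set x | convex_hull _ (r^-1 *: rot (- (th * alpha)) x)]).
rewrite -hull_similar ?gt_eqF ?r_gt0// /OmegaI; congr convex_hull.
apply/seteqP; split => x /=.
  move=> [[//|i] hi <-]; exists (E_pt n i.+1); first by exists i.+1.
  by rewrite E_ptE I_ptS vertI_rot.
move=> [_ [[//|i] hi <-] <-]; exists i.+1 => //.
by rewrite E_ptE I_ptS vertI_rot.
Qed.

Lemma vertI_dot i k : (i < n)%N -> (k < n)%N -> dotp (vertI i) (rv (th * (k%:R + 2^-1))) < q.
Proof.
move=> ni nk; have r0 := r_gt0; have r1 := r_lt1; have q0 := @apothem_gt0 R n n3; rewrite -/q in q0.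
have a0 := alpha_gt0; have a1 := alpha_lt1.
rewrite /vertI dotpZl dot_rv.
have -> : th * i%:R + th * alpha - th * (k%:R + 2^-1) = th * (i%:R - k%:R + alpha - 2^-1) by ring.
have [->|ik] := eqVneq i k.
  have -> : th * (k%:R - k%:R + alpha - 2^-1) = - (th / 2 * (1 - 2 * alpha)) by field.
  by rewrite cosN; exact: r_cn_lt_apothem.
apply: (@le_lt_trans _ _ (r * q)); last by rewrite gtr_pMl.
apply: ler_wpM2l; first exact: ltW.
apply: cos_half => //; rewrite -/th; have t0 := @theta_gt0 R n n3.
rewrite normrM (gtr0_norm t0) -(@theta_mul_n R n n3) -/th.
have -> : th * n%:R - th / 2 = th * (n%:R - 2^-1) by ring.
rewrite !ler_pM2l//; move: ik; rewrite neq_ltn => /orP[ik|ki].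
  have : (i%:R : R) + 1 <= k%:R by rewrite natr1 ler_nat.
  have : (k%:R : R) + 1 <= n%:R by rewrite natr1 ler_nat.
  have : 0 <= (i%:R : R) by [].
  by move=> h1 h2 h3; rewrite ltr0_norm; [apply/andP; split|]; lra.
have : (k%:R : R) + 1 <= i%:R by rewrite natr1 ler_nat.
have : (i%:R : R) + 1 <= n%:R by rewrite natr1 ler_nat.
have : 0 <= (k%:R : R) by [].
by move=> h1 h2 h3; rewrite gtr0_norm; [apply/andP; split|]; lra.
Qed.

Lemma open_polygon_convex : convex_set (open_polygon n : set (R * R)).
Proof.
apply/convex_setP => x y t hx hy /andP[t0 t1] k nk.
have -> : x + t *: (y - x) = (1 - t) *: x + t *: y by apply: pair_ext; rewrite !pairE; ring.
rewrite dotpDl !dotpZl.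
have := hx k nk; have := hy k nk; set a := dotp x _; set b := dotp y _ => hb ha.
have [->|t0'] := eqVneq t 0; first by rewrite subr0 mul1r mul0r addr0.
have t00 : 0 < t by rewrite lt_neqAle eq_sym t0'.
have : t * (apothem n - b) > 0 by rewrite mulr_gt0// subr_gt0.
have : (1 - t) * (apothem n - a) >= 0 by rewrite mulr_ge0 ?subr_ge0// ltW.
lra.
Qed.

(** The edge of the outer polygon that is nearest to an inner vertex is at
    distance [q - r * cn > 0] from it. *)
Lemma OmegaI_int : OmegaI alpha n `<=` open_polygon n.
Proof.
apply: hull_min; first exact: open_polygon_convex.
by move=> _ [[//|i] hi <-] k nk; rewrite I_ptS; exact: vertI_dot.
Qed.

Lemma OmegaI_sub : OmegaI alpha n `<=` OmegaE n.
Proof. by move=> x /OmegaI_int; exact: open_polygon_sub. Qed.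

Lemma OmegaI0 : OmegaI alpha n 0.
Proof.
rewrite OmegaI_E /=; rewrite (_ : rot _ 0 = 0); last by apply: pair_ext; rewrite /rot /=; ring.
by rewrite scaler0; exact: OmegaE0.
Qed.

Lemma OmegaI_vertI i : (i <= n)%N -> OmegaI alpha n (vertI i).
Proof.
move=> ni; rewrite OmegaI_E /= vertI_rot rotZ rotK scalerA mulVf ?scale1r ?gt_eqF ?r_gt0//.
exact: OmegaE_vertE_le.
Qed.

Lemma continuous_sim (k s : R) : continuous (fun x => k *: rot s x).
Proof.
have c1 : continuous (fun x : R * R => k * (cos s * x.1 - sin s * x.2)).
  exact: (contM (@contC _ _) (contD (contM (@contC _ _) continuous_fst2) (contN (contM (@contC _ _) continuous_snd2)))).
have c2 : continuous (fun x : R * R => k * (sin s * x.1 + cos s * x.2)).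
  exact: (contM (@contC _ _) (contD (contM (@contC _ _) continuous_fst2) (contM (@contC _ _) continuous_snd2))).
by move=> x; exact: (cvg_pair (c1 x) (c2 x)).
Qed.

Lemma closed_OmegaI : closed (OmegaI alpha n : set (R * R)).
Proof.
rewrite OmegaI_E.
apply: (@closed_comp _ _ (fun x => r^-1 *: rot (- (th * alpha)) x) (OmegaE n)); last exact: closed_OmegaE.
by move=> x _; exact: continuous_sim.
Qed.

(** With the angle of an outer vertex as parameter, [triO] is the closure of T_j
    for odd [j] and [triE] for even [j]. *)
Definition triO t x : Prop := ctri (rv t) (r *: rv (t + th * alpha)) (r *: rv (t + th * alpha - th)) x.
Definition triE t x : Prop := ctri (rv t) (rv (t + th)) (r *: rv (t + th * alpha)) x.

Lemma det2Zl (k : R) x y : det2 (k *: x) y = k * det2 x y.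
Proof. by rewrite /det2 !pairE; ring. Qed.
Lemma det2Zr (k : R) x y : det2 x (k *: y) = k * det2 x y.
Proof. by rewrite /det2 !pairE; ring. Qed.
Lemma det2Dl x y z : det2 (x + y) z = det2 x z + det2 y z.
Proof. by rewrite /det2 !pairE; ring. Qed.
Lemma det2N x y : det2 x y = - det2 y x.
Proof. by rewrite /det2; ring. Qed.

(* the determinants of the pairs (E, I), (I, next E), (I, next I), (E, next E) *)
Let A := r * sin (th * alpha).
Let B := r * sin (th * (1 - alpha)).
Let C := r ^+ 2 * sin th.
Let S := sin th.

Lemma sum_sin : sin (th * alpha) + sin (th * (1 - alpha)) = 2 * sin (th / 2) * cn.
Proof.
have -> : th * alpha = th / 2 - th / 2 * (1 - 2 * alpha) by field.
have -> : th * (1 - alpha) = th / 2 + th / 2 * (1 - 2 * alpha) by field.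
by rewrite sinB sinD /cn; ring.
Qed.

Lemma sin_double : sin th = 2 * sin (th / 2) * q.
Proof.
have {1}-> : th = th / 2 + th / 2 by field.
by rewrite sinD /q /apothem -/th; ring.
Qed.

Lemma sin_half_gt0 : 0 < sin (th / 2).
Proof. apply: sin_gt0_th; have := @theta_gt0 R n n3; have := @theta_lt_pi R n n3; rewrite -/th => h1 h2; apply/andP; split; lra. Qed.

Lemma SAB_gt0 : 0 < S - A - B.
Proof.
have -> : S - A - B = 2 * sin (th / 2) * (q - r * cn).
  have -> : S - A - B = sin th - r * (sin (th * alpha) + sin (th * (1 - alpha))) by rewrite /S /A /B; ring.
  by rewrite sum_sin sin_double; ring.
by rewrite mulr_gt0 ?subr_gt0 ?r_cn_lt_apothem// mulr_gt0// sin_half_gt0.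
Qed.

Lemma ABC_gt0 : 0 < A + B - C.
Proof.
have -> : A + B - C = 2 * sin (th / 2) * r * (cn - r * q).
  have -> : A + B - C = r * (sin (th * alpha) + sin (th * (1 - alpha))) - r ^+ 2 * sin th by rewrite /C /A /B; ring.
  by rewrite sum_sin sin_double; ring.
have h := sin_half_gt0; have h' := r_apothem_lt_cn; have r0 := r_gt0; apply: mulr_gt0; last by rewrite subr_gt0.
by apply: mulr_gt0 => //; apply: mulr_gt0.
Qed.

Lemma A_gt0 : 0 < A. Proof. by rewrite mulr_gt0 ?r_gt0 ?sin_al. Qed.
Lemma B_gt0 : 0 < B. Proof. by rewrite mulr_gt0 ?r_gt0 ?sin_al'. Qed.
Lemma C_gt0 : 0 < C. Proof. by rewrite mulr_gt0 ?exprn_gt0 ?r_gt0 ?sinth_gt0. Qed.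

(** Twice the area of the triangle, positive because [r * cn < q] ([SAB_gt0]). *)
Lemma or3_triE t : or3 (rv t) (rv (t + th)) (r *: rv (t + th * alpha)) = S - A - B.
Proof.
rewrite or3E !det2Zr det2Zl !det_rv.
have -> : t + th - t = th by ring.
have -> : t + th * alpha - (t + th) = - (th * (1 - alpha)) by ring.
have -> : t - (t + th * alpha) = - (th * alpha) by ring.
by rewrite !sinN /S /A /B; ring.
Qed.

(** Twice the area of the triangle, positive because [r * q < cn] ([ABC_gt0]). *)
Lemma or3_triO t : or3 (rv t) (r *: rv (t + th * alpha)) (r *: rv (t + th * alpha - th)) = A + B - C.
Proof.
rewrite or3E !(det2Zr, det2Zl) !det_rv.
have -> : t + th * alpha - t = th * alpha by ring.
have -> : t + th * alpha - th - (t + th * alpha) = - th by ring.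
have -> : t - (t + th * alpha - th) = th * (1 - alpha) by ring.
by rewrite !sinN /C /A /B; ring.
Qed.

Lemma inner_sector (D : set (R * R)) (p w : R) a b : convex_set D -> D 0 -> D a -> D b ->
  0 <= p -> 0 <= w -> p + w <= 1 -> D (p *: a + w *: b).
Proof.
move=> cD D0 Da Db p0 w0 pw; rewrite -[_ + _]addr0 -(scaler0 _ (1 - p - w)).
by apply: convex3 => //; [lra|ring].
Qed.

(** The signed area over an outer edge is proportional to the slack in the
    inequality of that edge. *)
Lemma or3_edge t x : or3 (rv t) (rv (t + th)) x = 2 * sin (th / 2) * (q - dotp x (rv (t + th / 2))).
Proof.
have -> : or3 (rv t) (rv (t + th)) x = det2 (rv t) (rv (t + th)) + det2 (rv (t + th) - rv t) x.
  by rewrite /or3 /det2 !pairE; ring.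
have -> : det2 (rv t) (rv (t + th)) = 2 * sin (th / 2) * q.
  by rewrite det_rv (_ : t + th - t = th) ?sin_double//; ring.
have -> : rv (t + th) - rv t = 2 * sin (th / 2) *: (- sin (t + th / 2), cos (t + th / 2)).
  have -> : rv t = rv (t + th / 2 + - (th / 2)) by congr rv; ring.
  have -> : t + th = t + th / 2 + th / 2 by field.
  by apply: pair_ext; rewrite !pairE /rv /= !(cosD, sinD, cosN, sinN); ring.
by rewrite /det2 /dotp !pairE /rv /=; ring.
Qed.

Lemma angle_facts : [/\ 0 < th * alpha, th * alpha < th, th < pi & 0 < th].
Proof.
have a0 := alpha_gt0; have a1 := alpha_lt1; have tp := @theta_lt_pi R n n3; have thp := @theta_gt0 R n n3; rewrite -/th in tp thp.
by split => //; [exact: mulr_gt0|rewrite gtr_pMr].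
Qed.

Lemma in_combination (D : set (R * R)) (p w c : R) a b x : convex_set D -> D 0 -> D a -> D b -> 0 < c ->
  0 <= p -> 0 <= w -> p + w <= c -> c *: x = p *: a + w *: b -> D x.
Proof.
move=> cD D0 Da Db c0 p0 w0 pw e.
have -> : x = (p / c) *: a + (w / c) *: b.
  have cN : c != 0 by rewrite gt_eqF.
  by rewrite -[LHS](scalerK cN) e scalerDr !scalerA ![c^-1 * _]mulrC.
apply: inner_sector => //; first by rewrite divr_ge0// ltW.
  by rewrite divr_ge0// ltW.
by rewrite -mulrDl ler_pdivrMr// mul1r.
Qed.

Lemma det_combination a b x : det2 a b *: x = det2 x b *: a + det2 a x *: b.
Proof. by apply: pair_ext; rewrite !pairE /det2; ring. Qed.

(** In the sector between the outer vertex [E] and the inner vertex [I] the point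
    is [p *: E + w *: I] with nonnegative [p] and [w].  If [1 <= p + w] it lies
    beyond the line [E I], in the triangle with two outer vertices.  Otherwise the
    side of the line [J I], with [J] the previous inner vertex, decides between the
    inner polygon and the triangle [E I J]. *)
Lemma cover_first t rho u : 0 <= rho -> 0 <= u <= th * alpha ->
  dotp (rho *: rv (t + u)) (rv (t + th / 2)) <= q ->
  OmegaI alpha n (r *: rv (t + th * alpha)) -> OmegaI alpha n (r *: rv (t + th * alpha - th)) ->
  [\/ OmegaI alpha n (rho *: rv (t + u)), triO t (rho *: rv (t + u)) | triE t (rho *: rv (t + u))].
Proof.
move=> rho0 /andP[u0 u1] hq OI OJ; set x := rho *: rv (t + u); rewrite -/x in hq.
have [ta tath tp thp] := angle_facts.
have r0 := r_gt0; have s0 := sin_al; have sN : sin (th * alpha) != 0 by rewrite gt_eqF.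
have A0 := A_gt0; have B0 := B_gt0; have C0 := C_gt0; have SAB := SAB_gt0; have ABC := ABC_gt0.
pose E := rv t : R * R; pose I := r *: rv (t + th * alpha) : R * R.
pose F := rv (t + th) : R * R; pose J := r *: rv (t + th * alpha - th) : R * R.
(* the coordinates of the point along [E] and [I], from the addition formula *)
pose p := rho * sin (th * alpha - u) / sin (th * alpha).
pose w := rho * sin u / sin (th * alpha) / r.
have p0 : 0 <= p by rewrite divr_ge0 ?(ltW s0)// mulr_ge0// sin_ge0_pi//; apply/andP; split; lra.
have w0 : 0 <= w by rewrite divr_ge0 ?(ltW r0)// divr_ge0 ?(ltW s0)// mulr_ge0// sin_ge0_pi//; apply/andP; split; lra.
have xE : x = p *: E + w *: I.
  have h := rv_decomp t (th * alpha) u.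
  have -> : p *: E + w *: I = (rho / sin (th * alpha)) *: (sin (th * alpha - u) *: rv t + sin u *: rv (t + th * alpha)).
    rewrite /p /w /E /I; apply: pair_ext; rewrite !pairE; field; rewrite ?sN ?gt_eqF//.
  by rewrite -h scalerA divfK.
have dEI : det2 E I = A.
  by rewrite /E /I det2Zr det_rv (_ : t + th * alpha - t = th * alpha)//; ring.
have dIF : det2 I F = B.
  by rewrite /F /I det2Zl det_rv (_ : t + th - (t + th * alpha) = th * (1 - alpha))//; ring.
have dEF : det2 E F = S.
  by rewrite /E /F det_rv (_ : t + th - t = th)//; ring.
have dJE : det2 J E = B.
  by rewrite /J /E det2Zl det_rv (_ : t - (t + th * alpha - th) = th * (1 - alpha))//; ring.
have dJI : det2 J I = C.
  rewrite /J /I det2Zl det2Zr det_rv (_ : t + th * alpha - (t + th * alpha - th) = th); last by ring.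
  by rewrite mulrA -expr2.
have dEE : det2 E E = 0 by rewrite /det2; ring.
have dII : det2 I I = 0 by rewrite /det2; ring.
have dIE : det2 I E = - A by rewrite det2N dEI.
have dFI : det2 F I = - B by rewrite det2N dIF.
have dEJ : det2 E J = - B by rewrite det2N dJE.
have dIJ : det2 I J = - C by rewrite det2N dJI.
have or_x a b : or3 a b x = det2 a b - p * det2 E b - w * det2 I b + p * det2 E a + w * det2 I a.
  by rewrite or3E (det2N b x) xE !det2Dl !det2Zl; ring.
have xl b : det2 x b = p * det2 E b + w * det2 I b.
  by rewrite xE det2Dl (det2Zl p E) (det2Zl w I).
have hEFx : 0 <= or3 E F x.
  by rewrite or3_edge mulr_ge0 ?subr_ge0// mulr_ge0// ltW// sin_half_gt0.
have [pw|pw] := leP 1 (p + w).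
  apply: Or33; rewrite /triE -/E -/F -/I; split => //.
  - rewrite or3_rotl or_x dFI dEI dII dEF dIF.
    have -> : - B - p * A - w * 0 + p * S + w * B = p * (S - A - B) + (p + w - 1) * B by ring.
    by rewrite addr_ge0// mulr_ge0 ?(ltW SAB) ?(ltW B0)// subr_ge0.
  - rewrite -or3_rotl or_x dIE dEE dEI dII.
    have -> : - A - p * 0 - w * - A + p * A + w * 0 = (p + w - 1) * A by ring.
    by rewrite mulr_ge0 ?(ltW A0)// subr_ge0.
have [hJ|hJ] := leP 0 (or3 J I x).
  apply: Or31; apply: (@in_combination _ (det2 x I) (det2 J x) (det2 J I) J I x _ _ OJ OI) => //.
  - exact: convex_hull_convex.
  - exact: OmegaI0.
  - by rewrite dJI.
  - by rewrite xl dEI dII mulr0 addr0 mulr_ge0// ltW.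
  - rewrite det2N xl dEJ dIJ.
    have -> : - (p * - B + w * - C) = p * B + w * C by ring.
    by rewrite addr_ge0// mulr_ge0// ltW.
  - by move: hJ; rewrite or3E (det2N x I) (det2N J x) => h; lra.
  - exact: det_combination.
apply: Or32; rewrite /triO -/E -/I -/J; split.
- rewrite or3_rotl; apply: ltW; move: hJ; rewrite !or3E (det2N I J) (det2N J x) (det2N x I) => h; lra.
- rewrite -or3_rotl or_x dJE dEE dIE dEJ dIJ.
  have -> : B - p * 0 - w * - A + p * - B + w * - C = (1 - (p + w)) * B + w * (A + B - C) by ring.
  have h1 := ltW ABC; have h2 : 0 <= 1 - (p + w) by rewrite subr_ge0 ltW.
  by rewrite addr_ge0// mulr_ge0// ltW.
- rewrite or_x dEI dII dEE dIE.
  have -> : A - p * A - w * 0 + p * 0 + w * - A = (1 - (p + w)) * A by ring.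
  by rewrite mulr_ge0// ?subr_ge0 ltW.
Qed.

(** The mirror image of [cover_first], in the sector between the inner vertex [I]
    and the next outer vertex [F]; [K] is the next inner vertex. *)
Lemma cover_second t rho u : 0 <= rho -> th * alpha <= u <= th ->
  dotp (rho *: rv (t + u)) (rv (t + th / 2)) <= q ->
  OmegaI alpha n (r *: rv (t + th * alpha)) -> OmegaI alpha n (r *: rv (t + th + th * alpha)) ->
  [\/ OmegaI alpha n (rho *: rv (t + u)), triO (t + th) (rho *: rv (t + u)) | triE t (rho *: rv (t + u))].
Proof.
move=> rho0 /andP[u0 u1] hq OI OK; set x := rho *: rv (t + u); rewrite -/x in hq.
have [ta tath tp thp] := angle_facts.
have r0 := r_gt0; have s0 := sin_al'; have sN : sin (th * (1 - alpha)) != 0 by rewrite gt_eqF.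
have A0 := A_gt0; have B0 := B_gt0; have C0 := C_gt0; have SAB := SAB_gt0; have ABC := ABC_gt0.
pose E := rv t : R * R; pose I := r *: rv (t + th * alpha) : R * R.
pose F := rv (t + th) : R * R; pose K := r *: rv (t + th + th * alpha) : R * R.
pose p := rho * sin (th - u) / sin (th * (1 - alpha)) / r.
pose w := rho * sin (u - th * alpha) / sin (th * (1 - alpha)).
have p0 : 0 <= p by rewrite divr_ge0 ?(ltW r0)// divr_ge0 ?(ltW s0)// mulr_ge0// sin_ge0_pi//; apply/andP; split; lra.
have w0 : 0 <= w by rewrite divr_ge0 ?(ltW s0)// mulr_ge0// sin_ge0_pi//; apply/andP; split; lra.
have xE : x = p *: I + w *: F.
  have h := rv_decomp (t + th * alpha) (th * (1 - alpha)) (u - th * alpha).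
  rewrite (_ : th * (1 - alpha) - (u - th * alpha) = th - u) in h; last by ring.
  rewrite (_ : t + th * alpha + (u - th * alpha) = t + u) in h; last by ring.
  rewrite (_ : t + th * alpha + th * (1 - alpha) = t + th) in h; last by ring.
  have -> : p *: I + w *: F = (rho / sin (th * (1 - alpha))) *: (sin (th - u) *: rv (t + th * alpha) + sin (u - th * alpha) *: rv (t + th)).
    rewrite /p /w /F /I; apply: pair_ext; rewrite !pairE; field; rewrite ?sN ?gt_eqF//.
  by rewrite -h scalerA divfK.
have dEI : det2 E I = A.
  by rewrite /E /I det2Zr det_rv (_ : t + th * alpha - t = th * alpha)//; ring.
have dIF : det2 I F = B.
  by rewrite /F /I det2Zl det_rv (_ : t + th - (t + th * alpha) = th * (1 - alpha))//; ring.
have dEF : det2 E F = S.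
  by rewrite /E /F det_rv (_ : t + th - t = th)//; ring.
have dFK : det2 F K = A.
  by rewrite /K /F det2Zr det_rv (_ : t + th + th * alpha - (t + th) = th * alpha)//; ring.
have dIK : det2 I K = C.
  rewrite /K /I det2Zl det2Zr det_rv (_ : t + th + th * alpha - (t + th * alpha) = th); last by ring.
  by rewrite mulrA -expr2.
have dFF : det2 F F = 0 by rewrite /det2; ring.
have dII : det2 I I = 0 by rewrite /det2; ring.
have dIE : det2 I E = - A by rewrite det2N dEI.
have dFI : det2 F I = - B by rewrite det2N dIF.
have dFE : det2 F E = - S by rewrite det2N dEF.
have dKF : det2 K F = - A by rewrite det2N dFK.
have dKI : det2 K I = - C by rewrite det2N dIK.
have or_x a b : or3 a b x = det2 a b - p * det2 I b - w * det2 F b + p * det2 I a + w * det2 F a.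
  by rewrite or3E (det2N b x) xE !det2Dl !det2Zl; ring.
have xl b : det2 x b = p * det2 I b + w * det2 F b.
  by rewrite xE det2Dl (det2Zl p I) (det2Zl w F).
have hEFx : 0 <= or3 E F x.
  by rewrite or3_edge mulr_ge0 ?subr_ge0// mulr_ge0// ltW// sin_half_gt0.
have [pw|pw] := leP 1 (p + w).
  apply: Or33; rewrite /triE -/E -/F -/I; split => //.
  - rewrite or3_rotl or_x dFI dII dIF dFF.
    have -> : - B - p * 0 - w * - B + p * B + w * 0 = (p + w - 1) * B by ring.
    by rewrite mulr_ge0 ?(ltW B0)// subr_ge0.
  - rewrite -or3_rotl or_x dIE dFE dII dFI.
    have -> : - A - p * - A - w * - S + p * 0 + w * - B = w * (S - A - B) + (p + w - 1) * A by ring.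
    by rewrite addr_ge0// mulr_ge0 ?(ltW SAB) ?(ltW A0)// subr_ge0.
have [hJ|hJ] := leP 0 (or3 I K x).
  apply: Or31; apply: (@in_combination _ (det2 x K) (det2 I x) (det2 I K) I K x _ _ OI OK) => //.
  - exact: convex_hull_convex.
  - exact: OmegaI0.
  - by rewrite dIK.
  - by rewrite xl dFK dIK addr_ge0// mulr_ge0// ltW.
  - rewrite det2N xl dFI dII.
    have -> : - (p * 0 + w * - B) = w * B by ring.
    by rewrite mulr_ge0// ltW.
  - by move: hJ; rewrite or3E (det2N x K) (det2N I x) => h; lra.
  - exact: det_combination.
have eI : r *: rv (t + th + th * alpha - th) = I by rewrite /I (_ : t + th + th * alpha - th = t + th * alpha)//; ring.
apply: Or32; rewrite /triO eI -/F -/I -/K; split.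
- rewrite or3_rotl; apply: ltW; move: hJ; rewrite !or3E (det2N K I) (det2N I x) (det2N x K) => h; lra.
- rewrite -or3_rotl or_x dIF dFF dII dFI.
  have -> : B - p * B - w * 0 + p * 0 + w * - B = (1 - (p + w)) * B by ring.
  by rewrite mulr_ge0// ?subr_ge0 ltW.
- rewrite or_x dFK dIK dIF dFF.
  have -> : A - p * C - w * A + p * B + w * 0 = (1 - (p + w)) * A + p * (A + B - C) by ring.
  have h1 := ltW ABC; have h2 : 0 <= 1 - (p + w) by rewrite subr_ge0 ltW.
  by rewrite addr_ge0// mulr_ge0// ltW.
Qed.

Lemma rvD2pi t : rv (t + 2 * pi) = rv t :> R * R.
Proof.
have -> : t + 2 * pi = t + pi *+ 2 by rewrite mulr2n; ring.
by rewrite /rv cosD2pi sinD2pi.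
Qed.

Lemma triO_period x : triO (th * n%:R) x -> triO (th * 0) x.
Proof.
rewrite /triO (@theta_mul_n R n n3) mulr0 add0r.
have -> : rv (2 * pi) = rv 0 :> R * R by rewrite -[2 * pi]add0r rvD2pi.
have -> : 2 * pi + th * alpha = th * alpha + 2 * pi by ring.
have -> : th * alpha + 2 * pi - th = th * alpha - th + 2 * pi by ring.
by rewrite !rvD2pi.
Qed.

Lemma ring_cover x : OmegaE n x -> ~ OmegaI alpha n x ->
  exists2 i : 'I_n, True & triO (th * (i : nat)%:R) x \/ triE (th * (i : nat)%:R) x.
Proof.
move=> hE hI; have [i [rho [t [ni r0 /andP[t0 t1] xE]]]] := @sector R n n3 x.
rewrite -/th in t1 xE.
have hq : dotp (rho *: rv (th * i%:R + t)) (rv (th * i%:R + th / 2)) <= q.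
  rewrite -xE; move: hE; rewrite OmegaE_halfplanes// => /(_ i ni).
  by rewrite mulrDr -/th.
have nn : (n.-1.+1 = n)%N by case: (n) n3.
have OI j : (j <= n)%N -> OmegaI alpha n (r *: rv (th * j%:R + th * alpha)).
  by move=> jn; exact: OmegaI_vertI.
have OJ : OmegaI alpha n (r *: rv (th * i%:R + th * alpha - th)).
  case: i ni {hq xE} => [_|i ni].
    have -> : rv (th * 0%:R + th * alpha - th) = rv (th * n.-1%:R + th * alpha).
      rewrite -[LHS]rvD2pi -(@theta_mul_n R n n3) -/th -{1}nn -[n.-1.+1%:R]natr1; congr rv; ring.
    by apply: OI; rewrite -{2}nn.
  have -> : th * i.+1%:R + th * alpha - th = th * i%:R + th * alpha by rewrite -natr1; ring.
  by apply: OI; rewrite ltnW// ltnW.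
have [ut|ut] := leP t (th * alpha).
  have := @cover_first (th * i%:R) rho t r0.
  rewrite t0 ut -xE => /(_ isT); rewrite {1}xE => /(_ hq (OI _ (ltnW ni)) OJ) [//|h|h].
    by exists (Ordinal ni) => //=; left.
  by exists (Ordinal ni) => //=; right.
have := @cover_second (th * i%:R) rho t r0.
have e : th * i%:R + th = th * i.+1%:R by rewrite -natr1; ring.
rewrite (ltW ut) (ltW t1) -xE => /(_ isT); rewrite {1}xE => /(_ hq (OI _ (ltnW ni))).
rewrite e => /(_ (OI _ ni)) [//|h|h]; last by exists (Ordinal ni) => //=; right.
move: ni; rewrite leq_eqVlt => /orP[/eqP ni|ni]; last by exists (Ordinal ni) => //=; left.
have n0 : (0 < n)%N by case: (n) n3.
exists (Ordinal n0) => //=; left; apply: triO_period; by rewrite -ni.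
Qed.

End RingGeometry.

(** * Planar matrices and rotations *)

Section Matrices.
Context {R : realType}.
Implicit Types (x y : R * R) (A B : 'M[R]_2) (s t : R).

Lemma mat2_ext A B : A ord0 ord0 = B ord0 ord0 -> A ord0 ord_max = B ord0 ord_max ->
  A ord_max ord0 = B ord_max ord0 -> A ord_max ord_max = B ord_max ord_max -> A = B.
Proof. by move=> h1 h2 h3 h4; apply/matrixP => i j; case: (ord2 i) => ->; case: (ord2 j) => ->. Qed.

Lemma mulmx2E A B i j : (A *m B) i j = A i ord0 * B ord0 j + A i ord_max * B ord_max j.
Proof.
rewrite mxE big_ord_recl big_ord1; congr (_ + A i _ * B _ j); exact/val_inj.
Qed.

Lemma mxactM A B x : mxact (A *m B) x = mxact A (mxact B x).
Proof. by apply: pair_ext; rewrite /mxact /= !mulmx2E; ring. Qed.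

Lemma mxact1 x : mxact 1%:M x = x.
Proof. by apply: pair_ext; rewrite /mxact !mxE /=; ring. Qed.

Lemma mxactB A x y : mxact A (x - y) = mxact A x - mxact A y.
Proof. by apply: pair_ext; rewrite /mxact !pairE /=; ring. Qed.

Lemma mxactD A x y : mxact A (x + y) = mxact A x + mxact A y.
Proof. by apply: pair_ext; rewrite /mxact !pairE /=; ring. Qed.

Lemma mxactZ A (k : R) x : mxact A (k *: x) = k *: mxact A x.
Proof. by apply: pair_ext; rewrite /mxact !pairE /=; ring. Qed.

Lemma rotationE s : (rotation s ord0 ord0 = cos s) * (rotation s ord0 ord_max = - sin s) *
  (rotation s ord_max ord0 = sin s) * (rotation s ord_max ord_max = cos s).
Proof. by rewrite !mxE. Qed.

Lemma rotationM s t : rotation s *m rotation t = rotation (s + t).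
Proof. by apply: mat2_ext; rewrite !mulmx2E !rotationE ?cosD ?sinD; ring. Qed.

Lemma rotation0 : rotation (0 : R) = 1%:M.
Proof. by apply: mat2_ext; rewrite !rotationE ?mxE ?cos0 ?sin0 ?oppr0. Qed.

Lemma rotation_exp s k : rotation s ^+ k = rotation (k%:R * s).
Proof.
elim: k => [|k IH]; first by rewrite mul0r rotation0 expr0.
by rewrite exprS IH -natr1 mulrDl mul1r addrC -rotationM.
Qed.

Lemma rotation_tr s : (rotation s)^T = rotation (- s).
Proof. by apply: mat2_ext; rewrite !mxE /= ?cosN ?sinN ?opprK. Qed.

Lemma continuous_mxact A : continuous (mxact A).
Proof.
have c1 : continuous (fun x : R * R => A ord0 ord0 * x.1 + A ord0 ord_max * x.2).
  exact: (contD (contM (@contC _ _) continuous_fst2) (contM (@contC _ _) continuous_snd2)).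
have c2 : continuous (fun x : R * R => A ord_max ord0 * x.1 + A ord_max ord_max * x.2).
  exact: (contD (contM (@contC _ _) continuous_fst2) (contM (@contC _ _) continuous_snd2)).
by move=> x; exact: (cvg_pair (c1 x) (c2 x)).
Qed.

(** A planar rotation matrix is [[a, b], [-b, a]]: its inverse is both its
    transpose and its adjugate. *)
Lemma SO2_entries A : SO2 A -> [/\ A ord_max ord_max = A ord0 ord0, A ord_max ord0 = - A ord0 ord_max &
  A ord0 ord0 ^+ 2 + A ord0 ord_max ^+ 2 = 1].
Proof.
move=> [h d].
have e i j : A i ord0 * A j ord0 + A i ord_max * A j ord_max = (i == j)%:R.
  by have := congr1 (fun M : 'M[R]_2 => M i j) h; rewrite mulmx2E !mxE.
have d' : A ord0 ord0 * A ord_max ord_max - A ord0 ord_max * A ord_max ord0 = 1.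
  rewrite -d (expand_det_row A ord0) big_ord_recl big_ord1 /cofactor !det_mx11 !mxE /=.
  rewrite expr0 expr1 mul1r mulN1r mulrN.
  by congr (_ * A _ _ - A _ _ * A _ _); exact/val_inj.
have := e ord0 ord0; have := e ord0 ord_max; have := e ord_max ord_max; rewrite /=.
move: d'; set a := A ord0 ord0; set b := A ord0 ord_max; set c := A ord_max ord0; set k := A ord_max ord_max.
move=> d' e3 e2 e1.
have kE : k = a.
  have -> : k = k * (a * a + b * b) by rewrite e1 mulr1.
  have -> : k * (a * a + b * b) = a * (a * k - b * c) + b * (a * c + b * k) by ring.
  by rewrite d' e2 mulr1 mulr0 addr0.
have cE : c = - b.
  have -> : c = c * (a * a + b * b) by rewrite e1 mulr1.
  have -> : c * (a * a + b * b) = - b * (a * k - b * c) + a * (a * c + b * k) by ring.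
  by rewrite d' e2 mulr1 mulr0 addr0.
by split => //; rewrite !expr2.
Qed.

Lemma SO2_enorm A x : SO2 A -> enorm (mxact A x) = enorm x.
Proof.
move=> /SO2_entries[h1 h2 h3]; rewrite /enorm /mxact /= h1 h2; congr Num.sqrt.
rewrite -[RHS]mul1r -h3; ring.
Qed.

Lemma SO2_comm_rotation A s : SO2 A -> A *m rotation s = rotation s *m A.
Proof.
by move=> /SO2_entries[h1 h2 _]; apply: mat2_ext; rewrite !mulmx2E !rotationE ?h1 ?h2; ring.
Qed.

End Matrices.

(** * The self-similar family of rings *)

Section RingFamily.
Context {R : realType}.
Variables (alpha : R) (n : nat).
Hypotheses (alpha01 : 0 < alpha < 1) (n3 : (3 <= n)%N).
Implicit Types (x y z : R * R) (t : R).

Let th : R := theta n.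
Let q : R := apothem n.
Let r : R := r_I alpha n.
Let r0 : 0 < r := r_gt0 alpha01 n3.

Lemma open_triangleC (a b c : R * R) : open_triangle a b c = open_triangle a c b.
Proof.
rewrite /open_triangle; congr (interior (convex_hull _)).
by apply/seteqP; split => x [] h; first [exact: Or31 h|exact: Or33 h|exact: Or32 h].
Qed.

Definition otriO t x : Prop := otri (rv t) (r *: rv (t + th * alpha)) (r *: rv (t + th * alpha - th)) x.
Definition otriE t x : Prop := otri (rv t) (rv (t + th)) (r *: rv (t + th * alpha)) x.

Lemma otriO_T (i : nat) : otriO (th * i%:R) `<=` T_ alpha n i.*2.+1.
Proof.
rewrite /T_ /= odd_double /= doubleK.
rewrite E_ptE open_triangleC I_ptS !I_ptE /vertI -/th -/r.
have -> : th * (i%:R - 1 + alpha) = th * i%:R + th * alpha - th by ring.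
apply: otri_sub_open_triangle; rewrite /vertE.
by have := or3_triO alpha n (th * i%:R); rewrite -/th -/r => ->; exact: ABC_gt0.
Qed.

Lemma otriE_T (i : nat) : otriE (th * i%:R) `<=` T_ alpha n i.+1.*2.
Proof.
rewrite /T_ odd_double doubleK add1n !E_ptE I_ptS open_triangleC /vertE /vertI -/th -/r.
have -> : th * i.+1%:R = th * i%:R + th by rewrite -natr1; ring.
apply: otri_sub_open_triangle.
by have := or3_triE alpha n (th * i%:R); rewrite -/th -/r => ->; exact: SAB_gt0.
Qed.

Lemma OmegaE_shrink x t : OmegaE n x -> 0 <= t < 1 -> open_polygon n (t *: x).
Proof.
rewrite OmegaE_halfplanes// => hx /andP[t0 t1] k nk; rewrite dotpZl.
apply: (@le_lt_trans _ _ (t * q)); first by apply: ler_wpM2l => //; exact: hx.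
by rewrite gtr_pMl// apothem_gt0.
Qed.

Lemma not_open_polygon_grow x t : ~ open_polygon n x -> 1 < t -> ~ OmegaE n (t *: x).
Proof.
move=> hx t1 hE; apply: hx => k nk; move: hE; rewrite OmegaE_halfplanes// => /(_ k nk).
rewrite dotpZl; move=> h; rewrite ltNge; apply/negP => h'.
have q0 := apothem_gt0 n3 : 0 < (q : R).
have : q < t * q by rewrite ltr_pMl.
have : t * q <= t * dotp x (rv (theta n * (k%:R + 2^-1))) by rewrite ler_pM2l// (lt_trans ltr01).
by rewrite -/q in h' *; move: h; rewrite -/q; lra.
Qed.

Lemma cvg_scale1 x : (fun t : R => t *: x) @ (1 : R) --> x.
Proof. by rewrite -{2}[x]scale1r; apply: cvgZr_tmp; exact: cvg_id. Qed.

Lemma open_scale (A : set (R * R)) x : open A -> A x -> \forall t \near (1 : R), A (t *: x).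
Proof. by move=> oA Ax; apply: (@cvg_scale1 x); exact: open_nbhs_nbhs. Qed.

Lemma closure_shrink (A : set (R * R)) x :
  (\forall t \near (1 : R), 0 <= t < 1 -> A (t *: x)) -> closure A x.
Proof.
move=> h B Bx; have := @cvg_scale1 x _ Bx.
rewrite /= => h'.
have [e /= e0 he] := filterI h h'.
pose t := 1 - Num.min (e / 2) 2^-1.
have m0 : 0 < Num.min (e / 2) 2^-1 by rewrite lt_min divr_gt0//= invr_gt0.
have m1 : Num.min (e / 2) 2^-1 <= 2^-1 by rewrite ge_min lexx orbT.
have m2 : Num.min (e / 2) 2^-1 <= e / 2 by rewrite ge_min lexx.
have [] := he t.
  by rewrite /ball /= /t opprB addrC subrK gtr0_norm//; lra.
by move=> hA hB; exists (t *: x); split => //; apply: hA; rewrite /t; apply/andP; split; lra.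
Qed.

Lemma Omega_sub x : Omega alpha n x -> OmegaE n x /\ ~ OmegaI alpha n x.
Proof. by move=> /interior_subset[]. Qed.

Lemma Omega_sup x : open_polygon n x -> ~ OmegaI alpha n x -> Omega alpha n x.
Proof.
move=> h1 h2; rewrite /Omega /interior.
have oI : open (~` OmegaI alpha n) by apply: closed_openC; exact: closed_OmegaI.
have hh : nbhs x (open_polygon n `&` ~` OmegaI alpha n).
  by apply: filterI; [exact: open_polygon_nbhs|exact: open_nbhs_nbhs].
by apply: filterS hh => y [] /(open_polygon_sub n3).
Qed.

Lemma vertE_not_int i : (i < n)%N -> ~ open_polygon n (vertE n i : R * R).
Proof.
move=> ni /(_ i ni); rewrite /vertE dot_rv.
have -> : theta n * i%:R - theta n * (i%:R + 2^-1) = - (th / 2) by rewrite -/th; ring.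
by rewrite cosN ltxx.
Qed.

Lemma vertE_shrink : \forall t \near (1 : R), forall i : 'I_n, 0 <= t < 1 -> Omega alpha n (t *: vertE n i).
Proof.
apply: (@filter_forall _ _ (fun (i : 'I_n) (t : R) => 0 <= t < 1 -> Omega alpha n (t *: vertE n i)) (nbhs (1 : R)) _) => i.
have oI : open (~` OmegaI alpha n) by apply: closed_openC; exact: closed_OmegaI.
have nI : ~ OmegaI alpha n (vertE n i) by move=> /(OmegaI_int alpha01 n3); apply: (@vertE_not_int i).
have := open_scale oI nI; apply: filterS => t h t01.
by apply: Omega_sup => //; exact: scale_vertE_int.
Qed.

(** The ring reaches the outer vertices, which are not in the inner polygon, so
    its hull contains the slightly shrunk outer polygons. *)
Lemma hull_Omega : open_polygon n `<=` convex_hull (Omega alpha n).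
Proof.
move=> x hx.
have c : (fun t : R => t^-1 *: x) @ (1 : R) --> x.
  rewrite -{2}[x]scale1r -{2}[1]invr1; apply: cvgZr_tmp; apply: cvgV; [exact: oner_neq0|exact: cvg_id].
have h1 : \forall t \near (1 : R), open_polygon n (t^-1 *: x) by apply: c; exact: open_polygon_nbhs.
have [e /= e0 he] := filterI h1 vertE_shrink.
pose t := 1 - Num.min (e / 2) 2^-1.
have m0 : 0 < Num.min (e / 2) 2^-1 by rewrite lt_min divr_gt0//= invr_gt0.
have m1 : Num.min (e / 2) 2^-1 <= 2^-1 by rewrite ge_min lexx orbT.
have m2 : Num.min (e / 2) 2^-1 <= e / 2 by rewrite ge_min lexx.
have t0 : 0 < t by rewrite /t; lra.
have [] := he t.
  by rewrite /ball /= /t opprB addrC subrK gtr0_norm//; lra.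
move=> hA hB.
have : [set y | OmegaE n (t^-1 *: rot (- 0) y)] x by rewrite /= oppr0 rot0; exact: open_polygon_sub.
rewrite -[X in X x]/[set y | convex_hull _ (t^-1 *: rot (- 0) y)] OmegaE_set.
rewrite -hull_similar ?gt_eqF//; apply: hull_mono.
move=> _ [_ [i ni <-] <-]; rewrite rot0; apply: (hB (Ordinal ni)); rewrite (ltW t0) /t; lra.
Qed.

Lemma hull_Omega_sub : convex_hull (Omega alpha n) `<=` OmegaE n.
Proof. by apply: hull_min; [exact: convex_hull_convex|move=> x /Omega_sub[]]. Qed.

(** [unscale k] maps the ring of index [k] to the one of index 0, and [filled k] is
    the full polygon bounded by the former; the ring of index [k] is then
    [filled k] without [filled k.+1]. *)
Definition unscale k x : R * R := r ^- k *: rot (- (k%:R * (th * alpha))) x.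
Definition filled k : set (R * R) := [set x | OmegaE n (unscale k x)].

Lemma rk_gt0 k : 0 < r ^+ k. Proof. exact: exprn_gt0. Qed.
Lemma rk_neq0 k : r ^+ k != 0. Proof. by rewrite gt_eqF// rk_gt0. Qed.

Lemma unscale0 x : unscale 0 x = x.
Proof. by rewrite /unscale mul0r oppr0 rot0 expr0 invr1 scale1r. Qed.

Lemma unscaleS k x : unscale k.+1 x = r^-1 *: rot (- (th * alpha)) (unscale k x).
Proof.
rewrite /unscale rotZ scalerA -rotD exprS invfM -natr1 mulrDl mul1r; congr (_ *: rot _ x); ring.
Qed.

Lemma unscaleZ k t x : unscale k (t *: x) = t *: unscale k x.
Proof. by rewrite /unscale rotZ !scalerA mulrC. Qed.

Lemma unscaleB k x y : unscale k (x - y) = unscale k x - unscale k y.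
Proof. by rewrite /unscale rotB scalerBr. Qed.

Lemma unscaleK k y : unscale k (r ^+ k *: rot (k%:R * (th * alpha)) y) = y.
Proof. by rewrite unscaleZ /unscale rotK scalerA divff ?scale1r// rk_neq0. Qed.

Lemma unscaleVK k x : r ^+ k *: rot (k%:R * (th * alpha)) (unscale k x) = x.
Proof. by rewrite /unscale rotZ rotNK scalerA divff ?scale1r// rk_neq0. Qed.

Lemma enorm_unscale k x : enorm (unscale k x) = enorm x / r ^+ k.
Proof. by rewrite /unscale enormZ enorm_rot ger0_norm ?invr_ge0 ?ltW ?rk_gt0// mulrC. Qed.

Lemma filledS k x : filled k.+1 x <-> OmegaI alpha n (unscale k x).
Proof. by rewrite OmegaI_E// /filled /= unscaleS. Qed.

Lemma filled_decS k : filled k.+1 `<=` filled k.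
Proof. by move=> x /filledS; exact: OmegaI_sub. Qed.

Lemma filled_dec j k : (j <= k)%N -> filled k `<=` filled j.
Proof.
move=> jk; rewrite -(subnK jk); elim: (k - j)%N => [//|m IH] x.
by rewrite addSn => /filled_decS /IH.
Qed.

Lemma continuous_unscale k : continuous (unscale k).
Proof. exact: continuous_sim. Qed.

Lemma closed_filled k : closed (filled k).
Proof.
apply: (@closed_comp _ _ (unscale k) (OmegaE n)); last exact: closed_OmegaE.
by move=> x _; exact: continuous_unscale.
Qed.

Lemma convex_filled k : convex_set (filled k).
Proof.
apply/convex_setP => x y t hx hy t01; rewrite /filled /=.
have -> : unscale k (x + t *: (y - x)) = unscale k x + t *: (unscale k y - unscale k x).
  by rewrite -unscaleB -unscaleZ; rewrite /unscale rotDl scalerDr.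
exact: hull_convex.
Qed.

Lemma SigmaE k : Sigma alpha n k = [set r ^+ k *: rot (k%:R * (th * alpha)) x | x in Omega alpha n].
Proof.
by apply/seteqP; split => _ [y hy <-]; exists y => //; rewrite /Qn rotation_exp mxact_rotation.
Qed.

Lemma Sigma_sub k x : Sigma alpha n k x -> filled k x /\ ~ filled k.+1 x.
Proof.
rewrite SigmaE => -[y /Omega_sub[hE hI] <-]; split; first by rewrite /filled /= unscaleK.
by move=> /filledS; rewrite unscaleK.
Qed.

Lemma Sigma_sup k x : open_polygon n (unscale k x) -> ~ filled k.+1 x -> Sigma alpha n k x.
Proof.
move=> h1 h2; rewrite SigmaE; exists (unscale k x); last exact: unscaleVK.
by apply: Omega_sup => // /filledS.
Qed.

Lemma core_sub : core alpha n `<=` filled (N_n alpha n).+1.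
Proof.
rewrite /core; apply: hull_min; first exact: convex_filled.
have := @closed_filled (N_n alpha n).+1 => /closure_id ->.
by apply: closure_subset => x /Sigma_sub[].
Qed.

Lemma core_sup x : open_polygon n (unscale (N_n alpha n).+1 x) -> core alpha n x.
Proof.
move=> /hull_Omega h; rewrite /core.
apply: (@hull_mono _ (Sigma alpha n (N_n alpha n).+1)); first exact: subset_closure.
by rewrite SigmaE hull_similar ?rk_neq0.
Qed.

Lemma outerE x : outer alpha n x <-> ~ convex_hull (Omega alpha n) x.
Proof.
rewrite /outer /setC /=; suff -> : Sigma alpha n 0 = Omega alpha n by [].
rewrite SigmaE; apply/seteqP; split => [_ [y hy <-]|y hy].
  by rewrite mul0r rot0 expr0 scale1r.
by exists y => //; rewrite mul0r rot0 expr0 scale1r.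
Qed.

Lemma outer_not_int x : outer alpha n x -> ~ open_polygon n x.
Proof. by move=> /outerE h /hull_Omega. Qed.

Lemma not_filled0_outer x : ~ filled 0 x -> outer alpha n x.
Proof. by move=> h; apply/outerE => /hull_Omega_sub; rewrite /filled /= unscale0 in h. Qed.

Lemma filled1_not_outer x : filled 1 x -> ~ outer alpha n x.
Proof. by move=> /filledS; rewrite unscale0 => /(OmegaI_int alpha01 n3) /hull_Omega h /outerE. Qed.

(** Shrinking a point of a ring slightly moves it off the outer boundary, and it
    stays outside the inner polygon, which is closed. *)
Lemma dense_v_domain x : closure (v_domain alpha n) x.
Proof.
set N := N_n alpha n.
have [h0|h0] := pselect (filled 0 x); last first.
  by apply: subset_closure; left; right; exact: not_filled0_outer.
apply: closure_shrink.
have [hN|hN] := pselect (filled N.+1 x).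
  near=> t => t01; right; apply: core_sup; rewrite unscaleZ; exact: OmegaE_shrink.
have [k [kN hk hk1]] : exists k, [/\ (k <= N)%N, filled k x & ~ filled k.+1 x].
  elim: N hN => [|m IH] hN; first by exists 0%N.
  have [hm|hm] := pselect (filled m.+1 x); first by exists m.+1.
  by have [k [km h1 h2]] := IH hm; exists k; split => //; exact: leqW.
have oD : open (~` filled k.+1) by apply: closed_openC; exact: closed_filled.
have := open_scale oD hk1; apply: filterS => t h t01.
left; left; exists k => //=; apply: Sigma_sup => //.
by rewrite unscaleZ; exact: OmegaE_shrink.
Unshelve. all: by end_near. Qed.

End RingFamily.

(** * Stretch matrices and affine pieces *)

Section Tensors.
Context {R : realType}.
Implicit Types (x y z e : R * R) (A B : 'M[R]_2) (s t : R).

Definition op_bound A (L : R) : Prop := forall x, enorm (mxact A x) <= L * enorm x.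

Lemma mxact_tensor x y z : mxact (tensor x y) z = dotp y z *: x.
Proof. by apply: pair_ext; rewrite /mxact !mxE /coord !pairE /dotp /=; ring. Qed.

Lemma mxactDl A B x : mxact (A + B) x = mxact A x + mxact B x.
Proof. by apply: pair_ext; rewrite /mxact !mxE !pairE /=; ring. Qed.

Lemma mxactZl (k : R) A x : mxact (k *: A) x = k *: mxact A x.
Proof. by apply: pair_ext; rewrite /mxact !mxE !pairE /=; ring. Qed.

Lemma mxact_inj A B : (forall x, mxact A x = mxact B x) -> A = B.
Proof.
move=> h; have h1 := h (1, 0); have h2 := h (0, 1).
have e i : (A i ord0 = B i ord0) * (A i ord_max = B i ord_max).
  case: (ord2 i) => ->; move: (congr1 fst h1) (congr1 fst h2) (congr1 snd h1) (congr1 snd h2);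
  by rewrite /mxact /= !mulr1 !mulr0 !addr0 !add0r.
by apply: mat2_ext; rewrite !e.
Qed.

Lemma dotC x y : dotp x y = dotp y x.
Proof. by rewrite /dotp; ring. Qed.

Lemma dot_abs x y : `|dotp x y| <= enorm x * enorm y.
Proof.
rewrite ler_norml dot_le andbT lerNl.
have -> : - dotp x y = dotp (- x) y by rewrite /dotp !pairE; ring.
by rewrite -[enorm x]enormN dot_le.
Qed.

Lemma op_bound_tensor x y : enorm x <= 1 -> enorm y <= 1 -> op_bound (tensor x y) 1.
Proof.
move=> hx hy z; rewrite mxact_tensor enormZ mul1r.
have z0 := enorm_ge0 z; have x0 := enorm_ge0 x; have := dot_abs y z => h.
apply: (@le_trans _ _ (enorm y * enorm z * enorm x)); first exact: ler_wpM2r.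
apply: (@le_trans _ _ (enorm y * enorm z)); first by rewrite ler_piMr// mulr_ge0// enorm_ge0.
by rewrite ler_piMl.
Qed.

Lemma op_boundD A B (L L' : R) : op_bound A L -> op_bound B L' -> op_bound (A + B) (L + L').
Proof. by move=> h h' x; rewrite mxactDl mulrDl; apply: le_trans (enormD _ _) _; exact: lerD. Qed.

Lemma op_boundZ (k L : R) A : op_bound A L -> op_bound (k *: A) (`|k| * L).
Proof. by move=> h x; rewrite mxactZl enormZ -mulrA ler_wpM2l. Qed.

Lemma op_bound_rotl s A (L : R) : op_bound A L -> op_bound (rotation s *m A) L.
Proof. by move=> h x; rewrite mxactM mxact_rotation enorm_rot. Qed.

Lemma op_bound_rotr s A (L : R) : op_bound A L -> op_bound (A *m rotation s) L.
Proof. by move=> h x; rewrite mxactM mxact_rotation; apply: le_trans (h _) _; rewrite enorm_rot. Qed.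

Lemma op_bound_le A (L L' : R) : L <= L' -> op_bound A L -> op_bound A L'.
Proof. by move=> LL h x; apply: le_trans (h x) _; apply: ler_wpM2r => //; exact: enorm_ge0. Qed.

Lemma perpE x : perp x = (- x.2, x.1).
Proof. by rewrite /perp mxact_rotation /rot cos_pihalf sin_pihalf; apply: pair_ext => /=; ring. Qed.

Lemma enorm_perp x : enorm (perp x) = enorm x.
Proof. by rewrite /perp mxact_rotation enorm_rot. Qed.

Lemma dot_ee e : enorm e = 1 -> dotp e e = 1.
Proof. by rewrite -enorm_dot => ->; rewrite expr1n. Qed.

Lemma dot_eperp e : dotp e (perp e) = 0.
Proof. by rewrite perpE /dotp /=; ring. Qed.

Lemma dot_perp e : enorm e = 1 -> dotp (perp e) (perp e) = 1.
Proof. by move=> h; rewrite -enorm_dot enorm_perp h expr1n. Qed.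

End Tensors.

Section AffinePieces.
Context {R : realType}.
Implicit Types (x y z : R * R) (A M : 'M[R]_2) (u : R * R -> R * R) (t : R).

Lemma zero_limit (g : R -> R * R) : {for 0, continuous g} -> (forall t, 0 < t <= 1 -> g t = 0) -> g 0 = 0.
Proof.
move=> cg h; have c1 : g @ (0 : R)^'+ --> g 0 by apply: cvg_at_right_filter.
have c2 : g @ (0 : R)^'+ --> (0 : R * R).
  have E : {near (0 : R)^'+, (fun=> 0) =1 g}.
    near=> t; rewrite h//; apply/andP; split => //; near: t; exact: nbhs_right_le.
  exact: (cvg_trans (near_eq_cvg E) (cvg_cst (0 : R * R))).
exact: (cvg_unique _ c1 c2).
Unshelve. all: by end_near. Qed.

(** The formula passes to the closed triangle along segments to the centre. *)
Lemma affine_closed_triangle u A (a b c : R * R) : 0 < or3 a b c -> continuous u ->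
  (forall x y, otri a b c x -> otri a b c y -> u y = u x + mxact A (y - x)) ->
  forall x y, ctri a b c x -> ctri a b c y -> u y = u x + mxact A (y - x).
Proof.
move=> D0 cu h x y hx hy; set z := 3^-1 *: (a + b + c).
have hz : otri a b c z by exact: otri_center.
pose p w (t : R) : R * R := w + t *: (z - w).
have cp w : continuous (p w).
  by move=> t; apply: cvgD; [exact: cvg_cst|apply: cvgZr_tmp; exact: cvg_id].
pose g (t : R) := u (p y t) - u (p x t) - mxact A (p y t - p x t).
have cg : continuous g.
  move=> t; apply: cvgB; first apply: cvgB.
  - exact: (continuous_comp (cp y t) (cu _)).
  - exact: (continuous_comp (cp x t) (cu _)).
  - apply: (continuous_comp (f := fun t => p y t - p x t)); last exact: continuous_mxact.
    exact: (cvgB (cp y t) (cp x t)).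
have : g 0 = 0.
  apply: zero_limit => [|t t01]; first exact: cg.
  rewrite /g (h (p x t) (p y t)); try exact: ctri_otri_segment.
  by rewrite [u _ + _]addrC addrK subrr.
rewrite /g /p !scale0r !addr0 => /eqP; rewrite subr_eq0 subr_eq => /eqP ->.
by rewrite addrC.
Qed.

Lemma affine_gradient_on u (G : R * R -> 'M[R]_2) A (O : set (R * R)) :
  W1loc +oo%E u G -> continuous u -> open O ->
  (forall x y t, O x -> O y -> 0 <= t <= 1 -> O (x + t *: (y - x))) ->
  {ae lebesgue2, forall x, O x -> G x = A} ->
  forall x y, O x -> O y -> u y = u x + mxact A (y - x).
Proof.
move=> [_ hm hw] cu oO cO hG.
have h i : forall x y, O x -> O y ->
    coord i (u y) = coord i (u x) + (A i ord0 * (y.1 - x.1) + A i ord_max * (y.2 - x.2)).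
  apply: (@affine_of_weak_gradient R (coord i \o u) (fun j x => G x i j) (A i) O) => //.
  - by case: (ord2 i) => ->; move=> x; apply: continuous_comp; [exact: cu|exact: continuous_fst2|exact: cu|exact: continuous_snd2].
  - by move=> j; have [] := hm i j.
  - by move=> j; apply: ae_mono hG => y /[apply] ->.
by move=> x y Ox Oy; apply: pair_ext; [exact: (h ord0)|exact: (h ord_max)].
Qed.

End AffinePieces.

Section RingMatrices.
Context {R : realType}.
Variables (alpha : R) (n : nat).
Hypotheses (alpha01 : 0 < alpha < 1) (n3 : (3 <= n)%N).
Implicit Types (x y z : R * R) (t : R).

Let th : R := theta n.
Let r : R := r_I alpha n.
Let r0 : 0 < r := r_gt0 alpha01 n3.
Let r1 : r < 1 := r_lt1 alpha01 n3.

Definition shear : R := ((a_n alpha n)^-1 - a_n alpha n) / tan (phi n).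
(** [b = 1] gives U and [b = -1] gives P_0 U P_0: the reflection only changes the
    sign of the shear. *)
Definition stretch (b : R) : 'M[R]_2 :=
  a_n alpha n *: tensor (e11 alpha n) (e11 alpha n)
  + (a_n alpha n)^-1 *: tensor (perp (e11 alpha n)) (perp (e11 alpha n))
  + (b * shear) *: tensor (e11 alpha n) (perp (e11 alpha n)).
Definition lip_bound : R := a_n alpha n + (a_n alpha n)^-1 + `|shear|.

Lemma an_gt0 : 0 < a_n alpha n.
Proof. by rewrite sqrtr_gt0; apply: divr_gt0; [exact: sin_al'|exact: sin_al]. Qed.

Lemma enorm_e11 : enorm (e11 alpha n) = 1.
Proof.
have d0 : enorm (I_pt alpha n 1 - E_pt n 1) != 0.
  apply/negP => /eqP/enorm_eq0/eqP; rewrite subr_eq0 => /eqP e.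
  have : enorm (I_pt alpha n 1) = enorm (E_pt n 1 : R * R) by rewrite e.
  rewrite I_ptE E_ptE enormZ !enorm_rv mulr1 ger0_norm ?ltW//.
  by move=> e'; move: r1; rewrite /r e' ltxx.
by rewrite /e11 enormZ ger0_norm ?invr_ge0 ?enorm_ge0// mulVf.
Qed.

Lemma U_stretch : U alpha n = stretch 1.
Proof. by rewrite /U /stretch mul1r. Qed.

(** P_0 fixes e11 and changes the sign of its perpendicular. *)
Lemma P0U_stretch : P0 alpha n *m U alpha n *m P0 alpha n = stretch (-1).
Proof.
rewrite U_stretch; have he := enorm_e11; rewrite /P0 /stretch; move: (e11 alpha n) he => e he.
have h1 := dot_ee he; have h2 := dot_eperp e; have h3 := dot_perp he.
have h2' : dotp (perp e) e = 0 by rewrite dotC.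
have P0e x : mxact (tensor e e - tensor (perp e) (perp e)) x = dotp e x *: e - dotp (perp e) x *: perp e.
  by rewrite mxactDl -scaleN1r mxactZl !mxact_tensor scaleN1r.
have Ve b x : mxact (a_n alpha n *: tensor e e + (a_n alpha n)^-1 *: tensor (perp e) (perp e) + (b * shear) *: tensor e (perp e)) x
   = (a_n alpha n * dotp e x + b * shear * dotp (perp e) x) *: e + ((a_n alpha n)^-1 * dotp (perp e) x) *: perp e.
  by rewrite !mxactDl !mxactZl !mxact_tensor; apply: pair_ext; rewrite !pairE; ring.
have D1 (k l : R) : dotp e (k *: e + l *: perp e) = k.
  by rewrite dotC dotpDl !dotpZl h1 h2' mulr0 addr0 mulr1.
have D2 (k l : R) : dotp (perp e) (k *: e + l *: perp e) = l.
  by rewrite dotC dotpDl !dotpZl h3 h2 mulr0 add0r mulr1.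
apply: mxact_inj => x; rewrite !mxactM !P0e !Ve -!scaleNr !(D1, D2).
by congr (_ *: _ + _ *: _); ring.
Qed.

Lemma lip_bound_ge1 : 1 <= lip_bound.
Proof.
rewrite /lip_bound; have a0 := an_gt0; have := normr_ge0 shear; move: (a_n alpha n) a0 => a a0 k0.
have [a1|a1] := leP 1 a; first by have : 0 < a^-1 by [rewrite invr_gt0]; lra.
have : 1 <= a^-1 by rewrite invf_ge1// ltW.
lra.
Qed.

Lemma lip_bound_ge0 : 0 <= lip_bound. Proof. by have := lip_bound_ge1; lra. Qed.

Lemma op_bound_stretch b : `|b| <= 1 -> op_bound (stretch b) lip_bound.
Proof.
move=> b1; have e1 := enorm_e11; have a0 := an_gt0.
apply: (@op_bound_le _ _ (`|a_n alpha n| * 1 + `|(a_n alpha n)^-1| * 1 + `|b * shear| * 1)).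
  rewrite !mulr1 normfV !(gtr0_norm a0) /lip_bound lerD2l normrM ler_piMl//.
by apply: op_boundD; [apply: op_boundD|]; apply: op_boundZ; apply: op_bound_tensor; rewrite ?enorm_perp e1.
Qed.

Definition turned_stretch b i : 'M[R]_2 := rotation (th * i%:R) *m stretch b *m rotation (- (th * i%:R)).

Lemma op_bound_turned_stretch b i : `|b| <= 1 -> op_bound (turned_stretch b i) lip_bound.
Proof. by move=> b1; apply: op_bound_rotr; apply: op_bound_rotl; exact: op_bound_stretch. Qed.

Lemma ring_gradient_odd i : ring_gradient alpha n i.*2.+1 = turned_stretch 1 i.
Proof.
rewrite /ring_gradient /= odd_double /= /turned_stretch U_stretch /Qn rotation_tr -/th.
have -> : ((i.*2.+1)%:R - 1) / 2 = i%:R :> R by rewrite -natr1 addrK -muln2 natrM mulfK.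
by [].
Qed.

Lemma ring_gradient_even i : ring_gradient alpha n i.+1.*2 = turned_stretch (-1) i.
Proof.
rewrite /ring_gradient odd_double /turned_stretch P0U_stretch /Qn rotation_tr -/th.
have -> : ((i.+1.*2)%:R - 2) / 2 = i%:R :> R by rewrite -muln2 natrM -natr1; field.
by [].
Qed.

End RingMatrices.

(** * The iterated deformation *)

Section RingMap.
Context {R : realType}.
Variables (alpha : R) (n : nat).
Hypotheses (alpha01 : 0 < alpha < 1) (n3 : (3 <= n)%N).
Variables (u : R * R -> R * R) (RE : 'M[R]_2).
Hypothesis hu : ring_deformation alpha n u RE.
Implicit Types (x y z : R * R) (t : R).

Let th : R := theta n.
Let r : R := r_I alpha n.
Let de : R := th * alpha.
Let ga : R := th * (1 - 2 * alpha).

Lemma RE_SO2 : SO2 RE. Proof. by case: hu. Qed.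
Lemma u_cont : continuous u. Proof. by case: hu. Qed.

Lemma RE_trK (A B : 'M[R]_2) : RE *m A = B -> A = RE^T *m B.
Proof. by have [/mulmx1C h _] := RE_SO2 => <-; rewrite mulmxA h mul1mx. Qed.

(** Such a point is a limit of exterior points, where [u] is the identity. *)
Lemma u_out x : ~ open_polygon n x -> u x = x.
Proof.
move=> hx; pose g (t : R) := u ((1 + t) *: x) - (1 + t) *: x.
have cs : continuous (fun t : R => (1 + t) *: x).
  move=> t; apply: cvgZr_tmp; apply: cvgD; [exact: cvg_cst|exact: cvg_id].
have cg : continuous g.
  move=> t; apply: cvgB; last exact: cs.
  have cu := u_cont; exact: (continuous_comp (cs t) (cu _)).
have : g 0 = 0.
  apply: zero_limit => [|t /andP[t0 _]]; first exact: cg.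
  have [_ _ h _ _] := hu; rewrite /g h ?subrr//; apply: not_open_polygon_grow => //.
  by rewrite ltrDl.
by rewrite /g addr0 scale1r => /eqP; rewrite subr_eq0 => /eqP.
Qed.

Lemma u_in x : OmegaI alpha n x -> u x = rot ga x.
Proof. by case: hu => _ _ _ h _ /h ->; rewrite mxact_rotation. Qed.

Lemma u_vertE i : (i < n)%N -> u (vertE n i) = vertE n i.
Proof. by move=> ni; apply: u_out; exact: vertE_not_int. Qed.

Lemma u_triangle_odd i x y : (i < n)%N -> triO alpha n (th * i%:R) x -> triO alpha n (th * i%:R) y ->
  u y = u x + mxact (RE^T *m turned_stretch alpha n 1 i) (y - x).
Proof.
move=> ni; apply: affine_closed_triangle; last 1 first.
  have [_ _ _ _ [G hG hae]] := hu.
  apply: (affine_gradient_on hG u_cont); [exact: otri_open|exact: otri_convex|].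
  have := hae i.*2.+1; rewrite ring_gradient_odd.
  have -> : (1 <= i.*2.+1 <= 2 * n)%N by rewrite mul2n ltn_double.
  by move=> /(_ isT); apply: ae_mono => x' h ox; apply/RE_trK/h; exact: otriO_T.
- by have := or3_triO alpha n (th * i%:R); rewrite -/th -/r => ->; exact: ABC_gt0.
- exact: u_cont.
Qed.

Lemma u_triangle_even i x y : (i < n)%N -> triE alpha n (th * i%:R) x -> triE alpha n (th * i%:R) y ->
  u y = u x + mxact (RE^T *m turned_stretch alpha n (-1) i) (y - x).
Proof.
move=> ni; apply: affine_closed_triangle; last 1 first.
  have [_ _ _ _ [G hG hae]] := hu.
  apply: (affine_gradient_on hG u_cont); [exact: otri_open|exact: otri_convex|].
  have := hae i.+1.*2; rewrite ring_gradient_even//.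
  have -> : (1 <= i.+1.*2 <= 2 * n)%N by rewrite mul2n leq_double.
  by move=> /(_ isT); apply: ae_mono => x' h ox; apply/RE_trK/h; exact: otriE_T.
- by have := or3_triE alpha n (th * i%:R); rewrite -/th -/r => ->; exact: SAB_gt0.
- exact: u_cont.
Qed.

Definition tri_at (b : bool) i x : Prop :=
  if b then triO alpha n (th * i%:R) x else triE alpha n (th * i%:R) x.
Definition sgn (b : bool) : R := if b then 1 else -1.

Lemma u_tri b i x y : (i < n)%N -> tri_at b i x -> tri_at b i y ->
  u y = u x + mxact (RE^T *m turned_stretch alpha n (sgn b) i) (y - x).
Proof. by case: b; [exact: u_triangle_odd|exact: u_triangle_even]. Qed.

Lemma tri_vertE b i : tri_at b i (vertE n i : R * R).
Proof.
have e (a c : R * R) : or3 a a c = 0 by rewrite /or3 /det2 !pairE; ring.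
have e' (a c : R * R) : or3 a c a = 0 by rewrite /or3 /det2 !pairE; ring.
case: b; rewrite /tri_at /triO /triE /vertE -/th; split; rewrite ?e ?e'//.
  by rewrite or3_triO ltW// ABC_gt0.
by rewrite or3_triE ltW// SAB_gt0.
Qed.

(** The two ends of an outer edge are fixed by [u], which is affine in between
    with gradient [RE^T *m turned_stretch].  This is what determines [RE]. *)
Lemma RE_edge i : (i.+1 < n)%N -> mxact RE (vertE n i.+1 - vertE n i) = mxact (turned_stretch alpha n (-1) i) (vertE n i.+1 - vertE n i).
Proof.
move=> ni; have ni' : (i < n)%N by exact: ltnW.
have h1 : triE alpha n (th * i%:R) (vertE n i.+1 : R * R).
  have e (a c : R * R) : or3 c a a = 0 by rewrite /or3 /det2 !pairE; ring.
  have e' (a c : R * R) : or3 a c a = 0 by rewrite /or3 /det2 !pairE; ring.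
  have e'' (a c : R * R) : or3 a a c = 0 by rewrite /or3 /det2 !pairE; ring.
  have -> : vertE n i.+1 = rv (th * i%:R + th) :> R * R by rewrite /vertE -/th -natr1; congr rv; ring.
  split; rewrite ?e ?e' ?e''//.
  by rewrite or3_triE ltW// SAB_gt0.
have := u_triangle_even ni' (tri_vertE false i) h1; rewrite !u_vertE// mxactM.
set d := mxact (turned_stretch _ _ _ _) _ => h.
have -> : vertE n i.+1 - vertE n i = mxact RE^T d.
  by apply/eqP; rewrite subr_eq addrC; apply/eqP.
by rewrite -mxactM; have [-> _] := RE_SO2; rewrite mxact1.
Qed.

(** An isometry inside and outside the ring, and an affine map with bounded
    gradient on each triangle. *)
Lemma u_lip x y : enorm (u x - u y) <= lip_bound alpha n * enorm (x - y).
Proof.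
have L1 := lip_bound_ge1 alpha01 n3; have L0 := lip_bound_ge0 alpha01 n3.
pose D (k : option (option ('I_n * bool))) x : Prop := match k with
  | None => ~ open_polygon n x | Some None => OmegaI alpha n x | Some (Some (i, b)) => tri_at b i x end.
apply: (@piecewise_lipschitz _ _ _ D) => //; first exact: u_cont.
- move=> z; have [hE|hE] := pselect (OmegaE n z); last first.
    by exists None => /= /(open_polygon_sub n3).
  have [hI|hI] := pselect (OmegaI alpha n z); first by exists (Some None).
  by have [i _ [h|h]] := ring_cover alpha01 n3 hE hI; [exists (Some (Some (i, true)))|exists (Some (Some (i, false)))].
- move=> [[[i b]|]|] {}x {}y /= hx hy.
  + rewrite (u_tri (ltn_ord i) hy hx) addrC addKr mxactM.
    have h : SO2 RE^T by have [h1 h2] := RE_SO2; split; rewrite ?trmxK ?det_tr//; exact: mulmx1C.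
    rewrite SO2_enorm//; apply: op_bound_turned_stretch => //.
    by case: (b); rewrite /sgn ?normrN normr1.
  + by rewrite !u_in// -rotB enorm_rot ler_peMl ?enorm_ge0.
  + by rewrite !u_out// ler_peMl ?enorm_ge0.
Qed.

Definition ring_copy k x : R * R := r ^+ k *: rot (k%:R * ga) (rot (k%:R * de) (u (unscale alpha n k x))).

(** The terms telescope: at a point of the ring of index [k] the terms of smaller
    index build up the rotation of angle [k * ga], those of larger index vanish,
    and the [k]-th one replaces this rotation by [ring_copy k].  In this form the
    map is visibly continuous. *)
Definition iterated x : R * R :=
  mxact RE (x + \sum_(0 <= k < (N_n alpha n).+1) (ring_copy k x - rot (k%:R * ga) x)).

Lemma ring_copy_out k x : ~ open_polygon n (unscale alpha n k x) -> ring_copy k x = rot (k%:R * ga) x.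
Proof. by move=> h; rewrite /ring_copy u_out// -rotZ unscaleVK. Qed.

Lemma ring_copy_in k x : filled alpha n k.+1 x -> ring_copy k x = rot (k.+1%:R * ga) x.
Proof.
move=> /(filledS alpha01 n3) h; rewrite /ring_copy u_in// [rot (k%:R * de) _]rotC -rotZ -rotZ unscaleVK// -rotD.
by rewrite -natr1; congr (rot _ x); ring.
Qed.

Lemma sum_telescope m x : \sum_(0 <= k < m) (rot (k.+1%:R * ga) x - rot (k%:R * ga) x) = rot (m%:R * ga) x - x.
Proof.
by rewrite (@telescope_sumr _ 0 m (fun k => rot (k%:R * ga) x))// mul0r rot0.
Qed.

Lemma iterated_ring k x : (k <= N_n alpha n)%N -> filled alpha n k x -> ~ filled alpha n k.+1 x -> iterated x = mxact RE (ring_copy k x).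
Proof.
move=> kN hk hk1; rewrite /iterated; congr mxact.
rewrite (big_cat_nat (n := k)) ?leqW//= (big_cat_nat (m := k) (n := k.+1))//= big_nat1.
have -> : \sum_(0 <= i < k) (ring_copy i x - rot (i%:R * ga) x) = rot (k%:R * ga) x - x.
  rewrite -sum_telescope; apply: eq_big_nat => j /andP[_ jk].
  by rewrite ring_copy_in//; apply: (filled_dec alpha01 n3 jk).
rewrite [X in _ + (_ + X)]big1_seq; last first.
  move=> j /= /[!mem_index_iota] /andP[kj _]; rewrite ring_copy_out ?subrr// => h.
  by apply: hk1; apply: (filled_dec alpha01 n3 kj); exact: open_polygon_sub.
by rewrite addr0 addrA [x + _]addrC subrK addrC subrK.
Qed.

Lemma iterated_out x : ~ open_polygon n x -> iterated x = mxact RE x.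
Proof.
move=> h; rewrite /iterated big1_seq ?addr0// => -[|j] _.
  by rewrite ring_copy_out ?subrr// unscale0.
rewrite ring_copy_out ?subrr// => hj; apply: h; apply: (OmegaI_int alpha01 n3).
rewrite -[x in OmegaI _ _ x](unscale0 alpha n); apply/(filledS alpha01 n3).
by apply: (@filled_dec _ _ _ alpha01 n3 1 j.+1) => //; exact: open_polygon_sub.
Qed.

Lemma iterated_in x : filled alpha n (N_n alpha n).+1 x -> iterated x = mxact RE (rot ((N_n alpha n).+1%:R * ga) x).
Proof.
move=> h; rewrite /iterated; congr mxact.
have -> : \sum_(0 <= i < (N_n alpha n).+1) (ring_copy i x - rot (i%:R * ga) x) = rot ((N_n alpha n).+1%:R * ga) x - x.
  rewrite -sum_telescope; apply: eq_big_nat => j /andP[_ jk].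
  by rewrite ring_copy_in//; apply: (filled_dec alpha01 n3 jk).
by rewrite addrC subrK.
Qed.

Lemma continuous_rot s : continuous (rot s : R * R -> R * R).
Proof.
have -> : rot s = mxact (rotation s) :> (R * R -> R * R) by apply/funext => x; rewrite mxact_rotation.
exact: continuous_mxact.
Qed.

Lemma continuous_ring_copy k : continuous (ring_copy k).
Proof.
move=> x; apply: (@continuous_comp _ _ _ (fun x => rot (k%:R * de) (u (unscale alpha n k x))) (fun y => r ^+ k *: rot (k%:R * ga) y)); last exact: continuous_sim.
apply: (continuous_comp (f := fun x => u (unscale alpha n k x))); last exact: continuous_rot.
by apply: continuous_comp; [exact: continuous_unscale|exact: u_cont].
Qed.

Lemma continuous_iterated : continuous iterated.
Proof.
have H m : continuous (fun x => \sum_(0 <= k < m) (ring_copy k x - rot (k%:R * ga) x)).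
  elim: m => [|m IH].
    rewrite (_ : (fun x => _) = (fun=> 0)); first by move=> x; exact: cvg_cst.
    by apply/funext => y; rewrite big_geq.
  rewrite (_ : (fun x => _) = (fun x => \sum_(0 <= k < m) (ring_copy k x - rot (k%:R * ga) x) + (ring_copy m x - rot (m%:R * ga) x))).
    by move=> x; apply: cvgD; [exact: IH|apply: cvgB; [exact: continuous_ring_copy|exact: continuous_rot]].
  by apply/funext => y; rewrite big_nat_recr.
move=> x; apply: (continuous_comp (f := fun x => x + \sum_(0 <= k < (N_n alpha n).+1) (ring_copy k x - rot (k%:R * ga) x))).
  by apply: cvgD; [exact: cvg_id|exact: H].
exact: continuous_mxact.
Qed.

Lemma ring_cases x : [\/ ~ filled alpha n 0 x, filled alpha n (N_n alpha n).+1 x |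
  exists2 k : 'I_(N_n alpha n).+1, filled alpha n k x & ~ filled alpha n k.+1 x].
Proof.
have [h0|h0] := pselect (filled alpha n 0 x); last by apply: Or31.
have [hN|hN] := pselect (filled alpha n (N_n alpha n).+1 x); first by apply: Or32.
apply: Or33; elim: (N_n alpha n) hN => [|m IH] hN; first by exists ord0.
have [hm|hm] := pselect (filled alpha n m.+1 x); first by exists ord_max.
have [k h1 h2] := IH hm.
by exists (widen_ord (leqnSn m.+1) k).
Qed.

Lemma v_sum_iterated x : v_domain alpha n x -> v_sum alpha n u RE x = iterated x.
Proof.
set N := N_n alpha n => hx.
have ind_core : ~ filled alpha n N.+1 x -> (\1_(core alpha n) x : R) = 0.
  by move=> h; rewrite indicE memNset// => /(core_sub alpha01 n3).
have ind_Sig0 k : ~ filled alpha n k x \/ filled alpha n k.+1 x -> (\1_(Sigma alpha n k) x : R) = 0.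
  by move=> h; rewrite indicE memNset// => /(Sigma_sub alpha01 n3)[h1 h2]; case: h.
case: hx => [[[k /= kN hS]|hO]|hC].
- have [h1 h2] := Sigma_sub alpha01 n3 hS.
  have nO : ~ outer alpha n x.
    case: k kN hS h1 h2 => [|k] kN hS h1 h2.
      move=> /outerE; apply; apply: hull_sub.
      move: hS; rewrite SigmaE => -[y hy <-]; by rewrite mul0r rot0 expr0 scale1r.
    by apply: (filled1_not_outer alpha01 n3); exact: (@filled_dec _ _ _ alpha01 n3 1 k.+1).
  rewrite /v_sum ind_core; last by move=> h; apply: h2; exact: (filled_dec alpha01 n3 (kN : (k.+1 <= N.+1)%N)).
  rewrite scale0r addr0 [\1_(outer _ _) x]indicE (memNset nO) scale0r addr0.
  rewrite (bigD1_seq k) ?mem_index_iota ?iota_uniq//= ?ltnS//.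
  rewrite big1_seq ?addr0; last first.
    move=> j /andP[/= jk _]; rewrite ind_Sig0 ?scale0r//.
    move: jk; rewrite neq_ltn => /orP[jk|kj]; [right|left => h; apply: h2].
      exact: (filled_dec alpha01 n3 jk).
    exact: (filled_dec alpha01 n3 kj).
  rewrite indicE mem_set// scale1r (iterated_ring kN h1 h2) /ring_copy mxactZ; congr (_ *: _).
  rewrite !mxactM /R_star /Qn !rotation_exp !mxact_rotation; congr (mxact _ (rot _ (rot _ (u _)))).
  by rewrite /unscale; congr (_ *: rot _ x); rewrite mulrN mulrN.
- rewrite /v_sum (iterated_out (outer_not_int alpha01 n3 hO)).
  have n1 : ~ filled alpha n 1 x by move=> /(filled1_not_outer alpha01 n3).
  rewrite ind_core; last by move=> h; apply: n1; exact: (@filled_dec _ _ _ alpha01 n3 1 N.+1).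
  rewrite scale0r addr0 indicE mem_set// scale1r big1_seq ?add0r// => -[|j] _.
    rewrite indicE memNset ?scale0r// => hS; move: hO => /outerE; apply; apply: hull_sub.
    move: hS; rewrite SigmaE => -[y hy <-]; by rewrite mul0r rot0 expr0 scale1r.
  rewrite ind_Sig0 ?scale0r//; left => h; apply: n1.
  exact: (@filled_dec _ _ _ alpha01 n3 1 j.+1).
- have hD := core_sub alpha01 n3 hC; rewrite /v_sum iterated_in//.
  rewrite [\1_(core _ _) x]indicE (mem_set hC) scale1r.
  rewrite [\1_(outer _ _) x]indicE memNset; last first.
    by apply: (filled1_not_outer alpha01 n3); exact: (@filled_dec _ _ _ alpha01 n3 1 N.+1).
  rewrite scale0r addr0 big1_seq ?add0r; last first.
    move=> j /= /[!mem_index_iota] /andP[_ jN]; rewrite ind_Sig0 ?scale0r//; right.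
    exact: (filled_dec alpha01 n3 jN).
  by rewrite mxactM /R_star rotation_exp mxact_rotation.
Qed.

(** The two maps agree on the domain of the sum, which is dense, and elsewhere the
    deformation is defined as a limit along this domain. *)
Lemma v_n_iterated x : v_n alpha n u RE x = iterated x.
Proof.
rewrite /v_n; case: ifPn => [/set_mem|/negP hx]; first exact: v_sum_iterated.
have PF : ProperFilter (within (v_domain alpha n) (nbhs x)).
  by apply: within_nbhs_proper; exact: dense_v_domain.
have cw : v_sum alpha n u RE @ within (v_domain alpha n) (nbhs x) --> iterated x.
  have E : {near within (v_domain alpha n) (nbhs x), iterated =1 v_sum alpha n u RE}.
    by rewrite near_withinE; apply: filterE => y hy; rewrite v_sum_iterated.
  apply: (cvg_trans (near_eq_cvg E)).
  by apply: cvg_within_filter; exact: continuous_iterated.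
apply: xget_unique => //= l hl.
exact: (cvg_unique _ hl cw).
Qed.

(** The scaling factor of a ring cancels, so that every copy of [u] has the
    Lipschitz constant of [u]. *)
Lemma iterated_lip x y : enorm (iterated x - iterated y) <= lip_bound alpha n * enorm (x - y).
Proof.
have L1 := lip_bound_ge1 alpha01 n3; have L0 := lip_bound_ge0 alpha01 n3.
pose D (k : option (option 'I_(N_n alpha n).+1)) x : Prop := match k with
  | None => ~ filled alpha n 0 x | Some None => filled alpha n (N_n alpha n).+1 x
  | Some (Some k) => filled alpha n k x /\ ~ filled alpha n k.+1 x end.
apply: (@piecewise_lipschitz _ _ _ D) => //; first exact: continuous_iterated.
- by move=> z; case: (ring_cases z) => [h|h|[k h1 h2]]; [exists None|exists (Some None)|exists (Some (Some k))].
- move=> [[k|]|] {}x {}y /=.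
  + move=> [x1 x2] [y1 y2]; rewrite !(iterated_ring (_ : (k <= N_n alpha n)%N))//; try by rewrite -ltnS.
    rewrite -mxactB (SO2_enorm _ RE_SO2) /ring_copy -scalerBr -!rotB enormZ !enorm_rot.
    rewrite (ger0_norm (ltW (rk_gt0 alpha01 n3 k))) mulrC -ler_pdivlMr ?rk_gt0// -mulrA -(enorm_unscale alpha01 n3) unscaleB.
    exact: u_lip.
  + by move=> hx hy; rewrite !iterated_in// -mxactB (SO2_enorm _ RE_SO2) -rotB enorm_rot ler_peMl ?enorm_ge0.
  + have h z : ~ filled alpha n 0 z -> ~ open_polygon n z by rewrite /filled /= unscale0 => h /(open_polygon_sub n3).
    by move=> /h hx /h hy; rewrite !iterated_out// -mxactB (SO2_enorm _ RE_SO2) ler_peMl ?enorm_ge0.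
Qed.

Lemma iterated0 : iterated 0 = 0.
Proof.
have rot00 s : rot s 0 = 0 :> R * R by apply: pair_ext; rewrite /rot /=; ring.
rewrite iterated_in; first by rewrite rot00; apply: pair_ext; rewrite /mxact /=; ring.
by rewrite /filled /= /unscale rot00 scaler0; exact: OmegaE0.
Qed.

Lemma ae_dot (z : R * R) (c : R) : z != 0 -> {ae lebesgue2, forall x : R * R, dotp x z != c}.
Proof.
move=> z0; have h : z.1 != 0 \/ z.2 != 0.
  have [z1|] := eqVneq z.1 0; last by left.
  by right; apply: contra z0 => /eqP z2; apply/eqP; exact: pair_ext.
apply: ae_mono (ae_line c h) => x; rewrite /dotp.
by rewrite [x.1 * _]mulrC [x.2 * _]mulrC.
Qed.

Lemma dot_unscale k x z : dotp (unscale alpha n k x) z = dotp x (r ^- k *: rot (k%:R * de) z).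
Proof. by rewrite /unscale dotpZl -(dot_rot (k%:R * de)) rotNK [RHS]dotC dotpZl [dotp (rot _ _) x]dotC. Qed.

Lemma ae_dot_unscale k (z : R * R) (c : R) : z != 0 -> {ae lebesgue2, forall x : R * R, dotp (unscale alpha n k x) z != c}.
Proof.
move=> z0; have h : r ^- k *: rot (k%:R * de) z != 0.
  apply: contra z0 => /eqP h; apply/eqP/enorm_eq0.
  have : enorm (r ^- k *: rot (k%:R * de) z) = 0 by rewrite h enorm0.
  rewrite enormZ enorm_rot => /eqP; rewrite mulf_eq0 => /orP[|/eqP//].
  by rewrite normr_eq0 invr_eq0 (negbTE (rk_neq0 alpha01 n3 k)).
by apply: ae_mono (ae_dot c h) => x; rewrite dot_unscale.
Qed.

Lemma ae_or3_unscale k (a b : R * R) : a != b -> {ae lebesgue2, forall x : R * R, or3 a b (unscale alpha n k x) != 0}.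
Proof.
move=> ab; pose z : R * R := (- (b - a).2, (b - a).1).
have z0 : z != 0.
  apply: contra ab => /eqP h; have h1 : - (b.2 - a.2) = 0 := congr1 fst h.
  have h2 : b.1 - a.1 = 0 := congr1 snd h.
  apply/eqP; apply: pair_ext; lra.
apply: ae_mono (ae_dot_unscale k (dotp a z) z0) => x; apply: contra => /eqP h; apply/eqP.
by move: h; rewrite /or3 /det2 /dotp /z !pairE /= => h; lra.
Qed.

Lemma ae_otri_unscale k (a b c : R * R) : 0 < or3 a b c ->
  {ae lebesgue2, forall x : R * R, ctri a b c (unscale alpha n k x) -> otri a b c (unscale alpha n k x)}.
Proof.
move=> D0.
have e (p q' : R * R) : or3 p p q' = 0 by rewrite /or3 /det2 !pairE; ring.
have e' (p q' : R * R) : or3 p q' p = 0 by rewrite /or3 /det2 !pairE; ring.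
have e'' (p q' : R * R) : or3 q' p p = 0 by rewrite /or3 /det2 !pairE; ring.
have ab : a != b by apply/eqP => h; move: D0; rewrite h e ltxx.
have bc : b != c by apply/eqP => h; move: D0; rewrite h e'' ltxx.
have ca : c != a by apply/eqP => h; move: D0; rewrite h e' ltxx.
have := ae_and (ae_or3_unscale k ab) (ae_and (ae_or3_unscale k bc) (ae_or3_unscale k ca)).
apply: ae_mono => x [h1 [h2 h3]] [k1 k2 k3].
by split; rewrite lt_neqAle eq_sym; apply/andP; split => //; [rewrite or3_rotl|rewrite -or3_rotl].
Qed.

Definition otri_at (b : bool) i x : Prop :=
  if b then otriO alpha n (th * i%:R) x else otriE alpha n (th * i%:R) x.

(** The excluded points lie on the countably many lines that carry the edges of
    the triangles of all rings. *)
Lemma ae_off_edges : {ae lebesgue2, forall x : R * R, (forall k, OmegaE n (unscale alpha n k x) -> open_polygon n (unscale alpha n k x)) /\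
  (forall k i, (tri_at true i (unscale alpha n k x) -> otri_at true i (unscale alpha n k x)) /\
    (tri_at false i (unscale alpha n k x) -> otri_at false i (unscale alpha n k x)))}.
Proof.
apply: ae_and; apply: ae_all_nat => k.
  have h : {ae lebesgue2, forall (x : R * R) i, dotp (unscale alpha n k x) (rv (th * (i%:R + 2^-1))) != apothem n}.
    apply: ae_all_nat => i; apply: ae_dot_unscale; apply/eqP => h.
    by have := enorm_rv (th * (i%:R + 2^-1)); rewrite h enorm0 => /eqP; rewrite eq_sym oner_eq0.
  apply: ae_mono h => x h; rewrite OmegaE_halfplanes// => hx i ni.
  by rewrite lt_neqAle h; exact: hx.
apply: ae_all_nat => i; apply: ae_and; apply: ae_otri_unscale.
  by rewrite or3_triO ABC_gt0.
by rewrite or3_triE SAB_gt0.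
Qed.

Definition affine_near (v : R * R -> R * R) x A : Prop := \forall y \near x, v y = v x + mxact A (y - x).

Lemma open_near (O : set (R * R)) x : open O -> O x -> \forall y \near x, O y.
Proof. by move=> oO Ox; exact: open_nbhs_nbhs. Qed.

Lemma affine_near_out x : ~ filled alpha n 0 x -> affine_near iterated x RE.
Proof.
move=> hx; have h z : ~ filled alpha n 0 z -> ~ open_polygon n z by rewrite /filled /= unscale0 => h /(open_polygon_sub n3).
have oD : open (~` filled alpha n 0) by apply: closed_openC; exact: closed_filled.
apply: filterS (open_near oD hx) => y hy; rewrite (iterated_out (h _ hx)) (iterated_out (h _ hy)).
by rewrite -mxactD addrC subrK.
Qed.

Lemma affine_near_in x : open_polygon n (unscale alpha n (N_n alpha n).+1 x) -> affine_near iterated x (RE *m rotation ((N_n alpha n).+1%:R * ga)).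
Proof.
move=> hx.
have hn : \forall y \near x, open_polygon n (unscale alpha n (N_n alpha n).+1 y).
  by apply: (@continuous_unscale _ alpha n (N_n alpha n).+1 x); exact: open_polygon_nbhs.
apply: filterS hn => y hy.
rewrite (iterated_in (open_polygon_sub n3 hx)) (iterated_in (open_polygon_sub n3 hy)) mxactM mxact_rotation.
by rewrite -mxactD -rotDl addrC subrK.
Qed.

(** [RE] commutes with rotations and cancels the [RE^T] in the gradient of [u].
    What is left is the accumulated rotation of the ring and the stretch, turned to
    the polar angle of the outer vertex of the triangle. *)
Lemma affine_near_ring k b i x : (k <= N_n alpha n)%N -> (i < n)%N -> open_polygon n (unscale alpha n k x) -> ~ filled alpha n k.+1 x ->
  otri_at b i (unscale alpha n k x) ->
  affine_near iterated x (rotation (k%:R * ga) *m rotation (th * i%:R + k%:R * de) *m stretch alpha n (sgn b) *m rotation (- (th * i%:R + k%:R * de))).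
Proof.
move=> kN ni hI hk1 hx.
have oD : open (~` filled alpha n k.+1) by apply: closed_openC; exact: closed_filled.
have hn : \forall y \near x, open_polygon n (unscale alpha n k y).
  by apply: (@continuous_unscale _ alpha n k x); exact: open_polygon_nbhs.
have ho : open (otri_at b i) by case: (b); exact: otri_open.
have ht : \forall y \near x, otri_at b i (unscale alpha n k y).
  by apply: (@continuous_unscale _ alpha n k x); exact: open_near.
have ot z : otri_at b i z -> tri_at b i z by case: (b); exact: otri_ctri.
near=> y.
have y1 : open_polygon n (unscale alpha n k y) by near: y.
have y2 : otri_at b i (unscale alpha n k y) by near: y.
have y3 : ~ filled alpha n k.+1 y by near: y; exact: open_near.
rewrite (iterated_ring kN (open_polygon_sub n3 hI) hk1) (iterated_ring kN (open_polygon_sub n3 y1) y3).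
rewrite /ring_copy (u_tri ni (ot _ hx) (ot _ y2)) -unscaleB !rotDl scalerDr [mxact RE (_ *: _ + _)]mxactD; congr (_ + _).
rewrite !mxactM !mxact_rotation.
set A := rot (theta n * i%:R) _.
have -> : rot (k%:R * de) (mxact RE^T A) = mxact RE^T (rot (k%:R * de) A).
  have h : SO2 RE^T by have [h1 h2] := RE_SO2; split; rewrite ?trmxK ?det_tr//; exact: mulmx1C.
  by rewrite -!mxact_rotation -!mxactM (SO2_comm_rotation _ h).
have -> : rot (k%:R * ga) (mxact RE^T (rot (k%:R * de) A)) = mxact RE^T (rot (k%:R * ga) (rot (k%:R * de) A)).
  have h : SO2 RE^T by have [h1 h2] := RE_SO2; split; rewrite ?trmxK ?det_tr//; exact: mulmx1C.
  by rewrite -!mxact_rotation -!mxactM (SO2_comm_rotation _ h).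
rewrite mxactZ -(mxactM RE); have [-> _] := RE_SO2; rewrite mxact1 /A.
rewrite /unscale rotZ mxactZ !rotZ scalerA divff ?rk_neq0// scale1r; congr (rot _ _).
rewrite -/th -/de -!rotD [k%:R * de + _]addrC; congr (rot _ (mxact _ (rot _ _))); by rewrite opprD.
Unshelve. all: by end_near. Qed.

Lemma ae_affine_near : {ae lebesgue2, forall x : R * R,
  [\/ ~ filled alpha n 0 x /\ affine_near iterated x RE,
      filled alpha n (N_n alpha n).+1 x /\ affine_near iterated x (RE *m rotation ((N_n alpha n).+1%:R * ga)) |
      exists k i b, [/\ (k <= N_n alpha n)%N && (i < n)%N, tri_at b i (unscale alpha n k x), filled alpha n k x, ~ filled alpha n k.+1 x &
        affine_near iterated x (rotation (k%:R * ga) *m rotation (th * i%:R + k%:R * de) *m stretch alpha n (sgn b) *m rotation (- (th * i%:R + k%:R * de)))]]}.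
Proof.
apply: ae_mono ae_off_edges => x [h1 h2].
case: (ring_cases x) => [h|h|[k hk hk1]].
- by apply: Or31; split => //; exact: affine_near_out.
- by apply: Or32; split => //; apply: affine_near_in; exact: h1.
- apply: Or33.
  have hI : ~ OmegaI alpha n (unscale alpha n k x) by move=> /(filledS alpha01 n3).
  have kN : (k <= N_n alpha n)%N by rewrite -ltnS.
  have [i _ [ht|ht]] := ring_cover alpha01 n3 hk hI.
    exists k, i, true; split => //; first (by rewrite kN /=); apply: affine_near_ring => //; first exact: h1.
    by have [h _] := h2 k i; exact: h.
  exists k, i, false; split => //; first (by rewrite kN /=); apply: affine_near_ring => //; first exact: h1.
  by have [_ h] := h2 k i; exact: h.
Qed.

End RingMap.

(** * Sobolev limits of Lipschitz maps *)

Section WeakLimit.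
Context {R : realType}.
Notation mR := (measurableTypeR R).
Implicit Types (f g psi phi : R * R -> R) (v : R * R -> R * R) (x y : R * R) (A : 'M[R]_2).

Lemma cvg_integral_cc (f_ : nat -> R * R -> R) f phi (M C : R) :
  (forall m, measurable_fun setT (f_ m : mR * mR -> mR)) ->
  measurable_fun setT (f : mR * mR -> mR) ->
  (forall m x, `|x| <= M -> `|f_ m x| <= C) -> continuous phi ->
  (forall x : R * R, M < `|x| -> phi x = 0) ->
  {ae lebesgue2, forall x, f_ ^~ x @ \oo --> f x} ->
  (fun m => \int[@lebesgue2 R]_x (f_ m x * phi x)%:E)%E @ \oo --> (\int[@lebesgue2 R]_x (f x * phi x)%:E)%E.
Proof.
move=> mf_ mf fC cphi phi0 cvf.
have := @dominated_convergence _ _ R (@lebesgue2 R) setT measurableT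
  (fun m x => (f_ m x * phi x)%:E) (fun x => (f x * phi x)%:E)
  (fun x => (C * `|phi x|)%:E).
have mphi := continuous_measurable2 cphi.
case=> //.
- by move=> m; apply/measurable_EFinP; apply: measurable_funM => //; exact: mf_.
- by apply/measurable_EFinP; apply: measurable_funM.
- apply: ae_mono cvf => x cx _; apply: cvg_EFin; first by near=> n.
  by apply: cvgM => //; exact: cvg_cst.
- apply: (@integrable_cc _ (fun x => C * `|phi x|) M).
    apply: (contM (@contC _ _)) => x.
    by apply: (@continuous_comp _ _ _ phi Num.norm); [exact: cphi|exact: norm_continuous].
  by move=> x /phi0 ->; rewrite normr0 mulr0.
- apply: aeW => x m _; rewrite /= lee_fin normrM.
  have [xM|/phi0 ->] := leP `|x| M; last by rewrite normr0 !mulr0.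
  by rewrite ler_wpM2r// fC.
Unshelve. all: by end_near. Qed.

(** Against a fixed test function both integrals converge by dominated
    convergence. *)
Theorem weak_partial_limit (j : 'I_2) (f_ g_ : nat -> R * R -> R) f g :
  (forall m, measurable_fun setT (f_ m : mR * mR -> mR)) ->
  measurable_fun setT (f : mR * mR -> mR) ->
  (forall m, measurable_fun setT (g_ m : mR * mR -> mR)) ->
  measurable_fun setT (g : mR * mR -> mR) ->
  (forall M : R, exists C : R, forall m x, `|x| <= M -> `|f_ m x| <= C /\ `|g_ m x| <= C) ->
  {ae lebesgue2, forall x, f_ ^~ x @ \oo --> f x} ->
  {ae lebesgue2, forall x, g_ ^~ x @ \oo --> g x} ->
  (forall m, weak_partial j (f_ m) (g_ m)) -> weak_partial j f g.
Proof.
move=> mf_ mf mg_ mg bd cf cg wp psi tpsi; have [psiS [K [cK K0]]] := tpsi.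
set Dp := 'D_(basis j) psi.
have [cpsi dpsi] := psiS [::]; have [cD _] := psiS [:: (basis j : R * R)].
rewrite /= in cpsi dpsi cD.
have [M psi0] : exists M : R, forall y : R * R, M < `|y| -> psi y = 0.
  have /compact_bounded [M [_ hM]] := cK.
  exists (M + 1) => y My; apply: K0 => Ky.
  have := hM (M + 1); rewrite ltrDl => /(_ ltr01 y Ky) /=.
  by move: My; case: ltgtP.
have D0 y : M < `|y| -> Dp y = 0 by exact: derive_eq0_out.
have [C hC] := bd M.
have h1 := cvg_integral_cc mf_ mf (fun m x xM => (hC m x xM).1) cD D0 cf.
have h2 := cvg_integral_cc mg_ mg (fun m x xM => (hC m x xM).2) cpsi psi0 cg.
have h3 : (fun m => - \int[@lebesgue2 R]_x (g_ m x * psi x)%:E)%E @ \oo --> (- \int[@lebesgue2 R]_x (g x * psi x)%:E)%E.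
  exact: cvgeN.
have E : (fun m => \int[@lebesgue2 R]_x (f_ m x * Dp x)%:E)%E =
    (fun m => - \int[@lebesgue2 R]_x (g_ m x * psi x)%:E)%E.
  by apply/funext => m; exact: wp.
rewrite -/Dp E in h1.
by rewrite -(cvg_lim (@ereal_hausdorff R) h1) (cvg_lim (@ereal_hausdorff R) h3).
Qed.

Lemma coord_lip v (L : R) : 0 <= L -> (forall x y, enorm (v x - v y) <= L * enorm (x - y)) ->
  forall i x y, `|coord i (v x) - coord i (v y)| <= (L * 2) * `|x - y|.
Proof.
move=> L0 hv i x y; have [h1 h2] := coord_le_enorm (v x - v y).
apply: (@le_trans _ _ (enorm (v x - v y))); first by case: (ord2 i) => ->.
by apply: le_trans (hv x y) _; rewrite -mulrA ler_wpM2l// enorm_le_norm.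
Qed.

Lemma limn_supE_cvg (a : nat -> R) (l : R) : a @ \oo --> l -> limn_sup (a : (R^o)^nat) = l.
Proof. by move=> ca; rewrite cvg_limn_supE; [exact: (cvg_lim _ ca)|apply/cvg_ex; exists l]. Qed.

(** The limit and its gradient are defined as limits superior, which makes them
    measurable and locally bounded.  The weak formulation passes to the limit, so
    that the limit map need not be differentiated. *)
Theorem W1loc_limit (w_ : nat -> R * R -> R * R) (L : R) : 0 <= L ->
  (forall m x y, enorm (w_ m x - w_ m y) <= L * enorm (x - y)) -> (forall m, w_ m 0 = 0) ->
  {ae lebesgue2, forall x m, exists A, \forall y \near x, w_ m y = w_ m x + mxact A (y - x)} ->
  {ae lebesgue2, forall x, exists l : R * R, forall i, (fun m => coord i (w_ m x)) @ \oo --> coord i l} ->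
  {ae lebesgue2, forall x, exists A, forall i j, (fun m => lgrad (w_ m) x i j) @ \oo --> A i j} ->
  exists (v : R * R -> R * R) (G : R * R -> 'M[R]_2),
    [/\ W1loc +oo%E v G, (forall p : R, 1 <= p -> W1loc_cvg p%:E w_ v) &
      {ae lebesgue2, forall x, forall i j, (fun m => lgrad (w_ m) x i j) @ \oo --> G x i j}].
Proof.
move=> L0 wL w0 waff wcvg gcvg.
have wc m := coord_lip L0 (wL m).
have wb m i x : `|coord i (w_ m x)| <= (L * 2) * `|x|.
  have := wc m i x 0; rewrite w0 subr0.
  by rewrite [coord i 0](_ : _ = 0) ?subr0//; case: (ord2 i) => ->.
pose fv i x : R := limn_sup ((fun m => coord i (w_ m x)) : (R^o)^nat).
pose v x : R * R := (fv ord0 x, fv ord_max x).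
pose G x : 'M[R]_2 := \matrix_(i, j) limn_sup ((fun m => lgrad (w_ m) x i j) : (R^o)^nat).
have vertE i : coord i \o v = fv i by apply/funext => x; case: (ord2 i) => ->.
have cw m i : continuous (coord i \o w_ m) := dominated_lipschitz_continuous (wc m i).
have mw m i : measurable_fun setT (coord i \o w_ m : mR * mR -> mR).
  exact: continuous_measurable2.
have mg m i j := @measurable_lgrad _ _ _ i j (wc m).
have gb m i j x : `|lgrad (w_ m) x i j| <= L * 2 by exact: lgrad_bound.
have mv i : measurable_fun setT (fv i : mR * mR -> mR).
  apply: measurable_fun_limn_sup => //.
  - by move=> x _; exists ((L * 2) * `|x|) => _ [m _ <-]; apply: le_trans (ler_norm _) (wb m i x).
  - by move=> x _; exists (- ((L * 2) * `|x|)) => _ [m _ <-]; have := wb m i x; rewrite ler_norml => /andP[].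
  - by move=> m; exact: mw.
have mG i j : measurable_fun setT ((fun x => G x i j) : mR * mR -> mR).
  under eq_fun do rewrite /G mxE.
  apply: measurable_fun_limn_sup => //.
  - by move=> x _; exists (L * 2) => _ [m _ <-]; apply: le_trans (ler_norm _) (gb m i j x).
  - by move=> x _; exists (- (L * 2)) => _ [m _ <-]; have := gb m i j x; rewrite ler_norml => /andP[].
  - by move=> m; exact: mg.
have vb i x : `|fv i x| <= (L * 2) * `|x| by apply: limn_sup_bound => m; exact: wb.
have Gb i j x : `|G x i j| <= L * 2 by rewrite /G mxE; apply: limn_sup_bound => m; exact: gb.
have vcvg : {ae lebesgue2, forall x, forall i, (fun m => coord i (w_ m x)) @ \oo --> fv i x}.
  by apply: ae_mono wcvg => x [l hl] i; rewrite /fv (limn_supE_cvg (hl i)).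
have Gcvg : {ae lebesgue2, forall x, forall i j, (fun m => lgrad (w_ m) x i j) @ \oo --> G x i j}.
  by apply: ae_mono gcvg => x [A hA] i j; rewrite /G mxE (limn_supE_cvg (hA i j)).
have wW m p : (0 < p)%E -> W1loc p (w_ m) (lgrad (w_ m)).
  move=> p0; apply: (W1loc_lipschitz p0 (wc m)).
  apply: ae_mono waff => x /(_ m) [A hA] i j; apply/cvg_ex; exists (A i j).
  exact: dquot_cvg_affine.
have Kb (K : set (R * R)) : compact K -> exists2 C : R, 0 <= C & forall x, K x -> `|x| <= C.
  move=> /compact_bounded [C [_ hC]]; exists (`|C| + 1); first by rewrite addr_ge0.
  by move=> x Kx; apply: hC => //; rewrite ltr_pwDr// ler_norm.
have vW p : (0 < p)%E -> W1loc p v G.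
  move=> p0; split.
  + move=> i; rewrite vertE; apply: Lloc_bounded => // K /Kb[C C0 hC].
    by exists ((L * 2) * C) => x /hC xC; apply: le_trans (vb i x) _; rewrite ler_wpM2l// mulr_ge0.
  + by move=> i j; apply: Lloc_bounded => // K _; exists (L * 2).
  + move=> i j; rewrite vertE.
    apply: (@weak_partial_limit j (fun m => coord i \o w_ m) (fun m x => lgrad (w_ m) x i j)) => //.
    * move=> M; exists (Num.max ((L * 2) * M) (L * 2)) => m x xM; rewrite !le_max gb orbT; split => //.
      by rewrite (le_trans (wb m i x))// ler_wpM2l// mulr_ge0.
    * by apply: ae_mono vcvg => x h; exact: (h i).
    * by apply: ae_mono Gcvg => x h; exact: (h i j).
    * by move=> m; have [_ _] := wW m p p0; exact.
exists v, G; split => //; first exact: vW.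
move=> p p1; have p0 : (0 < p%:E)%E by rewrite lte_fin; lra.
exists (fun m => lgrad (w_ m)), G; split.
  + by move=> m; exact: wW.
  + exact: vW.
  + move=> i; rewrite vertE; apply: Lloc_cvg_dominated => //.
    * move=> K /Kb[C C0 hC]; exists ((L * 2) * C) => x /hC xC.
      split; first by apply: le_trans (vb i x) _; rewrite ler_wpM2l// mulr_ge0.
      by move=> m; apply: le_trans (wb m i x) _; rewrite ler_wpM2l// mulr_ge0.
    * by apply: ae_mono vcvg => x h; exact: (h i).
  + move=> i j; apply: Lloc_cvg_dominated => //.
    * by move=> K _; exists (L * 2).
    * by apply: ae_mono Gcvg => x h; exact: (h i j).
Qed.

End WeakLimit.

(** * Asymptotics for many sides *)

Section Asymptotics.
Context {R : realType}.
Variable alpha : R.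
Hypothesis alpha01 : 0 < alpha < 1.
Let th (m : nat) : R := theta m.+3.
Let r (m : nat) : R := r_I alpha m.+3.
Let s : R := Num.sqrt (alpha * (1 - alpha)).
Let n3 (m : nat) : (3 <= m.+3)%N := isT.
Let a0 : 0 < alpha := alpha_gt0 alpha01.
Let a1 : alpha < 1 := alpha_lt1 alpha01.
Let b0 : 0 < 1 - alpha. Proof. by rewrite subr_gt0. Qed.

Lemma s_gt0 : 0 < s. Proof. by rewrite sqrtr_gt0 mulr_gt0. Qed.
Lemma s_sqr : s ^+ 2 = alpha * (1 - alpha). Proof. by rewrite sqr_sqrtr// mulr_ge0// ltW. Qed.

Lemma seq_derive (f : R -> R) (a d : R) (h : nat -> R) : is_derive a (1 : R) f d ->
  h @ \oo --> (0 : R) -> (forall m, h m != 0) -> (fun m => (f (a + h m) - f a) / h m) @ \oo --> d.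
Proof.
move=> [df <-] ch hN.
have c0 : h @ \oo --> (0 : R)^'.
  move=> A A0; have {}A0 : nbhs (0 : R) [set y | y != 0 -> A y] := A0.
  apply: (@filterS _ (nbhs \oo) _ (fun m => h m != 0 -> A (h m)) _ _ (ch _ A0)).
  by move=> m; apply.
have := cvg_comp _ _ c0 df; rewrite -/(derive f a 1).
rewrite [X in X @ _ --> _](_ : _ = (fun m => (f (a + h m) - f a) / h m))//.
apply/funext => m /=; rewrite /GRing.scale /= mulr1 [h m + a]addrC mulrC; exact: erefl.
Qed.

Lemma th_pos m : 0 < th m. Proof. exact: theta_gt0. Qed.
Lemma th_neq0 m : th m != 0. Proof. by rewrite gt_eqF// th_pos. Qed.

Lemma cvg_th : th @ \oo --> (0 : R).
Proof.
have c : (fun m => 2 * pi * m.+1%:R^-1) @ \oo --> (0 : R).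
  rewrite -[X in _ --> X](mulr0 (2 * pi)); apply: cvgM; [exact: cvg_cst|exact: cvg_natSinv].
apply: (@squeeze_cvgr _ _ _ _ (fun=> 0) (fun m => 2 * pi * m.+1%:R^-1)) => //; last exact: cvg_cst.
near=> m; rewrite (ltW (th_pos m))/= /th /theta ler_wpM2l ?mulr_ge0 ?pi_ge0//.
by rewrite lef_pV2 ?posrE ?ltr0n// ler_nat; apply: leqW; exact: leqnSn.
Unshelve. all: by end_near. Qed.

Lemma cvg_quot (f : R -> R) (d x : R) : is_derive (0 : R) (1 : R) f d ->
  (fun m => (f (th m * x) - f 0) / th m) @ \oo --> d * x.
Proof.
move=> df; have [->|x0] := eqVneq x 0.
  rewrite mulr0 (_ : (fun m => _) = (fun=> 0)); first exact: cvg_cst.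
  by apply/funext => m; rewrite mulr0 subrr mul0r.
have ch : (fun m => th m * x) @ \oo --> (0 : R).
  by rewrite -[X in _ --> X](mul0r x); apply: cvgM; [exact: cvg_th|exact: cvg_cst].
have hN m : th m * x != 0 by rewrite mulf_neq0// th_neq0.
have := seq_derive df ch hN => c.
rewrite (_ : (fun m => _) = (fun m => (f (0 + th m * x) - f 0) / (th m * x) * x)).
  by apply: cvgM => //; exact: cvg_cst.
apply/funext => m; rewrite add0r; field; by rewrite x0 th_neq0.
Qed.

Lemma sin_quot x : (fun m => sin (th m * x) / th m) @ \oo --> x.
Proof.
have := @cvg_quot _ _ x (is_derive_sin 0); rewrite cos0 mul1r.
by under eq_fun do rewrite sin0 subr0.
Qed.

Lemma cos_quot x : (fun m => (cos (th m * x) - 1) / th m) @ \oo --> (0 : R).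
Proof.
have := @cvg_quot _ _ x (is_derive_cos 0); rewrite sin0 oppr0 mul0r.
by under eq_fun do rewrite cos0.
Qed.

Lemma cvg_thx x : (fun m => th m * x) @ \oo --> (0 : R).
Proof. by rewrite -[X in _ --> X](mul0r x); apply: cvgM; [exact: cvg_th|exact: cvg_cst]. Qed.

Lemma cvg_cos (u : nat -> R) l : u @ \oo --> l -> (fun m => cos (u m)) @ \oo --> cos l.
Proof. by move=> h; apply: (cvg_comp _ _ h); exact: continuous_cos. Qed.

Lemma cvg_sin (u : nat -> R) l : u @ \oo --> l -> (fun m => sin (u m)) @ \oo --> sin l.
Proof. by move=> h; apply: (cvg_comp _ _ h); exact: continuous_sin. Qed.

Lemma cvg_sqrt (u : nat -> R) l : u @ \oo --> l -> (fun m => Num.sqrt (u m)) @ \oo --> Num.sqrt l.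
Proof. by move=> h; apply: (cvg_comp _ _ h); exact: sqrt_continuous. Qed.

Lemma cos_th x : (fun m => cos (th m * x)) @ \oo --> (1 : R).
Proof. by rewrite -(@cos0 R); apply: cvg_cos; exact: cvg_thx. Qed.

Lemma sin_th x : (fun m => sin (th m * x)) @ \oo --> (0 : R).
Proof. by rewrite -(@sin0 R); apply: cvg_sin; exact: cvg_thx. Qed.

Lemma cvg_an : (fun m => a_n alpha m.+3) @ \oo --> a_lim alpha.
Proof.
apply: cvg_sqrt.
rewrite (_ : (fun m => _) = (fun m => (sin (th m * (1 - alpha)) / th m) * (sin (th m * alpha) / th m)^-1)).
  by apply: cvgM; [exact: sin_quot|apply: cvgV; [rewrite gt_eqF|exact: sin_quot]].
apply/funext => m; have s0 := sin_al alpha01 (n3 m).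
rewrite -/(th m) in s0 *; field; by rewrite th_neq0 gt_eqF.
Qed.

Lemma cvg_apothem : (fun m => apothem m.+3 : R) @ \oo --> (1 : R).
Proof. exact: cos_th. Qed.

Lemma cvg_sin_mean : (fun m => sin_mean alpha m.+3 / th m) @ \oo --> s.
Proof.
rewrite (_ : (fun m => _) = (fun m => Num.sqrt ((sin (th m * alpha) / th m) * (sin (th m * (1 - alpha)) / th m)))).
  by apply: cvg_sqrt; apply: cvgM; exact: sin_quot.
apply/funext => m; have t0 := th_pos m.
have -> : sin_mean alpha m.+3 = Num.sqrt (th m ^+ 2 * (sin (th m * alpha) / th m * (sin (th m * (1 - alpha)) / th m))).
  by rewrite /sin_mean -/(th m); congr Num.sqrt; field; exact: th_neq0.
by rewrite sqrtrM ?sqr_ge0// sqrtr_sqr gtr0_norm// mulrC mulKf// th_neq0.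
Qed.

(** The cosines in the inner radius are 1 up to second order in theta, so only the
    geometric mean of the two sines contributes to first order. *)
Lemma cvg_1r : (fun m => (1 - r m) / th m) @ \oo --> s.
Proof.
rewrite (_ : (fun m => _) = (fun m => ((cos (th m * 2^-1) - 1) / th m - (cos (th m * ((1 - 2 * alpha) / 2)) - 1) / th m + sin_mean alpha m.+3 / th m) * (apothem m.+3)^-1)).
  have -> : s = (0 - 0 + s) * 1^-1 by rewrite invr1 subrr add0r mulr1.
  apply: cvgM; last first.
    by apply: cvgV; [exact: oner_neq0|exact: cvg_apothem].
  by apply: cvgD; [apply: cvgB; exact: cos_quot|exact: cvg_sin_mean].
apply/funext => m; rewrite /r (r_IE alpha (n3 m)) /cn -/(th m).
have -> : th m / 2 * (1 - 2 * alpha) = th m * ((1 - 2 * alpha) / 2) by field.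
have q0 := @apothem_gt0 R m.+3 (n3 m); move: q0; rewrite /apothem -/(th m) => q0.
move: (cos (th m * ((1 - 2 * alpha) / 2))) (sin_mean alpha m.+3) => c w.
by move: (cos (th m / 2)) q0 => q q0; field; rewrite th_neq0 gt_eqF.
Qed.

Lemma cvg_r : r @ \oo --> (1 : R).
Proof.
rewrite (_ : r = (fun m => 1 - th m * ((1 - r m) / th m))).
  rewrite -[X in _ --> X]subr0 -[X in _ --> _ - X](mul0r s).
  by apply: cvgB; [exact: cvg_cst|apply: cvgM; [exact: cvg_th|exact: cvg_1r]].
by apply/funext => m; rewrite mulrC divfK ?th_neq0// subKr.
Qed.

Lemma r_pos m : 0 < r m. Proof. exact: r_gt0. Qed.
Lemma r_lt m : r m < 1. Proof. exact: r_lt1. Qed.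

Lemma cvg_lnr : (fun m => ln (r m) / th m) @ \oo --> - s.
Proof.
have d1 : is_derive (1 : R) (1 : R) (@ln R) 1.
  by have := is_derive1_ln (@ltr01 R); rewrite invr1.
have ch : (fun m => r m - 1) @ \oo --> (0 : R).
  by rewrite -[X in _ --> X](subrr 1); apply: cvgB; [exact: cvg_r|exact: cvg_cst].
have hN m : r m - 1 != 0 by rewrite subr_eq0 lt_eqF// r_lt.
have c := seq_derive d1 ch hN.
rewrite (_ : (fun m => _) = (fun m => (ln (1 + (r m - 1)) - ln 1) / (r m - 1) * - ((1 - r m) / th m))).
  by rewrite -[X in _ --> X]mul1r; apply: cvgM => //; apply: cvgN; exact: cvg_1r.
apply/funext => m; rewrite ln1 subr0 addrC subrK; have := hN m; have := th_neq0 m.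
move=> t0' x0'; field; by rewrite x0' t0'.
Qed.

Lemma lnr_lt0 m : ln (r m) < 0. Proof. by rewrite ln_lt0// r_pos r_lt. Qed.

(** The origin of the logarithm: [k m * ln (r m)] tends to [ln rho], and theta is
    asymptotic to [- ln (r m) / s]. *)
Lemma cvg_angle (k : nat -> nat) (rho : R) : 0 < rho -> (fun m => r m ^+ k m) @ \oo --> rho ->
  (fun m => (k m)%:R * (th m * (1 - 2 * alpha))) @ \oo --> rho0 alpha * ln rho.
Proof.
move=> rho0_ ck.
have cl : (fun m => ln (r m ^+ k m)) @ \oo --> ln rho by apply: (cvg_comp _ _ ck); exact: continuous_ln.
rewrite (_ : (fun m => _) = (fun m => ln (r m ^+ k m) * (ln (r m) / th m)^-1 * (1 - 2 * alpha))).
  have -> : rho0 alpha * ln rho = ln rho * (- s)^-1 * (1 - 2 * alpha).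
    by rewrite /rho0 -/s; field; rewrite gt_eqF// s_gt0.
  apply: cvgM; last exact: cvg_cst.
  apply: cvgM => //; apply: cvgV; last exact: cvg_lnr.
  by rewrite oppr_eq0 gt_eqF// s_gt0.
apply/funext => m; rewrite lnXn ?r_pos// -mulr_natl.
have L0 := lnr_lt0 m; have t0 := th_neq0 m; field.
by rewrite t0 lt_eqF.
Qed.

Lemma sqrt_alpha : Num.sqrt alpha * Num.sqrt alpha = alpha.
Proof. by rewrite -expr2 sqr_sqrtr// ltW. Qed.
Lemma sqrt_alpha' : Num.sqrt (1 - alpha) * Num.sqrt (1 - alpha) = 1 - alpha.
Proof. by rewrite -expr2 sqr_sqrtr// ltW. Qed.
Lemma sqrt_alpha_gt0 : 0 < Num.sqrt alpha. Proof. by rewrite sqrtr_gt0. Qed.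
Lemma sqrt_alpha'_gt0 : 0 < Num.sqrt (1 - alpha). Proof. by rewrite sqrtr_gt0. Qed.
Lemma sE : s = Num.sqrt alpha * Num.sqrt (1 - alpha). Proof. by rewrite /s sqrtrM// ltW. Qed.

(** Divided by theta, the first edge of the first triangle tends to (- s, alpha),
    which has the direction of - ebar11; tensor squares do not see this sign. *)
Lemma cvg_e11 i : (fun m => coord i (e11 alpha m.+3)) @ \oo --> - coord i (ebar11 alpha).
Proof.
pose d m : R * R := I_pt alpha m.+3 1 - E_pt m.+3 1.
have dE m : d m = (r m * cos (th m * alpha) - 1, r m * sin (th m * alpha)).
  rewrite /d I_ptE E_ptE /vertE mulr0 (_ : (1%:R : R) - 1 + alpha = alpha); last by ring.
  by apply: pair_ext; rewrite !pairE /rv /= ?cos0 ?sin0 ?subr0.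
have c1 : (fun m => (d m).1 / th m) @ \oo --> - s.
  rewrite (_ : (fun m => _) = (fun m => r m * ((cos (th m * alpha) - 1) / th m) - (1 - r m) / th m)).
    rewrite -[X in _ --> X]add0r -[X in _ --> X + _](mulr0 1); apply: cvgB; last exact: cvg_1r.
    by apply: cvgM; [exact: cvg_r|exact: cos_quot].
  by apply/funext => m; rewrite dE /=; field; exact: th_neq0.
have c2 : (fun m => (d m).2 / th m) @ \oo --> alpha.
  rewrite (_ : (fun m => _) = (fun m => r m * (sin (th m * alpha) / th m))).
    by rewrite -[X in _ --> X]mul1r; apply: cvgM; [exact: cvg_r|exact: sin_quot].
  by apply/funext => m; rewrite dE /= mulrA.
have cN : (fun m => enorm (d m) / th m) @ \oo --> Num.sqrt alpha.
  rewrite (_ : (fun m => _) = (fun m => Num.sqrt (((d m).1 / th m) ^+ 2 + ((d m).2 / th m) ^+ 2))).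
    have -> : Num.sqrt alpha = Num.sqrt ((- s) ^+ 2 + alpha ^+ 2).
      by rewrite sqrrN s_sqr; congr Num.sqrt; ring.
    by apply: cvg_sqrt; apply: cvgD; apply: cvgM.
  apply/funext => m; rewrite /enorm.
  have -> : ((d m).1 / th m) ^+ 2 + ((d m).2 / th m) ^+ 2 = (th m)^-1 ^+ 2 * ((d m).1 ^+ 2 + (d m).2 ^+ 2) by ring.
  by rewrite sqrtrM ?sqr_ge0// sqrtr_sqr ger0_norm ?invr_ge0 ?ltW ?th_pos// mulrC.
have sN : Num.sqrt alpha != 0 by rewrite gt_eqF// sqrt_alpha_gt0.
have dN m : enorm (d m) != 0.
  apply/negP => /eqP h; have := enorm_e11 alpha01 (n3 m).
  by rewrite /e11 -/(d m) h invr0 scale0r enorm0 => /eqP; rewrite eq_sym oner_eq0.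
have cV : (fun m => (enorm (d m) / th m)^-1) @ \oo --> (Num.sqrt alpha)^-1 by exact: cvgV.
case: (ord2 i) => ->; rewrite /coord /= /ebar11 /=.
  rewrite (_ : (fun m => _) = (fun m => (d m).1 / th m * (enorm (d m) / th m)^-1)).
    have -> : - Num.sqrt (1 - alpha) = - s * (Num.sqrt alpha)^-1 by rewrite sE; field.
    exact: (cvgM c1 cV).
  by apply/funext => m; rewrite -[LHS]/((enorm (d m))^-1 * (d m).1); field; rewrite dN th_neq0.
rewrite (_ : (fun m => _) = (fun m => (d m).2 / th m * (enorm (d m) / th m)^-1)).
  have -> : - - Num.sqrt alpha = alpha * (Num.sqrt alpha)^-1 by rewrite opprK -[X in X / _]sqrt_alpha; field.
  exact: (cvgM c2 cV).
by apply/funext => m; rewrite -[LHS]/((enorm (d m))^-1 * (d m).2); field; rewrite dN th_neq0.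
Qed.

Lemma cvg_perp_e11 i : (fun m => coord i (perp (e11 alpha m.+3))) @ \oo --> - coord i (perp (ebar11 alpha)).
Proof.
have c1 := @cvg_e11 ord0; have c2 := @cvg_e11 ord_max.
case: (ord2 i) => ->.
  under eq_fun do rewrite perpE; rewrite perpE /coord /=.
  by move: c2; rewrite /coord /= => c2; apply: cvgN.
by under eq_fun do rewrite perpE; rewrite perpE.
Qed.

Lemma cvg_shear : (fun m => shear alpha m.+3) @ \oo --> (0 : R).
Proof.
have aN : a_lim alpha != 0 by rewrite gt_eqF// sqrtr_gt0 divr_gt0.
rewrite (_ : (fun m => _) = (fun m => ((a_n alpha m.+3)^-1 - a_n alpha m.+3) * (sin (th m * 2^-1) * (cos (th m * 2^-1))^-1))).
  rewrite -[X in _ --> X](mulr0 ((a_lim alpha)^-1 - a_lim alpha)); apply: cvgM.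
    by apply: cvgB; [apply: cvgV => //; exact: cvg_an|exact: cvg_an].
  rewrite -[X in _ --> X](mul0r 1^-1); apply: cvgM; first exact: sin_th.
  by apply: cvgV; [exact: oner_neq0|exact: cos_th].
apply/funext => m; rewrite /shear; congr (_ * _).
have -> : phi m.+3 = pi / 2 - th m * 2^-1 :> R.
  rewrite /phi /th /theta; have : (m.+3%:R : R) != 0 by rewrite pnatr_eq0.
  by move: (m.+3%:R) => N N0; field.
rewrite /tan sinB cosB sin_pihalf cos_pihalf !mul0r mul1r add0r mul1r subr0 invf_div//.
Qed.

Definition stretch_lim : 'M[R]_2 := a_lim alpha *: tensor (ebar11 alpha) (ebar11 alpha)
   + (a_lim alpha)^-1 *: tensor (perp (ebar11 alpha)) (perp (ebar11 alpha)).

Definition mxcvg (A_ : nat -> 'M[R]_2) (A : 'M[R]_2) : Prop :=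
  forall i j, (fun m => A_ m i j) @ \oo --> A i j.

Lemma mxcvgM A_ B_ A B : mxcvg A_ A -> mxcvg B_ B -> mxcvg (fun m => A_ m *m B_ m) (A *m B).
Proof.
move=> cA cB i j; rewrite mulmx2E; under eq_fun do rewrite mulmx2E.
by apply: cvgD; apply: cvgM.
Qed.

Lemma mxcvg_rotation (t : nat -> R) l : t @ \oo --> l -> mxcvg (fun m => rotation (t m)) (rotation l).
Proof.
move=> ct i j; have cc := cvg_cos ct; have cs := cvg_sin ct.
rewrite mxE; under eq_fun do rewrite mxE.
by case: (i == j) => //; case: (i == ord0) => //; exact: cvgN.
Qed.

Lemma mxcvg_stretch (b : nat -> bool) : mxcvg (fun m => stretch alpha m.+3 (sgn (b m))) stretch_lim.
Proof.
have aN : a_lim alpha != 0 by rewrite gt_eqF// sqrtr_gt0 divr_gt0.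
move=> i j; have e := cvg_e11; have p := cvg_perp_e11.
have -> : stretch_lim i j = a_lim alpha * (coord i (ebar11 alpha) * coord j (ebar11 alpha)) +
    (a_lim alpha)^-1 * (coord i (perp (ebar11 alpha)) * coord j (perp (ebar11 alpha))) + 0.
  by rewrite /stretch_lim !mxE addr0.
rewrite (_ : (fun m => _) = (fun m => a_n alpha m.+3 * (coord i (e11 alpha m.+3) * coord j (e11 alpha m.+3)) +
    (a_n alpha m.+3)^-1 * (coord i (perp (e11 alpha m.+3)) * coord j (perp (e11 alpha m.+3))) +
    sgn (b m) * shear alpha m.+3 * (coord i (e11 alpha m.+3) * coord j (perp (e11 alpha m.+3))))); last first.
  by apply/funext => m; rewrite !mxE.
apply: cvgD; first apply: cvgD.
- apply: cvgM; first exact: cvg_an.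
  by rewrite -mulrNN; apply: cvgM; exact: e.
- apply: cvgM; first by apply: cvgV => //; exact: cvg_an.
  by rewrite -mulrNN; apply: cvgM; exact: p.
- rewrite -[X in _ --> X](mul0r (- coord i (ebar11 alpha) * - coord j (perp (ebar11 alpha)))).
  apply: cvgM; last by apply: cvgM; [exact: e|exact: p].
  have ck : (fun m => `|shear alpha m.+3|) @ \oo --> (0 : R).
    by rewrite -[X in _ --> X](@normr0 _ R); apply: (cvg_comp _ _ cvg_shear); exact: norm_continuous.
  have ck' : (fun m => - `|shear alpha m.+3|) @ \oo --> (0 : R) by rewrite -oppr0; apply: cvgN.
  apply: (squeeze_cvgr _ ck' ck); apply: filterE => m.
  rewrite -ler_norml /sgn; case: (b m); by rewrite ?mulN1r ?normrN ?mul1r.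
Qed.

Lemma N_nP m : r m ^+ N_n alpha m.+3 <= 1 / 2 /\ forall k, r m ^+ k <= 1 / 2 -> (N_n alpha m.+3 <= k)%N.
Proof.
have ex : exists N, r m ^+ N <= 1 / 2.
  have c : (fun N => r m ^+ N) @ \oo --> (0 : R).
    by apply: cvg_expr; rewrite ger0_norm ?r_lt// ltW// r_pos.
  have h : (0 : R) < 1 / 2 by rewrite divr_gt0.
  have [N _ /(_ N (leqnn N)) /= hN] : \forall N \near \oo, r m ^+ N < 1 / 2 by apply: (cvgr_lt _ c).
  by exists N; exact: ltW.
rewrite /N_n; apply: (@xgetPex _ 0%N [set N | r m ^+ N <= 1 / 2 /\ forall k, r m ^+ k <= 1 / 2 -> (N <= k)%N]).
by case: (ex_minnP ex) => N h1 h2; exists N.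
Qed.

(** Minimality of [N_n]: one step earlier the radius is still more than [1 / 2]. *)
Lemma rN_bounds m : r m ^+ 2 / 2 <= r m ^+ (N_n alpha m.+3).+1 <= r m / 2.
Proof.
have [h1 h2] := N_nP m; have r0 := r_pos m; have r1 := r_lt m.
move: (N_n alpha m.+3) h1 h2 => N; move: (r m) r0 r1 => x r0 r1 h1 h2.
apply/andP; split; last by rewrite exprS; apply: ler_wpM2l; [exact: ltW|lra].
case: N h1 h2 => [|N] h1 h2; first by move: h1; rewrite expr0; lra.
have h : 1 / 2 <= x ^+ N.
  by rewrite leNgt; apply/negP => /ltW /h2; rewrite ltnn.
rewrite !exprS expr0 mulr1 -!mulrA !ler_pM2l//.
by apply: le_trans h; lra.
Qed.

Lemma cvg_rN : (fun m => r m ^+ (N_n alpha m.+3).+1) @ \oo --> (1 / 2 : R).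
Proof.
apply: (@squeeze_cvgr _ _ _ _ (fun m => r m ^+ 2 / 2) (fun m => r m / 2)).
- by apply: filterE => m; exact: rN_bounds.
- apply: cvgM; last exact: cvg_cst.
  rewrite -[X in _ --> X](mulr1 1); apply: cvgM; exact: cvg_r.
- by apply: cvgM; [exact: cvg_r|exact: cvg_cst].
Qed.

End Asymptotics.

(** * Pointwise limits *)

Section Limit.
Context {R : realType}.
Variable alpha : R.
Hypothesis alpha01 : 0 < alpha < 1.
Variables (u : nat -> R * R -> R * R) (RE : nat -> 'M[R]_2).
Hypothesis hu : forall m, ring_deformation alpha m.+3 (u m) (RE m).
Implicit Types (x y : R * R).
Let th (m : nat) : R := theta m.+3.
Let r (m : nat) : R := r_I alpha m.+3.
Let n3 (m : nat) : (3 <= m.+3)%N := isT.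
Let a0 : 0 < alpha := alpha_gt0 alpha01.
Let a1 : alpha < 1 := alpha_lt1 alpha01.
Let b0 : 0 < 1 - alpha. Proof. by rewrite subr_gt0. Qed.
Let W (m : nat) : R * R -> R * R := iterated alpha m.+3 (u m) (RE m).
Let N (m : nat) : nat := N_n alpha m.+3.
Let ga (m : nat) : R := th m * (1 - 2 * alpha).
Let de (m : nat) : R := th m * alpha.

Lemma a_limE : a_lim alpha = Num.sqrt (1 - alpha) / Num.sqrt alpha.
Proof. by rewrite /a_lim sqrtrM ?ltW// sqrtrV// ltW. Qed.

Lemma stretch_lim01 : stretch_lim alpha ord0 ord_max = - sin (beta0 alpha).
Proof.
have h0 := a0; have h1 := a1.
rewrite /beta0 asinK; last by rewrite in_itv /=; apply/andP; split; lra.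
rewrite /stretch_lim !mxE !perpE /coord /= a_limE.
have A := sqrt_alpha alpha01; have B := sqrt_alpha' alpha01.
have A0 := sqrt_alpha_gt0 alpha01; have B0 := sqrt_alpha'_gt0 alpha01.
move: A B A0 B0; set x := Num.sqrt alpha; set y := Num.sqrt (1 - alpha) => A B A0 B0.
rewrite opprK.
have -> : y / x * (y * - x) + (y / x)^-1 * (x * y) = x * x - y * y by field; rewrite !gt_eqF.
by rewrite A B; ring.
Qed.

Lemma stretch_lim11 : stretch_lim alpha ord_max ord_max = cos (beta0 alpha).
Proof.
have h0 := a0; have h1 := a1.
rewrite /beta0 cos_asin; last by apply/andP; split; lra.
rewrite /stretch_lim !mxE !perpE /coord /= a_limE.
have A := sqrt_alpha alpha01; have B := sqrt_alpha' alpha01.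
have A0 := sqrt_alpha_gt0 alpha01; have B0 := sqrt_alpha'_gt0 alpha01.
move: A B A0 B0; set x := Num.sqrt alpha; set y := Num.sqrt (1 - alpha) => A B A0 B0.
have -> : y / x * (- x * - x) + (y / x)^-1 * (y * y) = 2 * (x * y) by field; rewrite !gt_eqF.
have -> : 1 - (1 - 2 * alpha) ^+ 2 = (2 * (x * y)) ^+ 2.
  have -> : (2 * (x * y)) ^+ 2 = 4 * (x * x) * (y * y) by ring.
  by rewrite A B; ring.
by rewrite sqrtr_sqr ger0_norm// mulr_ge0// mulr_ge0// ltW.
Qed.

(** A rotation is determined by the image of one nonzero vector.  Here the vector
    is the first outer edge divided by theta, which tends to the second basis
    vector; its image tends to the second column of [stretch_lim]. *)
Lemma cvg_RE : mxcvg RE (rotation (beta0 alpha)).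
Proof.
(* the first outer edge on the scale of theta *)
pose d m : R * R := (th m)^-1 *: (vertE m.+3 1 - vertE m.+3 0).
have d1E m : (d m).1 = (cos (th m * 1) - 1) / th m.
  by rewrite /d !pairE /vertE /rv /= -/(th m) mulr0 cos0 mulrC.
have d2E m : (d m).2 = sin (th m * 1) / th m.
  by rewrite /d !pairE /vertE /rv /= -/(th m) mulr0 sin0 subr0 mulrC.
have c1 : (fun m => (d m).1) @ \oo --> (0 : R) by under eq_fun do rewrite d1E; exact: cos_quot.
have c2 : (fun m => (d m).2) @ \oo --> (1 : R) by under eq_fun do rewrite d2E; exact: sin_quot.
have hV := mxcvg_stretch alpha01 (fun=> false).
pose y m := mxact (stretch alpha m.+3 (-1)) (d m).
have y1 : (fun m => (y m).1) @ \oo --> stretch_lim alpha ord0 ord_max.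
  have -> : stretch_lim alpha ord0 ord_max = stretch_lim alpha ord0 ord0 * 0 + stretch_lim alpha ord0 ord_max * 1 by ring.
  by apply: cvgD; apply: cvgM => //; exact: hV.
have y2 : (fun m => (y m).2) @ \oo --> stretch_lim alpha ord_max ord_max.
  have -> : stretch_lim alpha ord_max ord_max = stretch_lim alpha ord_max ord0 * 0 + stretch_lim alpha ord_max ord_max * 1 by ring.
  by apply: cvgD; apply: cvgM => //; exact: hV.
have E m : mxact (RE m) (d m) = y m.
  rewrite /y /d !mxactZ (RE_edge alpha01 (n3 m) (hu m))//; congr (_ *: mxact _ _).
  by rewrite /turned_stretch mulr0 oppr0 rotation0 mul1mx mulmx1.
have cD : (fun m => (d m).1 * (d m).1 + (d m).2 * (d m).2) @ \oo --> (1 : R).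
  have -> : (1 : R) = 0 * 0 + 1 * 1 by ring.
  by apply: cvgD; apply: cvgM.
have DN m : (d m).1 * (d m).1 + (d m).2 * (d m).2 != 0.
  rewrite gt_eqF// -!expr2 ltr_wpDl ?sqr_ge0// exprn_gt0// d2E mulr1.
  by have := @sinth_gt0 R m.+3 (n3 m); rewrite -/(th m) => h; rewrite divr_gt0// th_pos.
have cp : (fun m => RE m ord0 ord0) @ \oo --> stretch_lim alpha ord_max ord_max.
  rewrite (_ : (fun m => _) = (fun m => ((d m).1 * (y m).1 + (d m).2 * (y m).2) / ((d m).1 * (d m).1 + (d m).2 * (d m).2))).
    have -> : stretch_lim alpha ord_max ord_max = (0 * stretch_lim alpha ord0 ord_max + 1 * stretch_lim alpha ord_max ord_max) / 1 by field.
    by apply: cvgM; [apply: cvgD; apply: cvgM|apply: cvgV; rewrite ?oner_neq0].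
  apply/funext => m; have [h1 h2 _] := SO2_entries (RE_SO2 (hu m)).
  have e1 : (y m).1 = RE m ord0 ord0 * (d m).1 + RE m ord0 ord_max * (d m).2 by rewrite -E.
  have e2 : (y m).2 = RE m ord_max ord0 * (d m).1 + RE m ord_max ord_max * (d m).2 by rewrite -E.
  rewrite e1 e2 h1 h2; have := DN m; move: (RE m _ _) (RE m _ _) (d m).1 (d m).2 => p q a b' ab; by field.
have cb : (fun m => RE m ord0 ord_max) @ \oo --> stretch_lim alpha ord0 ord_max.
  rewrite (_ : (fun m => _) = (fun m => ((d m).2 * (y m).1 - (d m).1 * (y m).2) / ((d m).1 * (d m).1 + (d m).2 * (d m).2))).
    have -> : stretch_lim alpha ord0 ord_max = (1 * stretch_lim alpha ord0 ord_max - 0 * stretch_lim alpha ord_max ord_max) / 1 by field.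
    by apply: cvgM; [apply: cvgB; apply: cvgM|apply: cvgV; rewrite ?oner_neq0].
  apply/funext => m; have [h1 h2 _] := SO2_entries (RE_SO2 (hu m)).
  have e1 : (y m).1 = RE m ord0 ord0 * (d m).1 + RE m ord0 ord_max * (d m).2 by rewrite -E.
  have e2 : (y m).2 = RE m ord_max ord0 * (d m).1 + RE m ord_max ord_max * (d m).2 by rewrite -E.
  rewrite e1 e2 h1 h2; have := DN m; move: (RE m _ _) (RE m _ _) (d m).1 (d m).2 => p q a b' ab; by field.
rewrite stretch_lim01 in cb; rewrite stretch_lim11 in cp.
move=> i j; case: (ord2 i) => ->; case: (ord2 j) => ->; rewrite rotationE//.
  rewrite (_ : (fun m => _) = (fun m => - RE m ord0 ord_max)).
    by rewrite -[sin _]opprK; apply: cvgN.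
  by apply/funext => m; have [_ -> _] := SO2_entries (RE_SO2 (hu m)).
rewrite (_ : (fun m => _) = (fun m => RE m ord0 ord0))//.
by apply/funext => m; have [-> _ _] := SO2_entries (RE_SO2 (hu m)).
Qed.

(** Bounds the distance from the outer vertex to the other points of a triangle. *)
Definition tri_bound m : R := enorm (rv (th m) - rv 0 : R * R) + enorm (r m *: rv (de m) - rv 0 : R * R) +
  enorm (r m *: rv (de m - th m) - rv 0 : R * R).

Lemma tri_bound_ge0 m : 0 <= tri_bound m.
Proof. by rewrite !addr_ge0// enorm_ge0. Qed.

Lemma cvg_enorm0 (a b : nat -> R) : a @ \oo --> (1 : R) -> b @ \oo --> (0 : R) ->
  (fun m => enorm (a m *: rv (b m) - rv 0 : R * R)) @ \oo --> (0 : R).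
Proof.
move=> ca cb.
rewrite (_ : (fun m => _) = (fun m => Num.sqrt ((a m * cos (b m) - 1) ^+ 2 + (a m * sin (b m)) ^+ 2))); last first.
  by apply/funext => m; rewrite /enorm !pairE /rv /= cos0 sin0 subr0.
have -> : (0 : R) = Num.sqrt ((1 * 1 - 1) ^+ 2 + (1 * 0) ^+ 2).
  by rewrite mulr1 subrr mulr0 expr2 mulr0 addr0 sqrtr0.
have cc := cvg_cos cb; have cs := cvg_sin cb; rewrite cos0 in cc; rewrite sin0 in cs.
have c1 : (fun m => a m * cos (b m) - 1) @ \oo --> (1 * 1 - 1 : R).
  by apply: cvgB; [exact: cvgM|exact: cvg_cst].
have c2 : (fun m => a m * sin (b m)) @ \oo --> (1 * 0 : R) by exact: cvgM.
by apply: cvg_sqrt; rewrite !expr2; apply: cvgD; apply: cvgM.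
Qed.

Lemma cvg_tri_bound : tri_bound @ \oo --> (0 : R).
Proof.
have -> : (0 : R) = 0 + 0 + 0 by rewrite !addr0.
apply: cvgD; first apply: cvgD.
- rewrite (_ : (fun m => _) = (fun m => enorm (1 *: rv (th m) - rv 0 : R * R))).
    by apply: cvg_enorm0; [exact: cvg_cst|exact: cvg_th].
  by apply/funext => m; rewrite scale1r.
- by apply: cvg_enorm0; [exact: cvg_r|exact: cvg_thx].
- apply: cvg_enorm0; [exact: cvg_r|].
  rewrite -[X in _ --> X](subrr (0 : R)); apply: cvgB; [exact: cvg_thx|exact: cvg_th].
Qed.

Lemma convex_ball (c : R * R) (d : R) : convex_set [set y | enorm (y - c) <= d].
Proof.
apply/convex_setP => x y t /= hx hy /andP[t0 t1].
have -> : x + t *: (y - x) - c = (1 - t) *: (x - c) + t *: (y - c) by apply: pair_ext; rewrite !pairE; ring.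
apply: le_trans (enormD _ _) _; rewrite !enormZ !ger0_norm ?subr_ge0//.
have -> : d = (1 - t) * d + t * d by ring.
by apply: lerD; apply: ler_wpM2l; rewrite ?subr_ge0.
Qed.

Lemma tri_at_bound m b i y : tri_at alpha m.+3 b i y -> enorm (y - vertE m.+3 i) <= tri_bound m.
Proof.
have d1 := enorm_ge0 (rv (th m) - rv 0 : R * R); have d2 := enorm_ge0 (r m *: rv (de m) - rv 0 : R * R).
have d3 := enorm_ge0 (r m *: rv (de m - th m) - rv 0 : R * R).
have h1 t : enorm (rv (t + th m) - rv t) <= tri_bound m.
  have -> : rv (t + th m) - rv t = rot t (rv (th m) - rv 0) by rewrite rotB !rot_rv addr0.
  by rewrite enorm_rot /tri_bound; lra.
have h2 t : enorm (r m *: rv (t + de m) - rv t) <= tri_bound m.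
  have -> : r m *: rv (t + de m) - rv t = rot t (r m *: rv (de m) - rv 0) by rewrite rotB rotZ !rot_rv addr0.
  by rewrite enorm_rot /tri_bound; lra.
have h3 t : enorm (r m *: rv (t + de m - th m) - rv t) <= tri_bound m.
  have -> : r m *: rv (t + de m - th m) - rv t = rot t (r m *: rv (de m - th m) - rv 0) by rewrite rotB rotZ !rot_rv addr0 addrA.
  by rewrite enorm_rot /tri_bound; lra.
have h0 t : enorm (rv t - rv t : R * R) <= tri_bound m by rewrite subrr enorm0 tri_bound_ge0.
rewrite /tri_at /vertE -/(th m); set t := th m * i%:R.
case: b; apply: (ctri_in_convex (C := [set y | enorm (y - rv t) <= tri_bound m])) => //=; try exact: convex_ball.
  by rewrite or3_triO// ABC_gt0.
by rewrite or3_triE// SAB_gt0.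
Qed.

Lemma cvg_ev (f g : nat -> R) (l : R) : (\forall m \near \oo, f m = g m) -> g @ \oo --> l -> f @ \oo --> l.
Proof.
move=> fg cg; have E : {near \oo, g =1 f} by near=> m; apply/esym; near: m.
exact: (cvg_trans (near_eq_cvg E)).
Unshelve. all: by end_near. Qed.

Lemma cvg_lip_bound : (fun m => lip_bound alpha m.+3) @ \oo --> a_lim alpha + (a_lim alpha)^-1.
Proof.
have aN : a_lim alpha != 0 by rewrite gt_eqF// sqrtr_gt0 divr_gt0.
rewrite -[X in _ --> X]addr0; apply: cvgD; first apply: cvgD.
- exact: cvg_an.
- by apply: cvgV => //; exact: cvg_an.
- by rewrite -[X in _ --> X](@normr0 _ R); apply: (cvg_comp _ _ (cvg_shear alpha01)); exact: norm_continuous.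
Qed.

(** The rotation whose cosine and sine are [c] and [d], written without an angle. *)
Definition conformal (c d : R) : 'M[R]_2 := \matrix_(i, j) (if i == j then c else if i == ord0 then - d else d).

Lemma conformalE (c d : R) : (conformal c d ord0 ord0 = c) * (conformal c d ord0 ord_max = - d) *
  (conformal c d ord_max ord0 = d) * (conformal c d ord_max ord_max = c).
Proof. by rewrite !mxE. Qed.

Lemma mxcvg_conformal (c_ d_ : nat -> R) (c d : R) : c_ @ \oo --> c -> d_ @ \oo --> d ->
  mxcvg (fun m => conformal (c_ m) (d_ m)) (conformal c d).
Proof.
move=> cc cd i j; rewrite mxE; under eq_fun do rewrite mxE.
by case: (i == j) => //; case: (i == ord0) => //; exact: cvgN.
Qed.

Definition annulus_lim x : 'M[R]_2 :=
  rotation (rho0 alpha * ln (enorm x)) *m conformal (x.1 / enorm x) (x.2 / enorm x) *m stretch_lim alpha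
  *m conformal (x.1 / enorm x) (- (x.2 / enorm x)).

(** The arctangent gives the polar angle up to a half turn, and the resulting sign
    cancels between the two factors. *)
Lemma annulus_limE x : x.1 != 0 -> annulus_lim x = annulus_gradient alpha x.
Proof.
move=> x0; have E0 : 0 < enorm x.
  rewrite lt_neqAle enorm_ge0 andbT eq_sym; apply/eqP => /enorm_eq0 h; move: x0; by rewrite h eqxx.
rewrite /annulus_lim /annulus_gradient rotation_tr -!mulmxA; congr (_ *m _).
have cpos : 0 < cos (omega x) by rewrite /omega cos_atan invr_gt0 sqrtr_gt0 ltr_pwDl// sqr_ge0.
have hs : sin (omega x) = x.2 / x.1 * cos (omega x).
  have ht : tan (omega x) = x.2 / x.1 by rewrite /omega atanK.
  by rewrite -ht /tan divfK// gt_eqF.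
have hc : (enorm x * cos (omega x)) ^+ 2 = x.1 ^+ 2.
  have h := cos2Dsin2 (omega x); rewrite hs in h.
  have : cos (omega x) ^+ 2 * (x.1 ^+ 2 + x.2 ^+ 2) = x.1 ^+ 2.
    rewrite -[RHS]mulr1 -h; field; exact: x0.
  by rewrite exprMn enorm_sqr mulrC.
have [e he] : exists e : R, e * e = 1 /\ x.1 / enorm x = e * cos (omega x).
  move/eqP: hc; rewrite eqf_sqr => /orP[/eqP h|/eqP h].
    by exists 1; split; [ring|rewrite -h; field; rewrite gt_eqF].
  by exists (-1); split; [ring|rewrite -[x.1]opprK -h; field; rewrite gt_eqF].
have [e1 e2] := he.
have e3 : x.2 / enorm x = e * sin (omega x).
  by rewrite hs mulrCA -e2; field; rewrite x0 gt_eqF.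
have E1 : conformal (x.1 / enorm x) (x.2 / enorm x) = e *: rotation (omega x).
  by apply: mat2_ext; rewrite conformalE mxE rotationE ?e2 ?e3 ?mulrN.
have E2 : conformal (x.1 / enorm x) (- (x.2 / enorm x)) = e *: rotation (- omega x).
  by apply: mat2_ext; rewrite conformalE mxE rotationE ?e2 ?e3 ?cosN ?sinN ?mulrN ?opprK.
by rewrite E1 E2 -!scalemxAr -!scalemxAl scalerA e1 scale1r.
Qed.

Definition generic x : Prop := forall m,
  [\/ ~ filled alpha m.+3 0 x /\ affine_near (W m) x (RE m),
      filled alpha m.+3 (N m).+1 x /\ affine_near (W m) x (RE m *m rotation ((N m).+1%:R * ga m)) |
      exists k i b, [/\ (k <= N m)%N && (i < m.+3)%N, tri_at alpha m.+3 b i (unscale alpha m.+3 k x), filled alpha m.+3 k x, ~ filled alpha m.+3 k.+1 x &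
        affine_near (W m) x (rotation (k%:R * ga m) *m rotation (th m * i%:R + k%:R * de m) *m stretch alpha m.+3 (sgn b) *m rotation (- (th m * i%:R + k%:R * de m)))]].

Lemma ae_generic : {ae lebesgue2, forall x, generic x}.
Proof. by apply: ae_all_nat => m; exact: (ae_affine_near alpha01 (n3 m) (hu m)). Qed.

Definition has_limits x (A : 'M[R]_2) : Prop :=
  (exists l : R * R, forall i, (fun m => coord i (W m x)) @ \oo --> coord i l) /\
  (forall i j, (fun m => lgrad (W m) x i j) @ \oo --> A i j).

Lemma cvg_mxact (A_ : nat -> 'M[R]_2) A (y : nat -> R * R) l : mxcvg A_ A ->
  (forall i, (fun m => coord i (y m)) @ \oo --> coord i l) ->
  forall i, (fun m => coord i (mxact (A_ m) (y m))) @ \oo --> coord i (mxact A l).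
Proof.
move=> cA cy i; have c1 := cy ord0; have c2 := cy ord_max.
rewrite /coord /= in c1 c2.
by case: (ord2 i) => ->; rewrite /coord /mxact /=; apply: cvgD; apply: cvgM => //; exact: cA.
Qed.

Lemma limits_out x : generic x -> 1 < enorm x -> has_limits x (rotation (beta0 alpha)).
Proof.
move=> _ x1.
have nD m : ~ filled alpha m.+3 0 x.
  by rewrite /filled /= unscale0 => /OmegaE_le1; rewrite leNgt x1.
split.
  exists (mxact (rotation (beta0 alpha)) x) => i.
  rewrite (_ : (fun m => _) = (fun m => coord i (mxact (RE m) x))).
    by apply: cvg_mxact; [exact: cvg_RE|move=> j; exact: cvg_cst].
  apply/funext => m; rewrite /W (iterated_out alpha01 (n3 m) (hu m))// => /(open_polygon_sub (n3 m)).
  by have := nD m; rewrite /filled /= unscale0.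
move=> i j; rewrite (_ : (fun m => _) = (fun m => RE m i j)); first exact: cvg_RE.
apply/funext => m; congr (fun_of_matrix _ i j).
by apply: lgrad_affine; apply: (affine_near_out alpha01 (n3 m) (hu m)).
Qed.

Lemma limits_in x : generic x -> enorm x < 1 / 2 ->
  has_limits x (rotation (beta0 alpha) *m rotation (rho0 alpha * ln (1 / 2))).
Proof.
move=> _ x1.
have ev : \forall m \near \oo, open_polygon m.+3 (unscale alpha m.+3 (N m).+1 x).
  have c : (fun m => r m ^+ (N m).+1 * apothem m.+3) @ \oo --> (1 / 2 : R).
    rewrite -[X in _ --> X]mulr1; apply: cvgM; [exact: cvg_rN|exact: cvg_apothem].
  have hh : \forall m \near \oo, enorm x < r m ^+ (N m).+1 * apothem m.+3 by exact: (cvgr_gt _ c _ x1).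
  apply: filterS hh => m h i _.
  apply: le_lt_trans (dot_le _ _) _; rewrite enorm_rv mulr1 (enorm_unscale alpha01 (n3 m)).
  by rewrite ltr_pdivrMr 1?mulrC// rk_gt0.
have cA : mxcvg (fun m => RE m *m rotation ((N m).+1%:R * ga m)) (rotation (beta0 alpha) *m rotation (rho0 alpha * ln (1 / 2))).
  apply: mxcvgM; first exact: cvg_RE.
  by apply: mxcvg_rotation; apply: cvg_angle => //; exact: cvg_rN.
split.
  exists (mxact (rotation (beta0 alpha) *m rotation (rho0 alpha * ln (1 / 2))) x) => i.
  apply: (@cvg_ev _ (fun m => coord i (mxact (RE m *m rotation ((N m).+1%:R * ga m)) x))).
    apply: filterS ev => m h; rewrite mxactM mxact_rotation /W (iterated_in alpha01 (n3 m) (hu m))//.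
    exact: (open_polygon_sub (n3 m)).
  by apply: cvg_mxact => // j; exact: cvg_cst.
move=> i j; apply: (@cvg_ev _ (fun m => (RE m *m rotation ((N m).+1%:R * ga m)) i j)); last exact: cA.
apply: filterS ev => m h; congr (fun_of_matrix _ i j).
by apply: lgrad_affine; apply: (affine_near_in alpha01 (n3 m) (hu m)).
Qed.

(** Let [y m] be the outer vertex of the triangle that contains [x], in the ring
    of index [k m].  The triangles shrink, so [y m] tends to [x].  Its norm
    [r m ^+ k m] thus tends to that of [x], which gives the accumulated rotation,
    and its polar angle [psi m] tends to that of [x].  The value at [y m] is
    explicit, and the common Lipschitz bound transfers it to [x]. *)
Lemma limits_mid x : generic x -> 1 / 2 < enorm x -> enorm x < 1 -> has_limits x (annulus_lim x).
Proof.
move=> gx x1 x2; have E0 : 0 < enorm x by apply: lt_trans x1; rewrite divr_gt0.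
(* [t] holds the index of the ring, the index of the vertex and the kind of the
     triangle that contains [x] *)
pose Q m (t : nat * nat * bool) := [/\ (t.1.1 <= N m)%N && (t.1.2 < m.+3)%N, tri_at alpha m.+3 t.2 t.1.2 (unscale alpha m.+3 t.1.1 x),
   filled alpha m.+3 t.1.1 x, ~ filled alpha m.+3 t.1.1.+1 x &
   affine_near (W m) x (rotation (t.1.1%:R * ga m) *m rotation (th m * t.1.2%:R + t.1.1%:R * de m) *m stretch alpha m.+3 (sgn t.2) *m rotation (- (th m * t.1.2%:R + t.1.1%:R * de m)))].
have ev : \forall m \near \oo, exists t, Q m t.
  have h1 := cvgr_gt _ (@cvg_apothem R) _ x2; have h2 := cvgr_lt _ (cvg_rN alpha01) _ x1.
  near=> m.
  have d0 : filled alpha m.+3 0 x.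
    rewrite /filled /= unscale0; apply: ball_in_OmegaE => //; apply: ltW; near: m; exact: h1.
  have dN : ~ filled alpha m.+3 (N m).+1 x.
    move=> /OmegaE_le1; rewrite (enorm_unscale alpha01 (n3 m)) ler_pdivrMr ?rk_gt0// mul1r leNgt => /negP; apply.
    near: m; exact: h2.
  have [[]|[]|[k [i [b h]]]] := gx m => //.
  by exists (k, i, b).
have [T hT] : {T : nat -> nat * nat * bool & forall m, (exists t, Q m t) -> Q m (T m)}.
  apply: (@choice _ _ (fun m t => (exists t, Q m t) -> Q m t)) => m.
  have [[t ht]|h] := pselect (exists t, Q m t); first by exists t.
  by exists (0%N, 0%N, true).
have {}ev : \forall m \near \oo, Q m (T m) by apply: filterS ev => m; exact: hT.
pose k m := (T m).1.1; pose i m := (T m).1.2; pose b m := (T m).2.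
pose psi m := th m * (i m)%:R + (k m)%:R * de m.
pose y m : R * R := r m ^+ k m *: rv (psi m).
have rk1 m : r m ^+ k m <= 1 by rewrite exprn_ile1// ltW ?r_pos ?r_lt.
have rk0 m : 0 < r m ^+ k m by rewrite exprn_gt0// r_pos.
have yE m : y m = r m ^+ k m *: rot ((k m)%:R * de m) (vertE m.+3 (i m)).
  by rewrite /y /vertE rot_rv /psi addrC.
have near_y : \forall m \near \oo, enorm (x - y m) <= tri_bound m.
  apply: filterS ev => m [_ ht _ _ _].
  rewrite -{1}[x](unscaleVK alpha01 (n3 m) (k m)) yE -scalerBr -rotB enormZ enorm_rot ger0_norm ?(ltW (rk0 m))//.
  apply: (@le_trans _ _ (1 * enorm (unscale alpha m.+3 (k m) x - vertE m.+3 (i m)))).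
    by apply: ler_wpM2r; [exact: enorm_ge0|exact: rk1].
  by rewrite mul1r; exact: (tri_at_bound ht).
have cdiff (z : nat -> R) : (\forall m \near \oo, `|z m| <= tri_bound m) -> z @ \oo --> (0 : R).
  move=> hz; have c' : (fun m => - tri_bound m) @ \oo --> (0 : R) by rewrite -oppr0; apply: cvgN; exact: cvg_tri_bound.
  apply: (squeeze_cvgr _ c' cvg_tri_bound); apply: filterS hz => m; by rewrite ler_norml.
have cy j : (fun m => coord j (y m)) @ \oo --> coord j x.
  have c : (fun m => coord j (x - y m)) @ \oo --> (0 : R).
    apply: cdiff; apply: filterS near_y => m; apply: le_trans.
    by have [h1 h2] := coord_le_enorm (x - y m); case: (ord2 j) => ->.
  rewrite (_ : (fun m => _) = (fun m => coord j x - coord j (x - y m))).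
    by rewrite -[X in _ --> X]subr0; apply: cvgB => //; exact: cvg_cst.
  by apply/funext => m; case: (ord2 j) => ->; rewrite /coord /= subKr.
have crk : (fun m => r m ^+ k m) @ \oo --> enorm x.
  have c : (fun m => enorm x - enorm (y m)) @ \oo --> (0 : R).
    apply: cdiff; apply: filterS near_y => m; apply: le_trans; exact: enorm_lerB.
  rewrite (_ : (fun m => _) = (fun m => enorm x - (enorm x - enorm (y m)))).
    by rewrite -[X in _ --> X]subr0; apply: cvgB => //; exact: cvg_cst.
  by apply/funext => m; rewrite subKr /y enormZ enorm_rv mulr1 ger0_norm// ltW.
have cang := cvg_angle alpha01 E0 crk.
have EN : enorm x != 0 by rewrite gt_eqF.
have ccos : (fun m => cos (psi m)) @ \oo --> x.1 / enorm x.
  rewrite (_ : (fun m => _) = (fun m => coord ord0 (y m) / r m ^+ k m)).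
    by apply: cvgM; [exact: (cy ord0)|exact: cvgV].
  by apply/funext => m; rewrite /coord /y /= mulrC mulKf// gt_eqF.
have csin : (fun m => sin (psi m)) @ \oo --> x.2 / enorm x.
  rewrite (_ : (fun m => _) = (fun m => coord ord_max (y m) / r m ^+ k m)).
    by apply: cvgM; [exact: (cy ord_max)|exact: cvgV].
  by apply/funext => m; rewrite /coord /y /= mulrC mulKf// gt_eqF.
split; last first.
  move=> i' j'.
  apply: (@cvg_ev _ (fun m => (rotation ((k m)%:R * ga m) *m rotation (psi m) *m stretch alpha m.+3 (sgn (b m)) *m rotation (- psi m)) i' j')).
    by apply: filterS ev => m [_ _ _ _ h]; rewrite (lgrad_affine h).
  have cR : mxcvg (fun m => rotation (psi m)) (conformal (x.1 / enorm x) (x.2 / enorm x)).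
    exact: (mxcvg_conformal ccos csin).
  have cR' : mxcvg (fun m => rotation (- psi m)) (conformal (x.1 / enorm x) (- (x.2 / enorm x))).
    rewrite (_ : (fun m => _) = (fun m => conformal (cos (psi m)) (- sin (psi m)))).
      by apply: mxcvg_conformal => //; exact: cvgN.
    by apply/funext => m; apply: mat2_ext; rewrite conformalE rotationE ?cosN ?sinN.
  by apply: (mxcvgM _ cR'); apply: mxcvgM; [apply: mxcvgM => //; exact: mxcvg_rotation|exact: mxcvg_stretch].
pose A := rotation (beta0 alpha) *m rotation (rho0 alpha * ln (enorm x)).
have cA : mxcvg (fun m => RE m *m rotation ((k m)%:R * ga m)) A.
  by apply: mxcvgM; [exact: cvg_RE|exact: mxcvg_rotation].
exists (mxact A x) => j.
have c1 := @cvg_mxact _ _ _ _ cA cy j.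
have c2 : (fun m => coord j (W m x) - coord j (mxact (RE m *m rotation ((k m)%:R * ga m)) (y m))) @ \oo --> (0 : R).
  have cL : (fun m => lip_bound alpha m.+3 * tri_bound m) @ \oo --> (0 : R).
    by rewrite -[X in _ --> X](mulr0 (a_lim alpha + (a_lim alpha)^-1)); apply: cvgM; [exact: cvg_lip_bound|exact: cvg_tri_bound].
  have cL' : (fun m => - (lip_bound alpha m.+3 * tri_bound m)) @ \oo --> (0 : R) by rewrite -oppr0; apply: cvgN.
  apply: (squeeze_cvgr _ cL' cL); apply: filterS ev => m [/andP[kN iN] ht hD hD' _].
  rewrite -ler_norml.
  have -> : coord j (W m x) - coord j (mxact (RE m *m rotation ((k m)%:R * ga m)) (y m)) =
      coord j (W m x - mxact (RE m *m rotation ((k m)%:R * ga m)) (y m)) by case: (ord2 j) => ->.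
  apply: (@le_trans _ _ (enorm (W m x - mxact (RE m *m rotation ((k m)%:R * ga m)) (y m)))).
    by have [h1 h2] := coord_le_enorm (W m x - mxact (RE m *m rotation ((k m)%:R * ga m)) (y m)); case: (ord2 j) => ->.
  rewrite /W (iterated_ring alpha01 (n3 m) (hu m) kN hD hD') mxactM -mxactB (SO2_enorm _ (RE_SO2 (hu m))).
  rewrite mxact_rotation yE /ring_copy rotZ -/(th m) -/(r m) -/(ga m) -/(de m) -/(k m) -scalerBr -!rotB enormZ !enorm_rot ger0_norm ?(ltW (rk0 m))//.
  rewrite -(u_vertE (n3 m) (hu m) iN).
  apply: (@le_trans _ _ (1 * (lip_bound alpha m.+3 * enorm (unscale alpha m.+3 (k m) x - vertE m.+3 (i m))))).
    apply: ler_pM => //; [exact: ltW|exact: enorm_ge0|exact: (u_lip alpha01 (n3 m) (hu m))].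
  rewrite mul1r ler_wpM2l ?(lip_bound_ge0 alpha01 (n3 m))//; exact: tri_at_bound ht.
have -> : coord j (mxact A x) = 0 + coord j (mxact A x) by rewrite add0r.
rewrite (_ : (fun m => _) = (fun m => (coord j (W m x) - coord j (mxact (RE m *m rotation ((k m)%:R * ga m)) (y m))) + coord j (mxact (RE m *m rotation ((k m)%:R * ga m)) (y m)))).
  exact: cvgD.
by apply/funext => m; rewrite subrK.
Unshelve. all: by end_near. Qed.

End Limit.

(** * The convergence theorem *)

Theorem proposition2p9 (R : realType) (alpha : R) (halpha : 0 < alpha < 1)
    (u : nat -> R * R -> R * R) (RE : nat -> 'M[R]_2)
    (hu : forall n : nat, (3 <= n)%N -> ring_deformation alpha n (u n) (RE n)) :
  exists (v : R * R -> R * R) (G : R * R -> 'M[R]_2),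
    W1loc +oo%E v G /\
    (forall p : R, 1 <= p ->
       W1loc_cvg p%:E
         (fun m => v_n alpha m.+3 (u m.+3) (RE m.+3)) v) /\
    {ae lebesgue2, forall x, ~ eball 1 x -> G x = rotation (beta0 alpha)} /\
    {ae lebesgue2, forall x, eball (1 / 2) x ->
       G x = rotation (beta0 alpha) *m rotation (rho0 alpha * ln (1 / 2))} /\
    {ae lebesgue2, forall x, eball 1 x -> ~ eball (1 / 2) x ->
       G x = annulus_gradient alpha x}.
Proof.
have n3 m : (3 <= m.+3)%N by [].
pose u' m := u m.+3; pose RE' m := RE m.+3.
have hu' m : ring_deformation alpha m.+3 (u' m) (RE' m) by exact: hu.
pose W m := iterated alpha m.+3 (u' m) (RE' m).
have vW : (fun m => v_n alpha m.+3 (u m.+3) (RE m.+3)) = W.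
  by apply/funext => m; apply/funext => x; exact: (v_n_iterated halpha (n3 m) (hu' m)).
have [L L0 LW] : exists2 L : R, 0 <= L & forall m x y, enorm (W m x - W m y) <= L * enorm (x - y).
  have /cvg_seq_bounded : cvgn (fun m => lip_bound alpha m.+3 : R^o) by apply/cvg_ex; eexists; exact: cvg_lip_bound.
  move=> [M [_ hM]]; exists (`|M| + 1); first by rewrite addr_ge0.
  move=> m x y; apply: le_trans (iterated_lip halpha (n3 m) (hu' m) x y) _.
  apply: ler_wpM2r; first exact: enorm_ge0.
  by apply: le_trans (ler_norm _) _; apply: hM => //; rewrite ltr_pwDr// ler_norm.
have gd := ae_generic halpha hu'.
have n1 := @ae_circle R 1; have n2 := @ae_circle R (1 / 2).
have key : {ae lebesgue2, forall x, exists A, has_limits alpha u' RE' x A /\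
   [/\ 1 < enorm x -> A = rotation (beta0 alpha),
      enorm x < 1 / 2 -> A = rotation (beta0 alpha) *m rotation (rho0 alpha * ln (1 / 2)) &
      1 / 2 < enorm x -> enorm x < 1 -> A = annulus_lim alpha x]}.
  apply: ae_mono (ae_and gd (ae_and n1 n2)) => x [hx [x1 x2]].
  have [h1|h1|h1] := ltgtP (enorm x) 1; last by rewrite h1 eqxx in x1.
  - have [h2|h2|h2] := ltgtP (enorm x) (1 / 2); last by rewrite h2 eqxx in x2.
    + exists (rotation (beta0 alpha) *m rotation (rho0 alpha * ln (1 / 2))); split.
        exact: limits_in.
      by split.
    + exists (annulus_lim alpha x); split; first exact: limits_mid.
      by split.
  - exists (rotation (beta0 alpha)); split; first exact: limits_out.
    by split => // h; exfalso; lra.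
have [v [G [h1 h2 h3]]] : exists (v : R * R -> R * R) (G : R * R -> 'M[R]_2),
    [/\ W1loc +oo%E v G, (forall p : R, 1 <= p -> W1loc_cvg p%:E W v) &
      {ae lebesgue2, forall x, forall i j, (fun m => lgrad (W m) x i j) @ \oo --> G x i j}].
  apply: (W1loc_limit L0 LW).
  - by move=> m; exact: (iterated0 halpha (n3 m)).
  - apply: ae_mono gd => x hx m.
    by case: (hx m) => [[_ h]|[_ h]|[k [i [b [_ _ _ _ h]]]]]; eexists; exact: h.
  - by apply: ae_mono key => x [A [[h _] _]].
  - by apply: ae_mono key => x [A [[_ h] _]]; exists A.
exists v, G; split => //; split; first by rewrite vW.
have GA x (A : 'M[R]_2) : (forall i j, (fun m => lgrad (W m) x i j) @ \oo --> G x i j) ->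
    has_limits alpha u' RE' x A -> G x = A.
  move=> hG [_ hA]; apply/matrixP => i j.
  exact: (cvg_unique _ (hG i j) (hA i j)).
have x0 : {ae lebesgue2, forall x : R * R, x.1 != 0}.
  have h : (1 : R) != 0 \/ (0 : R) != 0 by left; exact: oner_neq0.
  by apply: ae_mono (ae_line 0 h) => x; rewrite mul1r mul0r addr0.
have all := ae_and h3 (ae_and key (ae_and x0 (ae_and n1 n2))).
split; [|split]; apply: ae_mono all => x [hG [[A [hA [a1 a2 a3]]] [x1 [e1 e2]]]]; rewrite (GA x A hG hA) /eball /=.
- move=> /negP; rewrite -leNgt => h; apply: a1; by rewrite lt_neqAle eq_sym e1.
- exact: a2.
- move=> h /negP; rewrite -leNgt => h'; rewrite a3//; last by rewrite lt_neqAle eq_sym e2.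
  exact: annulus_limE.
Qed.
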